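(* Let $1<p<\infty$ and let $\nu:\mathbb{R}^d\setminus\{0\}\to[0,\infty)$ be measurable and symmetric with $\int_{\mathbb{R}^d}(1\wedge|h|^p)\nu(h)\,dh<\infty$ and $\nu\not\equiv0$, i.e. $|\{\nu>0\}|>0$. Let $\Omega\subset\mathbb{R}^d$ be open, and either bounded in one direction or such that $|\Omega|<\infty$. Write $W=W^p_\nu(\Omega|\mathbb{R}^d)$, $W_\Omega=W^p_{\nu,\Omega}(\Omega|\mathbb{R}^d)$, $T=T^p_\nu(\Omega^c)$. Let $f\in W_\Omega'$ and $g\in T$. (i) (Existence) There is a unique $u\in W$ such that $$(V_0)\qquad u-g\in W_\Omega\quad\text{and}\quad\mathcal{E}(u,v)=\langle f,v\rangle\ \text{ for all }v\in W_\Omega .$$ (ii) (Boundedness) There is $C=C(d,p,\Omega,\nu)>0$ such that for any $\overline g\in W$ with $\overline g|_{\Omega^c}=g$, $$\mathcal{E}(u,u)\le C\big(\|f\|^{p'}_{W_\Omega'}+\mathcal{E}(\overline g,\overline g)\big),\qquad \|u\|_W\le C\big(\|f\|^{p'}_{W_\Omega'}+\|g\|^p_{T}\big)^{1/p}.$$ (iii) (Continuity) Let $u_i$ be the solution associated with $f=f_i$ and $g=g_i$, $i=1,2$. Put $$D=\sum_{i=1}^2\big(\|f_i\|^{p'}_{W_\Omega'}+\|g_i\|^p_T\big)^{1/p'},\qquad R=\big(D^{\frac1{p-1}}+D\big)^{1/2}.$$ If $p\ge2$, then $$\|u_1-u_2\|_W\le C\big(\|f_1-f_2\|^{1/(p-1)}_{W_\Omega'}+\|g_1-g_2\|_T+D^{1/p}\|g_1-g_2\|_T^{1/p}\big).$$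 If $1<p<2$, then $$\|u_1-u_2\|_W\le C\big(D^{\frac{2-p}{p-1}}\|f_1-f_2\|_{W_\Omega'}+\|g_1-g_2\|_T+R\,\|g_1-g_2\|_T^{1/2}\big).$$
   Context: $\nu(h)=\nu(-h)$; $a\wedge b=\min(a,b)$; $\Omega^c=\mathbb{R}^d\setminus\Omega$; $p'=p/(p-1)$; $\psi(t)=|t|^{p-2}t$. $\Omega$ is bounded in one direction if $\Omega\subset\{z:|z\cdot e|\le R_0\}$ for some $R_0>0$ and unit vector $e$. $W^p_\nu(\Omega|\mathbb{R}^d)$: measurable $u:\mathbb{R}^d\to\mathbb{R}$ with $u|_\Omega\in L^p(\Omega)$ and $\int_\Omega\int_{\mathbb{R}^d}|u(x)-u(y)|^p\nu(x-y)\,dy\,dx<\infty$, with (semi)norm $\|u\|_W=\big(\|u\|^p_{L^p(\Omega)}+\int_\Omega\int_{\mathbb{R}^d}|u(x)-u(y)|^p\nu(x-y)\,dy\,dx\big)^{1/p}$. $W^p_{\nu,\Omega}(\Omega|\mathbb{R}^d)=\{u\in W:u=0\text{ a.e. on }\Omega^c\}$ with the same norm; $W_\Omega'$ is its dual with the dual norm. $T^p_\nu(\Omega^c)$: restrictions $v=u|_{\Omega^c}$ of $u\in W$, with $\|v\|_T=\inf\{\|u\|_W:u\in W,\ u|_{\Omega^c}=v\}$. For $g\in T$, ''$u-g\in W_\Omega$'' means $u-\overline g\in W_\Omega$ for an extension $\overline g\in W$ of $g$, i.e. $u=g$ a.e. on $\Omega^c$. $\mathcal{E}(u,v)=\iint_{(\Omega^c\times\Omega^c)^c}\psi(u(x)-u(y))(v(x)-v(y))\nu(x-y)\,dy\,dx$.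 $(V_0)$ is the weak formulation of the Dirichlet problem $Lu=f$ in $\Omega$, $u=g$ on $\Omega^c$, with $Lu(x)=2\,\mathrm{p.v.}\int_{\mathbb{R}^d}\psi(u(x)-u(y))\nu(x-y)\,dy$. In (iii), $C$ denotes a constant of the same kind as in (ii). *)

(* Defs.v *)
From HB Require Import structures.
From mathcomp Require Import all_boot all_order all_algebra.
From mathcomp Require Import all_classical all_reals all_analysis.

Set Implicit Arguments.
Unset Strict Implicit.
Unset Printing Implicit Defensive.

Import Order.TTheory GRing.Theory Num.Theory.
Import numFieldNormedType.Exports.

Local Open Scope classical_set_scope.
Local Open Scope ring_scope.

(* Row vectors carry the sigma-algebra generated by the coordinates, as tuples
   do; on 'rV[R]_n it is the Borel sigma-algebra. *)
Section measurable_rV.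
Context {d : measure_display} {T : measurableType d} (n : nat).

Definition rV_coord (i : 'I_n) (x : 'rV[T]_n) : T := x ord0 i.

Let rV_set0 : g_sigma_preimage rV_coord set0.
Proof. exact: sigma_algebra0. Qed.

Let rV_setC A : g_sigma_preimage rV_coord A -> g_sigma_preimage rV_coord (~` A).
Proof. exact: sigma_algebraC. Qed.

Let rV_bigcup (F : (set 'rV[T]_n)^nat) :
  (forall i, g_sigma_preimage rV_coord (F i)) ->
  g_sigma_preimage rV_coord (\bigcup_i (F i)).
Proof. exact: sigma_algebra_bigcup. Qed.

HB.instance Definition _ := @isMeasurable.Build (measure_tuple_display d)
  'rV[T]_n (g_sigma_preimage rV_coord) rV_set0 rV_setC rV_bigcup.

End measurable_rV.

Lemma measurable_rV_coord d (T : measurableType d) n (i : 'I_n) :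
  measurable_fun setT (@rV_coord d T n i).
Proof.
move=> _ Y mY; rewrite setTI; apply: sub_sigma_algebra => /=.
rewrite -bigcup_seq/=; exists i => /=; first by rewrite mem_index_enum.
by exists Y => //; rewrite setTI.
Qed.

Lemma measurable_fun_rVP d1 d2 (T1 : measurableType d1)
    (T2 : measurableType d2) n (f : T1 -> 'rV[T2]_n) :
  measurable_fun setT f <->
  forall i, measurable_fun setT (fun x => f x ord0 i).
Proof.
split=> [mf i|mf].
  exact: (measurableT_comp (@measurable_rV_coord _ T2 n i) mf).
move=> _ A mA; rewrite setTI.
suff H : g_sigma_preimage (@rV_coord _ T2 n) `<=`
    [set B | measurable (f @^-1` B)] by exact: H.
apply: smallest_sub.
  split => /=.
  - by rewrite preimage_set0.
  - by move=> B mB; rewrite setTD preimage_setC; exact: measurableC.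
  - by move=> F mF; rewrite preimage_bigcup; exact: bigcupT_measurable.
move=> B; rewrite -bigcup_seq/= => -[i /= _ [C mC <-]].
rewrite setTI -comp_preimage -[X in measurable X]setTI.
exact: mf.
Qed.

Section lebesgue_rV.
Context {R : realType}.

Definition rV_cons n (z : R * 'rV[R]_n) : 'rV[R]_n.+1 :=
  \row_i if unlift ord0 i is Some j then z.2 ord0 j else z.1.

Let rV_uncons n (x : 'rV[R]_n.+1) : R * 'rV[R]_n :=
  (x ord0 ord0, \row_i x ord0 (lift ord0 i)).

Let rV_consK n : cancel (@rV_cons n) (@rV_uncons n).
Proof.
case=> a v; rewrite /rV_uncons /rV_cons mxE unlift_none; congr (_, _).
by apply/rowP => i; rewrite !mxE liftK.
Qed.

Lemma measurable_rV_cons n : measurable_fun setT (@rV_cons n).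
Proof.
apply/measurable_fun_rVP => i; case: (unliftP ord0 i) => [j ->|->].
  under eq_fun do rewrite mxE liftK.
  exact: (measurableT_comp (measurable_rV_coord j) measurable_snd).
under eq_fun do rewrite mxE unlift_none.
exact: measurable_fst.
Qed.

Let measurable_rV_uncons n : measurable_fun setT (@rV_uncons n).
Proof.
apply: measurable_fun_pair; first exact: (measurable_rV_coord ord0).
apply/measurable_fun_rVP => i; under eq_fun do rewrite mxE.
exact: (measurable_rV_coord (lift ord0 i)).
Qed.

Section step.
Variables (n : nat) (m : {sigma_finite_measure set 'rV[R]_n -> \bar R}).

Definition lebesgue_rVS : set 'rV[R]_n.+1 -> \bar R :=
  pushforward (@lebesgue_measure R \x m)%E (@rV_cons n).


Let pushcons : {measure set 'rV[R]_n.+1 -> \bar R} :=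
  @measure_function_pushforward__canonical__measure_function_Measure
    _ _ _ _ _ (@lebesgue_measure R \x m)%E _ (@measurable_rV_cons n).

Let lebesgue_rVS0 : lebesgue_rVS set0 = 0%E.
Proof. exact: (measure0 pushcons). Qed.

Let lebesgue_rVS_ge0 A : (0 <= lebesgue_rVS A)%E.
Proof. exact: (measure_ge0 pushcons). Qed.

Let lebesgue_rVS_sigma_additive : semi_sigma_additive lebesgue_rVS.
Proof. exact: (@measure_semi_sigma_additive _ _ _ pushcons). Qed.

HB.instance Definition _ := isMeasure.Build _ _ _ lebesgue_rVS
  lebesgue_rVS0 lebesgue_rVS_ge0 lebesgue_rVS_sigma_additive.

Let lebesgue_rVS_sigma_finite : sigma_finite setT lebesgue_rVS.
Proof.
have /sigma_finiteP[F [TF ndF Foo]] := sigma_finiteT (@lebesgue_measure R).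
have /sigma_finiteP[G [TG ndG Goo]] := sigma_finiteT m.
exists (fun k => @rV_uncons n @^-1` (F k `*` G k)).
  rewrite -preimage_bigcup (_ : \bigcup_k _ = setT) ?preimage_setT//.
  rewrite -subTset => -[x y] _.
  have [k _ Fkx] : (\bigcup_k F k) x by rewrite -TF.
  have [l _ Gly] : (\bigcup_k G k) y by rewrite -TG.
  exists (maxn k l) => //; split.
  - by move: x Fkx; exact/subsetPset/ndF/leq_maxl.
  - by move: y Gly; exact/subsetPset/ndG/leq_maxr.
move=> k; have [mFk Fkoo] := Foo k; have [mGk Gkoo] := Goo k; split.
  rewrite -[X in measurable X]setTI.
  by apply: measurable_rV_uncons => //; exact: measurableX.
rewrite /lebesgue_rVS /pushforward -comp_preimage.
rewrite (_ : _ \o _ = id); last by apply/funext => z; exact: rV_consK.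
by rewrite preimage_id product_measure1E// lte_mul_pinfty// ge0_fin_numE.
Qed.

HB.instance Definition _ := Measure_isSigmaFinite.Build _ _ _ lebesgue_rVS
  lebesgue_rVS_sigma_finite.

End step.

Fixpoint lebesgue_rV n : {sigma_finite_measure set 'rV[R]_n -> \bar R} :=
  if n is n'.+1 then lebesgue_rVS (lebesgue_rV n') else dirac (0 : 'rV[R]_0).

End lebesgue_rV.
Arguments lebesgue_rV {R} n.

Section euclidean.
Context {R : realType} {d : nat}.

Definition dotp (x y : 'rV[R]_d) : R := \sum_i x ord0 i * y ord0 i.

Definition enorm (x : 'rV[R]_d) : R := Num.sqrt (dotp x x).

Definition bounded_in_one_direction (Omega : set 'rV[R]_d) : Prop :=
  exists (R0 : R) (e : 'rV[R]_d),
    [/\ 0 < R0, enorm e = 1 & forall z, Omega z -> `|dotp z e| <= R0].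

End euclidean.

Section nonlocal.
Context {R : realType} {d : nat}.
Notation leb := (@lebesgue_rV R d).
Implicit Types u v g : 'rV[R]_d -> R.

(* nu is a function on R^d \ {0}; its value at 0 plays no role below. *)
Definition levy_kernel (p : R) (nu : 'rV[R]_d -> R) : Prop :=
  [/\ measurable_fun [set h : 'rV[R]_d | h != 0] nu,
      forall h, h != 0 -> 0 <= nu h,
      forall h, h != 0 -> nu (- h) = nu h,
      (\int[leb]_(h in [set h : 'rV[R]_d | h != 0%R])
         (Num.min 1 (enorm h `^ p) * nu h)%:E < +oo)%E &
      (0 < leb [set h | h != 0%R /\ (0 < nu h)%R])%E].

Variables (p : R) (nu : 'rV[R]_d -> R) (Omega : set 'rV[R]_d).

Definition ae_eq_compl u v : Prop :=
  {ae leb, forall x, (~` Omega) x -> u x = v x}.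

Definition Lp_part u : \bar R := (\int[leb]_(x in Omega) (`|u x| `^ p)%:E)%E.

Definition nu_part u : \bar R :=
  (\int[leb]_(x in Omega) \int[leb]_y
     (`|u x - u y| `^ p * nu (x - y))%:E)%E.

(* Functions are not quotiented: equality in the spaces below is equality
   almost everywhere. *)
Definition Wspace : set ('rV[R]_d -> R) :=
  [set u | [/\ measurable_fun setT u, (Lp_part u < +oo)%E
             & (nu_part u < +oo)%E]].

Definition Wnorm u : R := fine (Lp_part u + nu_part u)%E `^ p^-1.

Definition W0space : set ('rV[R]_d -> R) :=
  [set u | Wspace u /\ ae_eq_compl u (cst 0)].

(* An element of the dual of W0space is given by a function whose values
   outside W0space are irrelevant. Linearity and boundedness make it compatible
   with almost everywhere equality. *)
Definition W0dual : set (('rV[R]_d -> R) -> R) :=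
  [set f | (forall (a : R) u v, W0space u -> W0space v ->
             f (fun x => a * u x + v x) = a * f u + f v) /\
           exists M : R, forall v, W0space v -> `|f v| <= M * Wnorm v].

Definition W0dual_norm (f : ('rV[R]_d -> R) -> R) : R :=
  sup [set `|f v| | v in [set v | W0space v /\ Wnorm v <= 1]].

Definition is_extension (g u : 'rV[R]_d -> R) : Prop :=
  Wspace u /\ ae_eq_compl u g.

(* A function on the complement of Omega is given by a function on R^d whose
   values on Omega are irrelevant. *)
Definition Tspace : set ('rV[R]_d -> R) :=
  [set g | exists u, is_extension g u].

Definition Tnorm g : R := inf [set Wnorm u | u in is_extension g].

Definition psi (t : R) : R := `|t| `^ (p - 2) * t.

Definition energy u v : R :=
  \int[(leb \x leb)%E]_(z in ~` (~` Omega `*` ~` Omega))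
    (psi (u z.1 - u z.2) * (v z.1 - v z.2) * nu (z.1 - z.2)).

Definition weak_solution (f : ('rV[R]_d -> R) -> R) g u : Prop :=
  [/\ Wspace u,
      exists2 g', is_extension g g' & W0space (u \- g') &
      forall v, W0space v -> energy u v = f v].

End nonlocal.

(* Main.v *)
From HB Require Import structures.
Require Import Defs.
From mathcomp Require Import all_boot all_order all_algebra.
From mathcomp Require Import all_classical all_reals all_analysis.
From mathcomp Require Import measurable_realfun.
From mathcomp Require Import ring lra.

(** Why the theorem is true. The weighted increment
    [T u (x, y) = nu (x - y) ^ (1 / p) * (u x - u y)], on the pairs that meet
    [Omega], is linear in [u] and takes its values in an L^p space of pairs.
    Since [psi] is homogeneous of degree [p - 1], the energy is the pull-back by
    [T] of the form [<U, V> = \int psi(U) V] of that space ([energyE]):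
    [E(u, v) = <T u, T v>] and [E(u, u) = |T u|^p]. This form is the derivative
    of the convex functional [|U|^p / p], and the theorem rests on two facts:
    this functional is uniformly convex, and on the functions that vanish off
    [Omega] the norm [|T v|] is equivalent to the norm of the energy space.

    Uniform convexity comes from pointwise tangent inequalities for [|t|^p] with
    a remainder. The remainder is [|b - a|^p] for [p >= 2] (from Clarkson's
    inequality) and [|b - a|^2 (|a| + |b|)^(p - 2)] for [p < 2]; integrated, with
    Hoelder's inequality in the second case, they become [pnorm_tangent_ge2] and
    [pnorm_tangent_lt2].

    The Poincare inequality ([poincare]) is where the hypotheses on [nu] and
    [Omega] enter. As [nu] does not vanish almost everywhere, it is at least some
    [de > 0] on a set [A] of jumps of positive measure. For a suitable [n], from
    every point [x] of [Omega] a part of [A] of measure at least [c > 0] consists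
    of jumps [h] such that [x + n h] is outside [Omega] ([jumps_leave_domain]),
    so that [|v x| = |v (x + n h) - v x|] there. A translation by [n h] is a
    composition of [n] translations by [h], and for [h] in [A] these are
    controlled by the energy ([poincare_shift]). With Fatou's lemma, it follows
    that the functions of the energy space that vanish off [Omega] are complete
    for [|T v|] ([W0_complete]).

    A solution is [g + v], where [v] minimizes [|T (g + v)|^p / p - f v]. By
    uniform convexity a minimizing sequence is Cauchy, and the equation is the
    first-order condition at the minimizer ([direct_method]). For the bounds, the
    equation is tested with [u - g]; for the stability, the difference of the two
    equations is tested with [u1 - u2 - h], where [h] is an extension of
    [g1 - g2]. In both cases the terms that contain the unknown are of lower
    degree in it and are absorbed ([powR_absorb]). For [p < 2] the weight of the
    monotonicity estimate involves [|T u1| + |T u2|], which the a priori bounds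
    replace by a power of [D]. These estimates hold for every extension of the
    data, hence with the trace norm, which is the infimum over the extensions
    ([le_continuous_inf]). Uniqueness is stability for equal data. *)

Set Implicit Arguments.
Unset Strict Implicit.
Unset Printing Implicit Defensive.

Import Order.TTheory GRing.Theory Num.Theory.
Import numFieldNormedType.Exports.

Local Open Scope classical_set_scope.
Local Open Scope ring_scope.

(** * Convexity of the power function *)

Section scalar.
Context {R : realType}.
Implicit Types p a b x y : R.

Lemma powR_mul_subr x p q : 0 <= x -> q != 0 -> x `^ p * x `^ (q - p) = x `^ q.
Proof.
by move=> x0 q0; rewrite -powRD subrKC// (negbTE q0).
Qed.

Lemma psi_mul p t : 1 < p -> psi p t * t = `|t| `^ p.
Proof.
move=> p1; rewrite /psi -mulrA -expr2 -real_normK ?num_real// -powR_mulrn//.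
by rewrite mulrC powR_mul_subr// gt_eqF// (lt_trans _ p1).
Qed.

Lemma norm_psi p t : 1 < p -> `|psi p t| = `|t| `^ (p - 1).
Proof.
move=> p1; rewrite /psi normrM norm_powR// normr_id.
have -> : p - 2 = p - 1 - 1 by lra.
by rewrite mulrC mulr_powRB1// subr_gt0.
Qed.

Lemma psiM p s t : 1 < p -> 0 <= s -> psi p (s * t) = s `^ (p - 1) * psi p t.
Proof.
move=> p1 s0; rewrite /psi normrM (ger0_norm s0) powRM//.
have -> : s `^ (p - 1) = s * s `^ (p - 2).
  have -> : p - 2 = p - 1 - 1 by lra.
  by rewrite mulr_powRB1// subr_gt0.
ring.
Qed.

Lemma psiN p t : psi p (- t) = - psi p t.
Proof. by rewrite /psi normrN mulrN. Qed.

Lemma young_powR p x y : 1 < p -> 0 <= x -> 0 <= y ->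
  p * (x `^ (p - 1) * y) <= (p - 1) * x `^ p + y `^ p.
Proof.
move=> p1 x0 y0.
have p0 : 0 < p by rewrite (lt_trans _ p1).
have q0 : 0 < p - 1 by rewrite subr_gt0.
have := @conjugate_powR R (x `^ (p - 1)) y (p / (p - 1)) p (powR_ge0 _ _) y0.
rewrite divr_gt0// => /(_ isT p0); rewrite invf_div.
have -> : (p - 1) / p + p^-1 = 1 by field; rewrite gt_eqF.
move=> /(_ erefl); rewrite -powRrM.
have -> : (p - 1) * (p / (p - 1)) = p by field; rewrite gt_eqF.
rewrite -(ler_pM2l p0) mulrDr.
have -> : p * (x `^ p * ((p - 1) / p)) = (p - 1) * x `^ p.
  by field; rewrite gt_eqF.
by rewrite [p * (_ / p)]mulrC mulfVK// gt_eqF.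
Qed.

(** The cross term [psi p a * b] is at most [|a|^(p - 1) * |b|], to which Young's
    inequality applies. *)
Lemma powR_tangent p a b : 1 < p ->
  `|a| `^ p + p * (psi p a * (b - a)) <= `|b| `^ p.
Proof.
move=> p1; have := young_powR p1 (normr_ge0 a) (normr_ge0 b).
have : psi p a * b <= `|a| `^ (p - 1) * `|b|.
  by rewrite (le_trans (ler_norm _))// normrM norm_psi.
rewrite -(ler_pM2l (lt_trans ltr01 p1)) mulrBr (psi_mul _ p1).
lra.
Qed.

Lemma powR_superadd q x y : 1 <= q -> 0 <= x -> 0 <= y ->
  x `^ q + y `^ q <= (x + y) `^ q.
Proof.
move=> q1 x0 y0; have q0 : 0 < q by rewrite (lt_le_trans _ q1).
rewrite -(mulr_powRB1 x0 q0) -(mulr_powRB1 y0 q0).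
rewrite -(mulr_powRB1 (addr_ge0 x0 y0) q0) mulrDl lerD// ler_wpM2l//;
  apply: ge0_ler_powR; rewrite ?nnegrE ?subr_ge0//; lra.
Qed.

Lemma powR_midpoint q x y : 1 <= q -> 0 <= x -> 0 <= y ->
  2 * ((x + y) / 2) `^ q <= x `^ q + y `^ q.
Proof.
rewrite le_eqVlt => /predU1P[<- x0 y0|q1 x0 y0].
  by rewrite !powRr1//; lra.
have := powR_tangent ((x + y) / 2) x q1.
have := powR_tangent ((x + y) / 2) y q1.
have m0 : 0 <= (x + y) / 2 by lra.
have -> : x - (x + y) / 2 = - (y - (x + y) / 2) by lra.
rewrite mulrN mulrN; rewrite !ger0_norm//; lra.
Qed.

(** Clarkson's inequality: the squares of [x + y] and [x - y] have mean
    [x ^ 2 + y ^ 2], and the power of exponent [p / 2 >= 1] is convex and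
    superadditive. *)
Lemma clarkson p x y : 2 <= p ->
  2 * (`|x| `^ p + `|y| `^ p) <= `|x + y| `^ p + `|x - y| `^ p.
Proof.
move=> p2.
have sqE (t : R) : `|t| `^ p = (t ^+ 2) `^ (p / 2).
  rewrite -real_normK ?num_real// -powR_mulrn// -powRrM; congr (_ `^ _); lra.
have q1 : 1 <= p / 2 by lra.
rewrite !sqE.
have := powR_midpoint q1 (sqr_ge0 (x + y)) (sqr_ge0 (x - y)).
have := powR_superadd q1 (sqr_ge0 x) (sqr_ge0 y).
have -> : ((x + y) ^+ 2 + (x - y) ^+ 2) / 2 = x ^+ 2 + y ^+ 2 by field.
lra.
Qed.

(** Clarkson's inequality for the half sum and the half difference of [a] and
    [b], together with the tangent inequality from [a] to their midpoint. *)
Lemma powR_tangent_ge2 p a b : 2 <= p ->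
  `|a| `^ p + p * (psi p a * (b - a)) + 2 `^ (1 - p) * `|b - a| `^ p
  <= `|b| `^ p.
Proof.
move=> p2; have p1 : 1 < p by lra.
have := clarkson ((a + b) / 2) ((b - a) / 2) p2.
have -> : (a + b) / 2 + (b - a) / 2 = b by lra.
have -> : (a + b) / 2 - (b - a) / 2 = a by lra.
have -> : 2 * (`|(a + b) / 2| `^ p + `|(b - a) / 2| `^ p) =
  2 * `|(a + b) / 2| `^ p + 2 `^ (1 - p) * `|b - a| `^ p.
  rewrite [`|(b - a) / 2|]normrM powRM// mulrDr; congr (_ + _).
  have -> : `|2^-1| = 2 `^ (- 1) :> R by rewrite powR_inv1// ger0_norm.
  rewrite -powRrM mulN1r (@powRD _ 2 1 (- p)) ?powRr1 ?pnatr_eq0 ?implybT//.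
  ring.
have := powR_tangent a ((a + b) / 2) p1.
have -> : (a + b) / 2 - a = (b - a) / 2 by lra.
lra.
Qed.

(** Write [r ^ p = r * r ^ (p - 1)] with [r ^ (p - 1) >= 1 + (p - 1) * ln r], and
    apply [ln s >= 1 - 1 / s] to the square root of [r]: at [r] itself this bound
    of the logarithm has no quadratic gain. *)
Lemma powR_quadratic p r : 1 < p -> 0 <= r -> r <= 2 ->
  1 + p * (r - 1) + (p - 1) / 6 * (r - 1) ^+ 2 <= r `^ p.
Proof.
move=> p1; rewrite le_eqVlt => /predU1P[<- _|r0 r2].
  by rewrite powR0 ?gt_eqF ?(lt_trans _ p1)//; lra.
pose s := Num.sqrt r.
have s0 : 0 < s by rewrite sqrtr_gt0.
have rE : r = s ^+ 2 by rewrite sqr_sqrtr// ltW.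
have lns : 1 - s^-1 <= ln s.
  have := @le_ln1Dx R (s^-1 - 1); rewrite subrKC lnV ?posrE//.
  have : 0 < s^-1 by rewrite invr_gt0.
  by move=> ? h; have := h ltac:(lra); lra.
have rlnr : 2 * s ^+ 2 - 2 * s <= r * ln r.
  rewrite rE lnXn// -(mulr_natl (ln s)).
  have -> : 2 * s ^+ 2 - 2 * s = s ^+ 2 * (2 * (1 - s^-1)).
    by field; rewrite gt_eqF.
  by rewrite ler_wpM2l ?sqr_ge0// ler_wpM2l.
have : r * (1 + (p - 1) * ln r) <= r `^ p.
  rewrite -(mulr_powRB1 (ltW r0)) ?(lt_trans _ p1)// ler_wpM2l ?(ltW r0)//.
  by rewrite /powR gt_eqF// expR_ge1Dx.
have s2 : s ^+ 2 <= 2 by rewrite -rE.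
(* 6 bounds [(s + 1) ^ 2 = s ^ 2 + 2 * s + 1] for [s ^ 2 <= 2] *)
have s15 : s <= 3 / 2 by nra.
have : (s ^+ 2 - 1) ^+ 2 / 6 <= (s - 1) ^+ 2.
  have -> : (s ^+ 2 - 1) ^+ 2 = (s - 1) ^+ 2 * (s + 1) ^+ 2 by ring.
  rewrite ler_pdivrMr// ler_wpM2l ?sqr_ge0//.
  have : (s + 1) ^+ 2 = s ^+ 2 + 2 * s + 1 by ring.
  lra.
rewrite -rE => sr rp; apply: le_trans rp.
have /ler_wpM2l/(_ _ _ rlnr) : 0 <= p - 1 by lra.
have /ler_wpM2l/(_ _ _ sr) : 0 <= p - 1 by lra.
rewrite !mulrBr mulrDr mulr1 rE; lra.
Qed.

Lemma powR_quadratic_base p m x : 1 < p -> 0 < m -> 0 <= x -> x <= 2 * m ->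
  m `^ p + p * (m `^ (p - 1) * (x - m))
    + (p - 1) / 6 * (m `^ (p - 2) * (x - m) ^+ 2) <= x `^ p.
Proof.
move=> p1 m0 x0 xm.
have r0 : 0 <= x / m by rewrite divr_ge0// ltW.
have r2 : x / m <= 2 by rewrite ler_pdivrMr.
have mp : 0 <= m `^ p by exact: powR_ge0.
have := ler_wpM2l mp (powR_quadratic p1 r0 r2).
rewrite -powRM ?(ltW m0)//.
have -> : m * (x / m) = x by field; rewrite gt_eqF.
have -> : m `^ (p - 1) = m `^ p / m.
  rewrite powRB ?powRr1 ?(ltW m0)//.
  by rewrite (gt_eqF m0) implybT.
have -> : m `^ (p - 2) = m `^ p / m ^+ 2.
  rewrite powRB; first by rewrite (powR_mulrn 2) ?(ltW m0).
  by rewrite (gt_eqF m0) implybT.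
apply: le_trans; rewrite le_eqVlt; apply/orP; left; apply/eqP.
by field; rewrite gt_eqF.
Qed.

(** The second derivative of the power is unbounded near the origin and decreases
    away from it, whence the weight. For [a] and [b] of the same sign the
    expansion is made at their midpoint, because either of them is at most twice
    the midpoint. *)
Lemma powR_tangent_lt2 p a b : 1 < p < 2 ->
  `|a| `^ p + p * (psi p a * (b - a))
    + (p - 1) / 12 * (`|b - a| ^+ 2 * (`|a| + `|b|) `^ (p - 2)) <= `|b| `^ p.
Proof.
move=> /andP[p1 p2].
have Sp (S : R) : 0 <= S -> S ^+ 2 * S `^ (p - 2) = S `^ p.
  by move=> S0; rewrite -powR_mulrn// powR_mul_subr//; lra.
have bound : 0 <= (p - 1) / 12 <= 1 by lra.
(* for opposite signs the linear term contains [- p * |x| ^ p], which pays for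
   the remainder *)
have opp (x y : R) : x <= 0 -> 0 <= y ->
  `|x| `^ p + p * (psi p x * (y - x))
    + (p - 1) / 12 * (`|y - x| ^+ 2 * (`|x| + `|y|) `^ (p - 2)) <= `|y| `^ p.
  move=> x0 y0; rewrite mulrBr (psi_mul _ p1).
  have -> : `|y - x| = `|x| + `|y|.
    rewrite (ler0_norm x0) (ger0_norm y0) ger0_norm; lra.
  rewrite Sp; last by rewrite addr_ge0.
  have psi0 : psi p x * y <= 0.
    by rewrite mulr_le0_ge0// /psi mulr_ge0_le0// powR_ge0.
  have : (`|x| + `|y|) `^ p <= 4 * (`|x| `^ p + `|y| `^ p).
    have := powR_midpoint (ltW p1) (normr_ge0 x) (normr_ge0 y).
    rewrite [((_ + _) / _) `^ _]powRM ?addr_ge0//.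
    have : 4^-1 <= 2^-1 `^ p :> R.
      have -> : 4^-1 = (2^-1) `^ 2 :> R.
        rewrite (powR_mulrn 2)//; lra.
      by apply: ger_powR; lra.
    move=> /(ler_wpM2l (powR_ge0 (`|x| + `|y|) p)).
    by have := powR_ge0 `|x| p; have := powR_ge0 `|y| p; lra.
  have := powR_ge0 `|x| p; have := powR_ge0 `|y| p.
  move: (`|x| `^ p) (`|y| `^ p) ((`|x| + `|y|) `^ p) => X Y S Y0 X0 SXY.
  have h1 : (p - 1) / 12 * S <= (p - 1) / 12 * (4 * (X + Y)).
    by rewrite ler_wpM2l//; lra.
  have h2 : 0 <= (p - 1) * X by rewrite mulr_ge0//; lra.
  have h3 : 0 <= (2 - p) * Y by rewrite mulr_ge0//; lra.
  have h4 : p * (psi p x * y) <= 0 by rewrite mulr_ge0_le0//; lra.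
  lra.
(* the linear terms of the expansions towards [x] and [y] cancel, and the
   tangent at [x] bounds the power of the midpoint from below *)
have same (x y : R) : 0 <= x -> 0 <= y ->
  `|x| `^ p + p * (psi p x * (y - x))
    + (p - 1) / 12 * (`|y - x| ^+ 2 * (`|x| + `|y|) `^ (p - 2)) <= `|y| `^ p.
  move=> x0 y0; have [S0|S0] := leP (x + y) 0.
    have -> : x = 0 by lra.
    have -> : y = 0 by lra.
    by rewrite subr0 normr0 expr0n/= powR0; lra.
  have := powR_tangent x ((x + y) / 2) p1.
  have m0 : 0 < (x + y) / 2 by lra.
  have := @powR_quadratic_base p _ x p1 m0 x0 ltac:(lra).
  have := @powR_quadratic_base p _ y p1 m0 y0 ltac:(lra).
  rewrite real_normK ?num_real// !ger0_norm ?(ltW m0)//.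
  have -> : (x + y) / 2 - x = (y - x) / 2 by lra.
  have -> : y - (x + y) / 2 = (y - x) / 2 by lra.
  have -> : x - (x + y) / 2 = - ((y - x) / 2) by lra.
  have : (x + y) `^ (p - 2) <= ((x + y) / 2) `^ (p - 2).
    have -> : p - 2 = - (2 - p) by lra.
    rewrite !powRN lef_pV2 ?posrE ?powR_gt0//.
    by apply: ge0_ler_powR; rewrite ?nnegrE; lra.
  move=> /(ler_wpM2l (sqr_ge0 (y - x))).
  have p10 : 0 <= (p - 1) / 12 by lra.
  move=> /(ler_wpM2l p10).
  rewrite sqrrN expr_div_n.
  lra.
have [a0|a0] := leP 0 a; have [b0|b0] := leP 0 b.
- exact: same.
- have := opp (- a) (- b); rewrite psiN !normrN !opprK.
  have -> : - b + a = - (b - a) by lra.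
  by rewrite normrN mulrNN; apply; lra.
- by apply: opp; lra.
- have := same (- a) (- b); rewrite psiN !normrN !opprK.
  have -> : - b + a = - (b - a) by lra.
  by rewrite normrN mulrNN; apply; lra.
Qed.

(** With the negative power of the weight moved to the other side, the estimate
    can be integrated by Hoelder's inequality, and it makes sense even where both
    arguments vanish. *)
Lemma powR_excess_lt2 p a b : 1 < p < 2 ->
  `|b - a| ^+ 2 <= ((p - 1) / 12)^-1
    * (`|b| `^ p - (`|a| `^ p + p * (psi p a * (b - a))))
    * (`|a| + `|b|) `^ (2 - p).
Proof.
move=> pp; have := powR_tangent_lt2 a b pp.
move: pp => /andP[p1 p2].
have c0 : 0 < (p - 1) / 12 by lra.
move: (powR_tangent a b p1); rewrite -subr_ge0.
set h := `|b| `^ p - _ => h0 hh.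
have [S0|S0] := leP (`|a| + `|b|) 0.
  have /eqP : `|a| = 0 by have := normr_ge0 a; have := normr_ge0 b; lra.
  have /eqP : `|b| = 0 by have := normr_ge0 a; have := normr_ge0 b; lra.
  rewrite !normr_eq0 => /eqP -> /eqP ->.
  rewrite subrr normr0 expr0n mulr_ge0 ?powR_ge0// mulr_ge0//.
  by rewrite invr_ge0 ltW.
rewrite -mulrA ler_pdivlMl//.
have {}hh : (p - 1) / 12 * (`|b - a| ^+ 2 * (`|a| + `|b|) `^ (p - 2)) <= h.
  by rewrite /h; lra.
have := ler_wpM2r (powR_ge0 (`|a| + `|b|) (2 - p)) hh.
apply: le_trans; rewrite -!mulrA -powRD; last by rewrite (gt_eqF S0) implybT.
have -> : p - 2 + (2 - p) = 0 by lra.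
by rewrite powRr0 mulr1 lexx.
Qed.

(** The hypothesis is what Hoelder's inequality with the exponents [2 / p] and
    [2 / (2 - p)] gives for the integral of [powR_excess_lt2]. *)
Lemma powR_hoelder_lt2 p a b h : 1 < p < 2 -> 0 <= a -> 0 <= b -> 0 <= h ->
  a `^ p <= h `^ (2 / p)^-1 * (b `^ p) `^ (2 / (2 - p))^-1 ->
  a `^ 2 <= h * b `^ (2 - p).
Proof.
move=> /andP[p1 p2] a0 b0 h0; have p0 : 0 < p by lra.
have q0 : 0 <= 2 / p by rewrite divr_ge0// ltW.
move=> /(ge0_ler_powR q0); rewrite !nnegrE => /(_ (powR_ge0 _ _)).
move=> /(_ (mulr_ge0 (powR_ge0 _ _) (powR_ge0 _ _))).
rewrite [(_ * _) `^ (2 / p)]powRM ?powR_ge0// -!powRrM.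
have -> : p * (2 / p) = 2 by field; rewrite gt_eqF.
have -> : (2 / p)^-1 * (2 / p) = 1 by field; rewrite gt_eqF.
have -> : p * ((2 / (2 - p))^-1 * (2 / p)) = 2 - p.
  by field; rewrite subr_eq0 !gt_eqF.
by rewrite powRr1.
Qed.

End scalar.

(** * The form of the space of p-integrable functions *)

Section integrable.
Context {R : realType} d {X : measurableType d} (m : {measure set X -> \bar R}).
Implicit Types (f g U V W : X -> R).

Definition Rintegrable f := m.-integrable setT (EFin \o f).

Lemma RintegrableD f g : Rintegrable f -> Rintegrable g ->
  Rintegrable (fun x => f x + g x).
Proof.
move=> fi gi; rewrite /Rintegrable (_ : _ \o _ = (EFin \o f) \+ (EFin \o g))%E//.
exact: integrableD.
Qed.

Lemma RintegrableZ k f : Rintegrable f -> Rintegrable (fun x => k * f x).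
Proof.
by move=> fi; rewrite /Rintegrable (_ : _ \o _ = fun x => (k%:E * (EFin \o f) x)%E)//;
  exact: integrableZl.
Qed.

Lemma RintegrableB f g : Rintegrable f -> Rintegrable g ->
  Rintegrable (fun x => f x - g x).
Proof.
move=> fi gi; rewrite /Rintegrable (_ : _ \o _ = (EFin \o f) \- (EFin \o g))%E//.
exact: integrableB.
Qed.

Lemma Rintegrable_measurable f : Rintegrable f -> measurable_fun setT f.
Proof. by move=> /(measurable_int m) /measurable_EFinP. Qed.

Lemma le_Rintegrable f g : measurable_fun setT f ->
  (forall x, `|f x| <= g x) -> Rintegrable g -> Rintegrable f.
Proof.
move=> mf fg; apply: le_integrable => //; first exact/measurable_EFinP.
by move=> x _ /=; rewrite lee_fin (le_trans (fg x))// ler_norm.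
Qed.

Lemma Rhoelder f g a b : measurable_fun setT f -> measurable_fun setT g ->
  (forall x, 0 <= f x) -> (forall x, 0 <= g x) ->
  0 < a -> 0 < b -> a^-1 + b^-1 = 1 ->
  Rintegrable (fun x => f x `^ a) -> Rintegrable (fun x => g x `^ b) ->
  Rintegrable (fun x => f x * g x) /\
  \int[m]_x (f x * g x) <=
    (\int[m]_x (f x `^ a)) `^ a^-1 * (\int[m]_x (g x `^ b)) `^ b^-1.
Proof.
move=> mf mg f0 g0 a0 b0 ab fi gi.
have N (h : X -> R) c : 0 < c -> (forall x, 0 <= h x) ->
    Rintegrable (fun x => h x `^ c) ->
    Lnorm m c%:E (EFin \o h) = ((\int[m]_x (h x `^ c)) `^ c^-1)%:E.
  move=> c0 h0 hi; rewrite unlock -poweR_EFin; congr (_ `^ _)%E.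
  rewrite fineK; last exact: integrable_fin_num.
  by apply: eq_integral => x _ /=; rewrite ger0_norm.
have := hoelder m mf mg a0 b0 ab; rewrite (N f)// (N g)// Lnorm1 -EFinM => h.
have mfg : measurable_fun setT (fun x => f x * g x) by exact: measurable_funM.
have i : Rintegrable (fun x => f x * g x).
  apply/integrableP; split; first exact/measurable_EFinP.
  by apply: le_lt_trans h _; rewrite ltry.
split => //; rewrite -lee_fin fineK; last exact: integrable_fin_num.
apply: le_trans h; rewrite le_eqVlt; apply/orP; left; apply/eqP.
by apply: eq_integral => x _ /=; rewrite ger0_norm// mulr_ge0.
Qed.

End integrable.

Definition inLp {R : realType} d {X : measurableType d}
    (m : {measure set X -> \bar R}) (p : R) (U : X -> R) :=
  measurable_fun setT U /\ Rintegrable m (fun x => `|U x| `^ p).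

(** Both operations below are locked, so that unification treats them as atoms
    and does not open the integrals. *)
HB.lock Definition pnorm {R : realType} d {X : measurableType d}
    (m : {measure set X -> \bar R}) (p : R) (U : X -> R) : R :=
  (\int[m]_x (`|U x| `^ p)) `^ p^-1.

(** The derivative of [pnorm m p ^ p / p] at [U] in the direction [V]. *)
HB.lock Definition pform {R : realType} d {X : measurableType d}
    (m : {measure set X -> \bar R}) (p : R) (U V : X -> R) : R :=
  \int[m]_x (psi p (U x) * V x).

Arguments pnorm {R d X} m p U.
Arguments pform {R d X} m p U V.

Section Lp.
Context {R : realType} d {X : measurableType d} (m : {measure set X -> \bar R}).
Implicit Types (f g U V W : X -> R).

Variable (p : R).
Local Notation inLp := (inLp m p).
Local Notation pnorm := (pnorm m p).
Local Notation pform := (pform m p).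
Local Notation Rintegrable := (Rintegrable m).
Hypothesis p1 : 1 < p.
Let p0 : 0 < p. Proof. by rewrite (lt_trans _ p1). Qed.

Lemma measurable_psi f : measurable_fun setT f ->
  measurable_fun setT (fun x => psi p (f x)).
Proof.
move=> mf; apply: measurable_funM => //.
apply: (measurableT_comp (measurable_powR _)).
exact: measurableT_comp.
Qed.

Lemma measurable_normp f q : measurable_fun setT f ->
  measurable_fun setT (fun x => `|f x| `^ q).
Proof.
move=> mf; apply: (measurableT_comp (measurable_powR _)).
exact: measurableT_comp.
Qed.

Lemma powR_normD_le (x y : R) : `|x + y| `^ p <= 2 `^ p * (`|x| `^ p + `|y| `^ p).
Proof.
have := powR_midpoint (ltW p1) (normr_ge0 x) (normr_ge0 y).
have h : `|x + y| `^ p <= (2 * ((`|x| + `|y|) / 2)) `^ p.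
  rewrite mulrCA divff// mulr1.
  apply: ge0_ler_powR; rewrite ?nnegrE ?(ltW p0) ?addr_ge0//.
  exact: ler_normD.
move=> h2; apply: (le_trans h); rewrite powRM ?divr_ge0 ?addr_ge0//.
rewrite ler_wpM2l ?powR_ge0//.
by have := powR_ge0 ((`|x| + `|y|) / 2) p; lra.
Qed.

Lemma inLp0 : inLp (cst 0).
Proof.
split => //; rewrite /Rintegrable (_ : _ \o _ = cst 0%E); last first.
  by apply/funext => x /=; rewrite normr0 powR0// gt_eqF.
exact: integrable0.
Qed.

Lemma inLpD U V : inLp U -> inLp V -> inLp (fun x => U x + V x).
Proof.
move=> [mU iU] [mV iV].
have mUV : measurable_fun setT (fun x => U x + V x) by exact: measurable_funD.
split => //.
apply: (@le_Rintegrable _ _ _ m _ (fun x => 2 `^ p * (`|U x| `^ p + `|V x| `^ p))).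
- exact: measurable_normp.
- by move=> x; rewrite ger0_norm ?powR_ge0//; exact: powR_normD_le.
- by apply: RintegrableZ; exact: RintegrableD.
Qed.

Lemma inLpZ k U : inLp U -> inLp (fun x => k * U x).
Proof.
move=> [mU iU]; split; first exact: measurable_funM.
rewrite /Rintegrable.
rewrite (_ : _ \o _ = EFin \o (fun x => `|k| `^ p * `|U x| `^ p)).
  exact: RintegrableZ.
by apply/funext => x /=; rewrite normrM powRM.
Qed.

Lemma inLpB U V : inLp U -> inLp V -> inLp (fun x => U x - V x).
Proof.
move=> lU /(inLpZ (-1)) lV; have := inLpD lU lV.
by under eq_fun do rewrite mulN1r.
Qed.

Lemma inLp_norm U : inLp U -> inLp (fun x => `|U x|).
Proof.
move=> [mU iU]; split; first exact: measurableT_comp.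
by under eq_fun do rewrite normr_id.
Qed.

Lemma pnorm_ge0 U : 0 <= pnorm U. Proof. by rewrite pnorm.unlock powR_ge0. Qed.

Lemma pnormE U : pnorm U `^ p = \int[m]_x (`|U x| `^ p).
Proof.
rewrite pnorm.unlock -powRrM mulVf ?gt_eqF// powRr1//.
by apply: Rintegral_ge0 => x _; exact: powR_ge0.
Qed.

Lemma pnormZ k U : inLp U -> pnorm (fun x => k * U x) = `|k| * pnorm U.
Proof.
move=> [mU iU]; rewrite pnorm.unlock.
under eq_Rintegral do rewrite normrM powRM//.
rewrite RintegralZl// powRM ?powR_ge0//; last first.
  by apply: Rintegral_ge0 => x _; exact: powR_ge0.
by rewrite -powRrM divff ?gt_eqF// powRr1.
Qed.

Lemma pnormN U : pnorm (fun x => - U x) = pnorm U.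
Proof. by rewrite pnorm.unlock; under eq_Rintegral do rewrite normrN. Qed.

Lemma pnorm_norm U : pnorm (fun x => `|U x|) = pnorm U.
Proof. by rewrite pnorm.unlock; under eq_Rintegral do rewrite normr_id. Qed.

Lemma pnormD U V : inLp U -> inLp V ->
  pnorm (fun x => U x + V x) <= pnorm U + pnorm V.
Proof.
move=> lU lV; have [mU iU] := lU; have [mV iV] := lV.
have [mUV iUV] := inLpD lU lV.
have N (h : X -> R) : Rintegrable (fun x => `|h x| `^ p) ->
    Lnorm m p%:E (EFin \o h) = (pnorm h)%:E.
  move=> hi; rewrite unlock pnorm.unlock -poweR_EFin; congr (_ `^ _)%E.
  by rewrite fineK; last exact: integrable_fin_num.
have := minkowski_EFin m mU mV (ltW p1).
by rewrite !N.
Qed.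

Lemma pnormB U V : inLp U -> inLp V ->
  pnorm (fun x => U x - V x) <= pnorm U + pnorm V.
Proof.
move=> lU lV; rewrite -[pnorm V]pnormN; apply: pnormD => //.
by have := inLpZ (-1) lV; under eq_fun do rewrite mulN1r.
Qed.

Lemma pform_integrable U V : inLp U -> inLp V ->
  Rintegrable (fun x => psi p (U x) * V x).
Proof.
move=> [mU iU] [mV iV].
apply: (@le_Rintegrable _ _ _ m _ (fun x => p^-1 * ((p - 1) * `|U x| `^ p + `|V x| `^ p))).
- by apply: measurable_funM => //; exact: measurable_psi.
- move=> x; rewrite normrM norm_psi// ler_pdivlMl//.
  exact: young_powR.
- by apply: RintegrableZ; apply: RintegrableD => //; exact: RintegrableZ.
Qed.

Lemma pform_diag U : pform U U = pnorm U `^ p.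
Proof. by rewrite pnormE pform.unlock; under eq_Rintegral do rewrite psi_mul//. Qed.

Lemma pformZr k U V : inLp U -> inLp V ->
  pform U (fun x => k * V x) = k * pform U V.
Proof.
move=> lU lV; rewrite pform.unlock; under eq_Rintegral do rewrite mulrCA.
by rewrite RintegralZl//; exact: pform_integrable.
Qed.

Lemma pformBr U V W : inLp U -> inLp V -> inLp W ->
  pform U (fun x => V x - W x) = pform U V - pform U W.
Proof.
move=> lU lV lW; rewrite pform.unlock; under eq_Rintegral do rewrite mulrBr.
by rewrite RintegralB//; exact: pform_integrable.
Qed.

Lemma pform_le U V : inLp U -> inLp V ->
  `|pform U V| <= pnorm U `^ (p - 1) * pnorm V.
Proof.
move=> lU lV; have [mU iU] := lU; have [mV iV] := lV; rewrite pform.unlock.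
apply: le_trans (le_normr_Rintegral measurableT (pform_integrable lU lV)) _.
under eq_Rintegral do rewrite normrM norm_psi//.
have p10 : 0 < p - 1 by rewrite subr_gt0.
have E (x : R) : (x `^ (p - 1)) `^ (p / (p - 1)) = x `^ p.
  by rewrite -powRrM; congr (_ `^ _); field; rewrite gt_eqF.
have -> : pnorm U `^ (p - 1) =
    (\int[m]_x ((`|U x| `^ (p - 1)) `^ (p / (p - 1)))) `^ (p / (p - 1))^-1.
  under eq_Rintegral do rewrite E.
  by rewrite -pnormE -powRrM; congr (_ `^ _); field; rewrite !gt_eqF.
have [] // := @Rhoelder _ _ _ m (fun x => `|U x| `^ (p - 1)) (fun x => `|V x|)
  (p / (p - 1)) p.
- exact: measurable_normp.
- exact: measurableT_comp.
- by rewrite divr_gt0.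
- by field; rewrite !gt_eqF.
- by rewrite /Rintegrable; under eq_fun do rewrite /= E.
- by move=> _; rewrite pnorm.unlock.
Qed.

Lemma pnorm_tangent_ge2 U V : 2 <= p -> inLp U -> inLp V ->
  pnorm U `^ p + p * pform U (fun x => V x - U x)
    + 2 `^ (1 - p) * pnorm (fun x => V x - U x) `^ p <= pnorm V `^ p.
Proof.
move=> p2 lU lV; have [mU iU] := lU; have [mV iV] := lV.
have lW := inLpB lV lU; have [mW iW] := lW; have iF := pform_integrable lU lW.
have iPF := RintegrableZ p iF.
have iT := RintegrableD iU iPF.
have iQW := RintegrableZ (2 `^ (1 - p)) iW.
have := le_Rintegral measurableT (RintegrableD iT iQW) iV
  (fun x _ => powR_tangent_ge2 (U x) (V x) p2).
by rewrite (RintegralD _ iT iQW)// (RintegralD _ iU iPF)// !RintegralZl// -!pnormE pform.unlock.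
Qed.

Lemma pnorm_tangent U V : inLp U -> inLp V ->
  pnorm U `^ p + p * pform U (fun x => V x - U x) <= pnorm V `^ p.
Proof.
move=> lU lV; have [mU iU] := lU; have [mV iV] := lV.
have lW := inLpB lV lU; have iF := pform_integrable lU lW.
have iPF := RintegrableZ p iF.
have iT := RintegrableD iU iPF.
have := le_Rintegral measurableT iT iV
  (fun x _ => powR_tangent (U x) (V x) p1).
by rewrite (RintegralD _ iU iPF)// RintegralZl// -!pnormE pform.unlock.
Qed.

(** The integrated excess [h] and the integral of [(|U| + |V|) ^ p] bound the
    [p]-th power of the norm of [V - U], by Hoelder's inequality with the
    exponents [2 / p] and [2 / (2 - p)]. *)
Lemma pnorm_tangent_lt2 U V : p < 2 -> inLp U -> inLp V ->
  (p - 1) / 12 * pnorm (fun x => V x - U x) `^ 2 <=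
  (pnorm U + pnorm V) `^ (2 - p) *
    (pnorm V `^ p - (pnorm U `^ p + p * pform U (fun x => V x - U x))).
Proof.
move=> p2 lU lV; have [mU iU] := lU; have [mV iV] := lV.
have lW := inLpB lV lU; have [mW iW] := lW; have iF := pform_integrable lU lW.
have iPF := RintegrableZ p iF.
have iT := RintegrableD iU iPF.
pose c : R := (p - 1) / 12; have c0 : 0 < c by rewrite /c divr_gt0// subr_gt0.
pose h x := `|V x| `^ p - (`|U x| `^ p + p * (psi p (U x) * (V x - U x))).
pose S x := `|U x| + `|V x|.
have lS : inLp S by apply: inLpD; exact: inLp_norm.
have [mS iS] := lS.
have S0 x : 0 <= S x by exact: addr_ge0.
have h0 x : 0 <= h x by rewrite subr_ge0; exact: powR_tangent.
have ih : Rintegrable h by exact: RintegrableB.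
have mh : measurable_fun setT h by exact: (Rintegrable_measurable ih).
have hE : \int[m]_x h x =
    pnorm V `^ p - (pnorm U `^ p + p * pform U (fun x => V x - U x)).
  rewrite /h (RintegralB _ iV iT)// (RintegralD _ iU iPF)// RintegralZl//.
  by rewrite -!pnormE pform.unlock.
rewrite -hE -/c -ler_pdivlMl//.
set w := fun x => V x - U x.
have wle x : `|w x| `^ p <= (c^-1 * h x) `^ (p / 2) * (S x `^ (2 - p)) `^ (p / 2).
  have w2 : `|w x| ^+ 2 <= c^-1 * h x * S x `^ (2 - p).
    by apply: powR_excess_lt2; rewrite p1.
  rewrite -powRM ?powR_ge0//; last by rewrite mulr_ge0// invr_ge0 ltW.
  have -> : `|w x| `^ p = (`|w x| ^+ 2) `^ (p / 2).
    by rewrite -powR_mulrn// -powRrM mulrCA divff// mulr1.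
  apply: ge0_ler_powR => //; rewrite ?nnegrE ?exprn_ge0 ?divr_ge0 ?(ltW p0)//.
  by rewrite mulr_ge0 ?powR_ge0// mulr_ge0// invr_ge0 ltW.
have E1 (x : R) : 0 <= x -> (x `^ (p / 2)) `^ (2 / p) = x.
  move=> x0; rewrite -powRrM.
  have -> : p / 2 * (2 / p) = 1 by field; rewrite gt_eqF.
  by rewrite powRr1.
have E2 (x : R) : ((x `^ (2 - p)) `^ (p / 2)) `^ (2 / (2 - p)) = x `^ p.
  by rewrite -!powRrM; congr (_ `^ _); field; rewrite subr_eq0 gt_eqF.
have ch0 x : 0 <= c^-1 * h x by rewrite mulr_ge0// invr_ge0 ltW.
have ich := RintegrableZ c^-1 ih.
have [] := @Rhoelder _ _ _ m (fun x => (c^-1 * h x) `^ (p / 2))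
  (fun x => (S x `^ (2 - p)) `^ (p / 2)) (2 / p) (2 / (2 - p)).
- by apply: (measurableT_comp (measurable_powR _)); exact: measurable_funM.
- apply: (measurableT_comp (measurable_powR _)).
  exact: (measurableT_comp (measurable_powR _)).
- by move=> x; exact: powR_ge0.
- by move=> x; exact: powR_ge0.
- by rewrite divr_gt0.
- by rewrite divr_gt0// subr_gt0.
- by field; rewrite subr_eq0 !gt_eqF.
- by rewrite /Rintegrable; under eq_fun do rewrite /= E1//.
- rewrite /Rintegrable (_ : _ \o _ = EFin \o (fun x => `|S x| `^ p))//.
  by apply/funext => x /=; rewrite E2 ger0_norm.
move=> iH.
under [X in _ <= X `^ _ * _]eq_Rintegral do rewrite E1//.
under [X in _ <= _ * X `^ _]eq_Rintegral do rewrite E2//.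
under [X in _ <= _ * X `^ _]eq_Rintegral do rewrite -[S _]ger0_norm//.
rewrite -pnormE RintegralZl// => HH.
have : pnorm w `^ p <= (c^-1 * \int[m]_x h x) `^ (2 / p)^-1 *
    (pnorm S `^ p) `^ (2 / (2 - p))^-1.
  by apply: le_trans HH; rewrite pnormE; apply: le_Rintegral.
have ih0 : 0 <= \int[m]_x h x by apply: Rintegral_ge0.
have ch : 0 <= c^-1 * \int[m]_x h x by rewrite mulr_ge0// invr_ge0 ltW.
have pp : 1 < p < 2 by rewrite p1.
move=> /(powR_hoelder_lt2 pp (pnorm_ge0 _) (pnorm_ge0 _) ch) H.
apply: (le_trans H); rewrite -mulrA ler_wpM2l//; first by rewrite invr_ge0 ltW.
rewrite mulrC ler_wpM2r//; apply: ge0_ler_powR.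
- by rewrite subr_ge0 ltW.
- exact: pnorm_ge0.
- by rewrite nnegrE addr_ge0// pnorm_ge0.
by rewrite -[pnorm U]pnorm_norm -[pnorm V]pnorm_norm; apply: pnormD; exact: inLp_norm.
Qed.

End Lp.

(** * Existence by minimization *)

Lemma continuous_powR {R : realType} (q x : R) : 0 < x ->
  {for x, continuous (@powR R ^~ q)}.
Proof.
move=> x0; apply: differentiable_continuous; apply/derivable1_diffP.
by apply: derivable_powR; rewrite in_itv/= x0.
Qed.

Lemma continuous_psi {R : realType} (p : R) : 1 < p -> continuous (psi p).
Proof.
move=> p1 t; have p10 : 0 < p - 1 by rewrite subr_gt0.
have [->|t0] := eqVneq t 0.
  apply/cvgrPdist_lt => e e0;
  near=> s; rewrite {1}/psi mulr0 sub0r normrN norm_psi//.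
  have -> : e = (e `^ (p - 1)^-1) `^ (p - 1).
    by rewrite -powRrM mulVf ?gt_eqF// powRr1// ltW.
  apply: gt0_ltr_powR; rewrite ?nnegrE ?powR_ge0//.
  near: s; exists (e `^ (p - 1)^-1); first exact: powR_gt0.
  by move=> y /=; rewrite sub0r normrN.
rewrite /psi; apply: cvgM; last exact: cvg_id.
apply: (@cvg_comp _ _ _ (@Num.norm _ R) (@powR R ^~ (p - 2)) _ (nbhs `|t|)).
  exact: norm_continuous.
by apply: continuous_powR; rewrite normr_gt0.
Unshelve. all: by end_near. Qed.

Section existence.
Context {R : realType} d {X : measurableType d} (m : {measure set X -> \bar R}).
Variable p : R.
Hypothesis p1 : 1 < p.
Let p0 : 0 < p. Proof. by rewrite (lt_trans _ p1). Qed.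
Implicit Types (U V W : X -> R).
Local Notation inLp := (inLp m p).
Local Notation pnorm := (pnorm m p).
Local Notation pform := (pform m p).

(** The steps are at most 1, so the integrands are dominated by
    [(|U| + |W|) ^ (p - 1) * |W|]. *)
Lemma pform_hemicontinuous U W : inLp U -> inLp W ->
  (fun n : nat => pform (fun x => U x + n.+1%:R^-1 * W x) W) @ \oo
    --> pform U W.
Proof.
move=> lU lW; have [mU _] := lU; have [mW _] := lW.
have lD : inLp (fun x => `|U x| + `|W x|) by apply: inLpD => //; exact: inLp_norm.
have lN : inLp (fun x => `|W x|) by exact: inLp_norm.
have [] := @dominated_convergence _ _ _ m setT measurableT
  (fun n x => (psi p (U x + n.+1%:R^-1 * W x) * W x)%:E)
  (fun x => (psi p (U x) * W x)%:E)
  (fun x => (psi p (`|U x| + `|W x|) * `|W x|)%:E).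
- move=> n; apply/measurable_EFinP; apply: measurable_funM => //.
  by apply: measurable_psi; apply: measurable_funD => //; exact: measurable_funM.
- by apply/measurable_EFinP; apply: measurable_funM => //; exact: measurable_psi.
- apply: aeW => x _; apply: cvg_EFin; first exact: nearW.
  apply: cvgMl => /=.
  have h : (fun n : nat => U x + n.+1%:R^-1 * W x) @ \oo --> U x + 0 * W x.
    by apply: cvgD; [exact: cvg_cst|apply: cvgMl; exact: cvg_harmonic].
  rewrite mul0r addr0 in h.
  by apply: (cvg_comp _ (psi p) h); exact: continuous_psi.
- exact: pform_integrable.
- apply: aeW => x n _ /=; rewrite lee_fin normrM.
  rewrite ler_wpM2r// norm_psi// -[psi p (_ + _)]ger0_norm; last first.
    by rewrite /psi mulr_ge0 ?powR_ge0// addr_ge0.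
  rewrite norm_psi//; apply: ge0_ler_powR; rewrite ?nnegrE// ?subr_ge0 ?(ltW p1)//.
  rewrite [leRHS]ger0_norm ?addr_ge0// (le_trans (ler_normD _ _))// lerD2l.
  by rewrite normrM ler_piMl// ger0_norm ?invr_ge0// invf_le1// ler1n.
move=> _ _ h.
rewrite pform.unlock; apply: fine_cvg; rewrite /Rintegral fineK//.
by apply: integrable_fin_num => //; exact: pform_integrable.
Qed.

(** The two regimes of the tangent estimate give the same qualitative
    information on bounded sets: the [p]-energy is uniformly convex there. *)
Lemma pnorm_tangent_bounded (S : R) : exists c q : R, [/\ 0 < c, 0 < q &
  forall U V, inLp U -> inLp V -> pnorm U <= S -> pnorm V <= S ->
  pnorm U `^ p + p * pform U (fun x => V x - U x)
    + c * pnorm (fun x => V x - U x) `^ q <= pnorm V `^ p].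
Proof.
have [p2|p2] := leP 2 p.
  exists (2 `^ (1 - p)), p; split; [exact: powR_gt0|exact: p0|].
  by move=> U V lU lV _ _; exact: pnorm_tangent_ge2.
pose K : R := (2 * `|S| + 1) `^ (2 - p).
have S1 : 0 < 2 * `|S| + 1 by rewrite ltr_wpDl// mulr_ge0.
have K0 : 0 < K by exact: powR_gt0.
exists ((p - 1) / 12 / K), 2; split => //.
  by rewrite divr_gt0// divr_gt0// subr_gt0.
move=> U V lU lV US VS; rewrite -lerBrDl mulrAC ler_pdivrMr// [leRHS]mulrC.
apply: le_trans (pnorm_tangent_lt2 p1 p2 lU lV) _.
rewrite ler_wpM2r ?subr_ge0 ?pnorm_tangent//.
apply: ge0_ler_powR; rewrite ?subr_ge0 ?nnegrE ?(ltW p2) ?(ltW S1)//.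
  by rewrite addr_ge0// pnorm_ge0.
move: US VS (ler_norm S); move: (pnorm U) (pnorm V) => a b; lra.
Qed.

(** The test functions form a space [W0] that [T] maps to p-integrable functions,
    and [G] is the image by [T] of an extension of the boundary datum. The
    functional to minimize is [J v = |G + T v| ^ p / p - f v]. *)
Section direct_method.
Context {Y : Type} (T : (Y -> R) -> (X -> R)) (W0 : set (Y -> R)).
Hypothesis T_lin : forall k u v,
  T (fun y => k * u y + v y) = (fun x => k * T u x + T v x).
Hypothesis W00 : W0 (cst 0).
Hypothesis W0_lin : forall k u v, W0 u -> W0 v -> W0 (fun y => k * u y + v y).
Hypothesis W0_Lp : forall u, W0 u -> inLp (T u).
Hypothesis W0_complete : forall v_ : nat -> Y -> R, (forall n, W0 (v_ n)) ->
  (forall e : R, 0 < e -> exists N, forall i j, (N <= i)%N -> (N <= j)%N ->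
     pnorm (fun x => T (v_ i) x - T (v_ j) x) <= e) ->
  exists2 v, W0 v & (fun n => pnorm (fun x => T (v_ n) x - T v x)) @ \oo --> (0 : R).
Variables (G : X -> R) (f : (Y -> R) -> R) (M : R).
Hypothesis GLp : inLp G.
Hypothesis M0 : 0 <= M.
Hypothesis f_lin : forall k u v, W0 u -> W0 v ->
  f (fun y => k * u y + v y) = k * f u + f v.
Hypothesis f_bnd : forall v, W0 v -> `|f v| <= M * pnorm (T v).

Let U v : X -> R := fun x => G x + T v x.
Let s v := pnorm (U v).
Let J v := s v `^ p / p - f v.

Let ULp v : W0 v -> inLp (U v).
Proof. by move=> wv; apply: inLpD => //; exact: W0_Lp. Qed.

Let T_le v : W0 v -> pnorm (T v) <= s v + pnorm G.
Proof.
move=> wv; have := pnormB p1 (ULp wv) GLp.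
by have -> : (fun x => U v x - G x) = T v by apply/funext => x; rewrite /U; lra.
Qed.

(* below the threshold [S0] the linear term is bounded, and above it the linear
   term is at most half of the power *)
Let coercive : exists K, forall v, W0 v -> s v `^ p / (2 * p) <= J v + K.
Proof.
pose S0 := (2 * p * M) `^ (p - 1)^-1.
exists (M * S0 + M * pnorm G) => v wv.
have s0 : 0 <= s v by exact: pnorm_ge0.
have fv : f v <= M * s v + M * pnorm G.
  rewrite -mulrDr (le_trans (ler_norm _))// (le_trans (f_bnd wv))// ler_wpM2l//.
  exact: T_le.
have p10 : 0 < p - 1 by rewrite subr_gt0.
have Ms : M * s v <= s v `^ p / (2 * p) + M * S0.
  have [sS|sS] := leP (s v) S0.
    rewrite -[leLHS]add0r lerD ?divr_ge0 ?powR_ge0 ?mulr_ge0 ?(ltW p0)//.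
    by rewrite ler_wpM2l.
  rewrite -[leLHS]addr0 lerD ?mulr_ge0 ?powR_ge0//.
  rewrite ler_pdivlMr ?mulr_gt0// -(mulr_powRB1 s0)// mulrAC [leRHS]mulrC.
  rewrite ler_wpM2r//.
  have -> : M * (2 * p) = S0 `^ (p - 1).
    rewrite -powRrM mulVf ?gt_eqF// powRr1 ?mulr_ge0 ?(ltW p0)//; lra.
  by apply: (ge0_ler_powR (ltW p10)) (ltW sS); rewrite nnegrE ?powR_ge0.
rewrite /J.
have -> : s v `^ p / (2 * p) = s v `^ p / p - s v `^ p / (2 * p).
  by field; rewrite gt_eqF.
lra.
Qed.

Let J_tangent u v : W0 u -> W0 v ->
  J v + pform (U v) (fun x => U u x - U v x) - (f u - f v) <= J u.
Proof.
move=> wu wv; have := pnorm_tangent p1 (ULp wv) (ULp wu).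
rewrite -(ler_pM2l (_ : 0 < p^-1)) ?invr_gt0// /J -/(s u) -/(s v).
rewrite mulrDr (mulrA p^-1 p) mulVf ?gt_eqF// mul1r.
rewrite ![p^-1 * _]mulrC; lra.
Qed.

Let f_sub u v : W0 u -> W0 v -> `|f u - f v| <= M * pnorm (fun x => T u x - T v x).
Proof.
move=> wu wv; have := f_bnd (W0_lin (- 1) wv wu); rewrite f_lin// T_lin.
have -> : (fun x => -1 * T v x + T u x) = (fun x => T u x - T v x).
  by apply/funext => x; lra.
by have -> : -1 * f v + f u = f u - f v by lra.
Qed.

Let mid u v : Y -> R := fun y => 2^-1 * u y + (2^-1 * v y + cst 0 y).

Let W0_mid u v : W0 u -> W0 v -> W0 (mid u v).
Proof. by move=> wu wv; apply: W0_lin => //; exact: W0_lin. Qed.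

Let U_mid u v : U (mid u v) = (fun x => (U u x + U v x) / 2).
Proof.
have T0 : T (cst 0) = cst 0.
  have -> : cst 0 = (fun y => -1 * cst 0 y + cst 0 y) :> (Y -> R).
    by apply/funext => y /=; lra.
  by rewrite T_lin; apply/funext => x /=; lra.
by rewrite /mid /U !T_lin T0; apply/funext => x /=; lra.
Qed.

Let f_mid u v : W0 u -> W0 v -> f (mid u v) = (f u + f v) / 2.
Proof.
move=> wu wv.
have f0 : f (cst 0) = 0.
  have -> : cst 0 = (fun y => -1 * cst 0 y + cst 0 y) :> (Y -> R).
    by apply/funext => y /=; lra.
  by rewrite f_lin//; lra.
by rewrite /mid !f_lin// ?f0; [lra|exact: W0_lin].
Qed.

(** The tangent inequalities from the midpoint to [u] and to [v] are added: the
    linear terms cancel. *)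
Let uniform_convexity S : exists c q : R, [/\ 0 < c, 0 < q &
  forall u v, W0 u -> W0 v -> s u <= S -> s v <= S ->
  c * pnorm (fun x => T u x - T v x) `^ q <= J u + J v - 2 * J (mid u v)].
Proof.
have [c [q [c0 q0 H]]] := pnorm_tangent_bounded S.
exists (2 * c * 2^-1 `^ q / p), q; split => //.
  by rewrite divr_gt0// !mulr_gt0// powR_gt0.
move=> u v wu wv uS vS; have wm := W0_mid wu wv.
have lu := ULp wu; have lv := ULp wv; have lm := ULp wm.
have lD := inLpB p1 lu lv.
have smS : s (mid u v) <= S.
  rewrite /s U_mid.
  have -> : (fun x => (U u x + U v x) / 2) = (fun x => 2^-1 * (U u x + U v x)).
    by apply/funext => x; lra.
  rewrite pnormZ//; last exact: inLpD.
  rewrite ger0_norm//; have := pnormD p1 lu lv.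
  by rewrite /s in uS vS; lra.
have Eu : (fun x => U u x - U (mid u v) x) = (fun x => 2^-1 * (U u x - U v x)).
  by rewrite U_mid; apply/funext => x; lra.
have Ev : (fun x => U v x - U (mid u v) x) = (fun x => - 2^-1 * (U u x - U v x)).
  by rewrite U_mid; apply/funext => x; lra.
have EU : (fun x => U u x - U v x) = (fun x => T u x - T v x).
  by apply/funext => x; rewrite /U; lra.
have := H _ _ lm lu smS uS; have := H _ _ lm lv smS vS.
rewrite Eu Ev !pformZr// !pnormZ// normrN ger0_norm// powRM ?pnorm_ge0//.
rewrite EU -/(s u) -/(s v) -/(s (mid u v)) /J f_mid//.
set hq := 2^-1 `^ q; set Q := _ `^ q; set D := pform _ _ => h1 h2.
have -> : 2 * c * hq / p * Q = p^-1 * (2 * (c * (hq * Q))) by field; rewrite gt_eqF.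
have -> : s u `^ p / p - f u + (s v `^ p / p - f v) -
    2 * (s (mid u v) `^ p / p - (f u + f v) / 2) =
    p^-1 * (s u `^ p + s v `^ p - 2 * s (mid u v) `^ p).
  by field; rewrite gt_eqF.
rewrite ler_pM2l ?invr_gt0//; lra.
Qed.

(** A minimizing sequence stays in a bounded sublevel set, where the value at
    midpoints, which is at least the infimum, forces it to be Cauchy. The tangent
    inequality at its limit gives the lower semicontinuity. *)
Let minimizer : exists2 v, W0 v & forall u, W0 u -> J v <= J u.
Proof.
have [K HK] := coercive.
pose A := [set J v | v in W0].
have lbA v : W0 v -> - K <= J v.
  move=> wv; have := HK _ wv.
  have : 0 <= s v `^ p / (2 * p) by rewrite divr_ge0 ?powR_ge0// mulr_ge0// ltW.
  by lra.
have infA : has_inf A.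
  split; first by exists (J (cst 0)), (cst 0).
  by exists (- K) => _ [v wv <-]; exact: lbA.
pose I := inf A.
have IJ v : W0 v -> I <= J v.
  by move=> wv; apply: ge_inf; [exact: infA.2|exists v].
have /choice[v_ Hv] : forall n : nat, exists v, W0 v /\ J v <= I + n.+1%:R^-1.
  move=> n; have n0 : 0 < n.+1%:R^-1 :> R by rewrite invr_gt0.
  have [_ [v wv <-] Jv] := inf_adherent n0 infA.
  by exists v; split => //; rewrite ltW.
have wv n := (Hv n).1.
pose S := (2 * p * (I + 1 + K)) `^ p^-1.
have sS n : s (v_ n) <= S.
  have n1 : n.+1%:R^-1 <= 1 :> R by rewrite invf_le1// ler1n.
  have : s (v_ n) `^ p <= 2 * p * (I + 1 + K).
    rewrite -ler_pdivrMl ?mulr_gt0// mulrC.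
    apply: le_trans (HK _ (wv n)) _.
    by rewrite lerD2r (le_trans (Hv n).2)// lerD2l.
  have pV : 0 <= p^-1 by rewrite invr_ge0 ltW.
  have sp : 0 <= s (v_ n) `^ p by exact: powR_ge0.
  move=> h; have := ge0_ler_powR pV _ _ h; rewrite !nnegrE.
  move=> /(_ sp (le_trans sp h)).
  by rewrite -powRrM divff ?gt_eqF// powRr1// pnorm_ge0.
have [c [q [c0 q0 UC]]] := uniform_convexity S.
have [||v wv0 vcvg] := W0_complete (v_ := v_); first exact: wv.
  move=> e e0.
  have k0 : 0 < c * e `^ q / 2 by rewrite divr_gt0// mulr_gt0// powR_gt0.
  have /cvgrPdist_lt /(_ _ k0) [N _ HN] := @cvg_harmonic R.
  exists N => i j Ni Nj.
  have := UC _ _ (wv i) (wv j) (sS i) (sS j).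
  have := IJ _ (W0_mid (wv i) (wv j)).
  have := (Hv i).2; have := (Hv j).2.
  have := HN _ Ni; have := HN _ Nj.
  rewrite /= !sub0r !normrN !ger0_norm ?invr_ge0// => hj hi hJj hJi hm hc.
  have : c * pnorm (fun x => T (v_ i) x - T (v_ j) x) `^ q <= c * e `^ q.
    move: hj hi hJj hJi hm hc; move: (J (mid _ _)) (J (v_ i)) (J (v_ j)).
    move: (c * _) (c * _) (i.+1%:R^-1 : R) (j.+1%:R^-1 : R) (I).
    by move=> a b ni nj k x y z; lra.
  rewrite ler_pM2l// => h.
  have qV : 0 <= q^-1 by rewrite invr_ge0 ltW.
  have := ge0_ler_powR qV _ _ h; rewrite !nnegrE => /(_ (powR_ge0 _ _) (powR_ge0 _ _)).
  by rewrite -!powRrM divff ?gt_eqF// !powRr1 ?pnorm_ge0 ?(ltW e0).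
exists v => // u wu; apply: le_trans (IJ _ wu).
set k := s v `^ (p - 1) + M.
have Jle n : J v <= I + n.+1%:R^-1 + k * pnorm (fun x => T (v_ n) x - T v x).
  have := J_tangent (wv n) wv0; have := (Hv n).2.
  have := pform_le p1 (ULp wv0) (inLpB p1 (ULp (wv n)) (ULp wv0)).
  have -> : (fun x => U (v_ n) x - U v x) = (fun x => T (v_ n) x - T v x).
    by apply/funext => x; rewrite /U; lra.
  have := f_sub (wv n) wv0.
  rewrite !ler_norml /k mulrDl -/(s v).
  move: (J v) (J (v_ n)) (f (v_ n) - f v) (pform _ _) (M * _) (s v `^ _ * _).
  move: (I) (n.+1%:R^-1 : R) => a b x y z t u' v'.
  by move=> /andP[h1 h2] /andP[h3 h4]; lra.
have : (fun n : nat => I + n.+1%:R^-1 + k * pnorm (fun x => T (v_ n) x - T v x)) @ \oo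
   --> I + 0 + k * 0.
  apply: cvgD; last exact: cvgMr.
  by apply: cvgD; [exact: cvg_cst|exact: cvg_harmonic].
rewrite mulr0 !addr0 => h; rewrite -(cvg_lim _ h)//.
by apply: limr_ge; [apply/cvg_ex; exists I|exact: nearW].
Qed.

(** The minimizer [v] is compared with [v + w / n] as [n] tends to infinity, which
    gives one inequality for every [w]; the other one is that for [- w]. *)
Lemma direct_method : exists2 v, W0 v &
  forall w, W0 w -> pform (fun x => G x + T v x) (T w) = f w.
Proof.
have [v wv minv] := minimizer.
have half w : W0 w -> f w <= pform (U v) (T w).
  move=> ww; have lw := W0_Lp ww; have lv := ULp wv.
  have cv := pform_hemicontinuous lv lw.
  rewrite -(cvg_lim _ cv)//; apply: limr_ge; first by apply/cvg_ex; eexists; exact: cv.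
  apply: nearW => n; set t := n.+1%:R^-1.
  have t0 : 0 < t :> R by rewrite invr_gt0.
  have wt := W0_lin t ww wv.
  have := J_tangent wv wt; have := minv _ wt; rewrite f_lin//.
  have -> : U (fun y => t * w y + v y) = (fun x => U v x + t * T w x).
    by rewrite /U T_lin; apply/funext => x; lra.
  have -> : (fun x => U v x - (U v x + t * T w x)) = (fun x => (- t) * T w x).
    by apply/funext => x; lra.
  rewrite pformZr//; last by apply: inLpD => //; exact: inLpZ.
  set F := pform _ _ => h1 h2.
  have : t * f w <= t * F by lra.
  by rewrite ler_pM2l.
exists v => // w ww; apply/eqP; rewrite eq_le; apply/andP; split; last exact: half.
have wN := W0_lin (-1) ww W00.
have := half _ wN; rewrite f_lin// T_lin.
have -> : (fun x => -1 * T w x + T (cst 0) x) = (fun x => -1 * T w x).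
  apply/funext => x.
  have : T (fun y => -1 * cst 0 y + cst 0 y) x = -1 * T (cst 0) x + T (cst 0) x.
    by rewrite T_lin.
  have -> : (fun y => -1 * cst 0 y + cst 0 y) = cst 0 :> (Y -> R).
    by apply/funext => y /=; lra.
  by lra.
rewrite pformZr//; [|exact: ULp|exact: W0_Lp].
have : f (fun y => -1 * cst 0 y + cst 0 y) = -1 * f (cst 0) + f (cst 0).
  by rewrite f_lin.
have -> : (fun y => -1 * cst 0 y + cst 0 y) = cst 0 :> (Y -> R).
  by apply/funext => y /=; lra.
rewrite -/(U v).
by lra.
Qed.

End direct_method.
End existence.

(** * A priori bounds and stability *)

Section absorption.
Context {R : realType}.
Implicit Types (p q r a x y t K : R).

(** Both sides are homogeneous of degree [p], and the terms on the right are of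
    lower degree in [x]: each is at most [x ^ p / (4 * K + 1)] as soon as [x]
    exceeds a fixed multiple of [t]. *)
Lemma powR_absorb p K : 1 < p -> 0 <= K -> exists2 l : R, 0 < l &
  forall x t, 0 <= x -> 0 <= t ->
  x `^ p <= K * (x `^ (p - 1) * t + t `^ (p - 1) * x + t `^ p) -> x <= l * t.
Proof.
move=> p1 K0; have p10 : 0 < p - 1 by rewrite subr_gt0.
have p0 : 0 < p by rewrite (lt_trans _ p1).
pose k := 4 * K + 1; have k1 : 1 <= k by rewrite lerDr mulr_ge0.
have k0 : 0 < k by exact: lt_le_trans k1.
pose l := k + k `^ (p - 1)^-1.
have lk : k <= l by rewrite lerDl powR_ge0.
have l0 : 0 < l by exact: lt_le_trans lk.
have lp : k <= l `^ (p - 1).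
  have -> : k = (k `^ (p - 1)^-1) `^ (p - 1).
    by rewrite -powRrM mulVf ?gt_eqF// powRr1// ltW.
  apply: ge0_ler_powR; rewrite ?nnegrE ?powR_ge0 ?(ltW l0) ?(ltW p10)//.
  by rewrite lerDr ltW.
exists l => // x t x0 t0; apply: contraPP => /negP; rewrite -ltNge => ltx hx.
have xp : 0 < x by apply: le_lt_trans ltx; rewrite mulr_ge0// ltW.
have xpp : 0 < x `^ p by exact: powR_gt0.
have tx : k * t <= x by rewrite (le_trans _ (ltW ltx))// ler_wpM2r.
have t1 : k * (x `^ (p - 1) * t) <= x `^ p.
  by rewrite mulrCA -(mulr_powRB1 x0 p0) [leRHS]mulrC ler_wpM2l// powR_ge0.
have tp : k * t `^ (p - 1) <= x `^ (p - 1).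
  rewrite (le_trans (ler_wpM2r (powR_ge0 _ _) lp))// -powRM ?(ltW l0)//.
  apply: ge0_ler_powR; rewrite ?nnegrE ?mulr_ge0 ?(ltW l0) ?(ltW p10)//.
  exact: ltW.
have t2 : k * (t `^ (p - 1) * x) <= x `^ p.
  by rewrite mulrA -(mulr_powRB1 x0 p0) [leRHS]mulrC ler_wpM2r.
have tlx : t <= x by rewrite (le_trans _ tx)// ler_peMl.
have t3 : k * t `^ p <= x `^ p.
  apply: le_trans t2; rewrite ler_wpM2l ?(ltW k0)// -(mulr_powRB1 t0 p0).
  by rewrite mulrC ler_wpM2l// powR_ge0.
have : k * x `^ p <= K * (3 * x `^ p).
  have := ler_wpM2l (ltW k0) hx.
  rewrite mulrCA => /le_trans; apply; rewrite ler_wpM2l//.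
  by rewrite !mulrDr; lra.
have : 0 <= K * x `^ p by rewrite mulr_ge0// powR_ge0.
by rewrite /k; lra.
Qed.

Lemma ler_powRl p x t : 0 <= p -> 0 <= x -> x <= t -> x `^ p <= t `^ p.
Proof.
by move=> p0 x0 xt; apply: (ge0_ler_powR p0) => //; rewrite nnegrE// (le_trans x0).
Qed.

Lemma ler_powR_scale q r a x y : 0 <= q -> 0 <= a -> 0 <= x ->
  x <= a * y `^ r -> x `^ q <= a `^ q * y `^ (q * r).
Proof.
move=> q0 a0 x0 xa; rewrite [q * r]mulrC powRrM -powRM ?powR_ge0//.
exact: ler_powRl.
Qed.

Lemma powRVK p x : p != 0 -> 0 <= x -> (x `^ p^-1) `^ p = x.
Proof. by move=> p0 x0; rewrite -powRrM mulVf// powRr1. Qed.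

Lemma powRKV p x : p != 0 -> 0 <= x -> (x `^ p) `^ p^-1 = x.
Proof. by move=> p0 x0; rewrite -powRrM divff// powRr1. Qed.

Lemma continuous_normr_powR (q : R) : 0 < q ->
  continuous (fun t : R => `|t| `^ q).
Proof.
move=> q0 t; have p1 : 1 < q + 1 by rewrite ltrDr.
have -> : (fun t : R => `|t| `^ q) = (fun t => `|psi (q + 1) t|).
  by apply/funext => s; rewrite norm_psi// addrK.
by apply: (cvg_comp _ _ (continuous_psi p1 (x := t))); exact: norm_continuous.
Qed.

(** The trace norm is an infimum over extensions; this carries estimates by the
    norm of an arbitrary extension over to it. *)
Lemma le_continuous_inf (A : set R) (phi : R -> R) c : has_inf A ->
  continuous phi -> (forall a, A a -> c <= phi a) -> c <= phi (inf A).
Proof.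
move=> infA cphi cA.
have /choice[a_ Ha] : forall n : nat, exists a, A a /\ a < inf A + n.+1%:R^-1.
  move=> n; have n0 : 0 < n.+1%:R^-1 :> R by rewrite invr_gt0.
  by have [a Aa ale] := inf_adherent n0 infA; exists a.
have acvg : a_ @ \oo --> inf A.
  apply: (@squeeze_cvgr _ _ _ _ (fun=> inf A) (fun n => inf A + n.+1%:R^-1)).
  - apply: nearW => n; rewrite (ltW (Ha n).2) andbT.
    by apply: ge_inf; [exact: infA.2|exact: (Ha n).1].
  - exact: cvg_cst.
  - rewrite -[X in _ --> X]addr0; apply: cvgD; first exact: cvg_cst.
    exact: cvg_harmonic.
have h : phi (a_ n) @[n --> \oo] --> phi (inf A).
  by apply: (cvg_comp _ _ acvg); exact: cphi.
rewrite -(cvg_lim _ h)//; apply: limr_ge; first by apply/cvg_ex; exists (phi (inf A)).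
by apply: nearW => n; exact: cA (Ha n).1.
Qed.

End absorption.

(** The part of the argument that uses only the following structure: [T] is the
    weighted increment, [A] the norm of the restriction to the domain and [N] the
    norm of the energy space [W], equivalent to [A + |T|], with Poincare's
    inequality on the test functions [W0]. *)
Section stability.
Context {R : realType} d {X : measurableType d} (m : {measure set X -> \bar R}).
Variable p : R.
Hypothesis p1 : 1 < p.
Let p0 : 0 < p. Proof. by rewrite (lt_trans _ p1). Qed.
Let p10 : 0 < p - 1. Proof. by rewrite subr_gt0. Qed.
Local Notation inLp := (inLp m p).
Local Notation pnorm := (pnorm m p).
Local Notation pform := (pform m p).
Context {Y : Type} (T : (Y -> R) -> (X -> R)) (W W0 : set (Y -> R)).
Hypothesis T_lin : forall k u v,
  T (fun y => k * u y + v y) = (fun x => k * T u x + T v x).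
Hypothesis W_lin : forall k u v, W u -> W v -> W (fun y => k * u y + v y).
Hypothesis W0W : W0 `<=` W.
Hypothesis W_Lp : forall u, W u -> inLp (T u).
Variables (A N : (Y -> R) -> R).
Hypothesis A_tri : forall u v, W u -> W v -> A u <= A (u \- v) + A v.
Hypothesis N_ge0 : forall u, 0 <= N u.
Hypothesis A_N : forall u, W u -> A u <= N u.
Hypothesis T_N : forall u, W u -> pnorm (T u) <= 2 * N u.
Hypothesis N_le : forall u, W u -> N u <= A u + pnorm (T u).
Variable C0 : R.
Hypothesis C00 : 0 <= C0.
Hypothesis poincare : forall v, W0 v -> A v <= C0 * pnorm (T v).

Lemma linear_sub u v : T (u \- v) = (fun x => T u x - T v x).
Proof.
have -> : u \- v = (fun y => -1 * v y + u y) by apply/funext => y /=; lra.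
by rewrite T_lin; apply/funext => x; lra.
Qed.

Lemma closed_sub u v : W u -> W v -> W (u \- v).
Proof.
have -> : u \- v = (fun y => -1 * v y + u y) by apply/funext => y /=; lra.
by move=> wu wv; exact: W_lin.
Qed.

Lemma N_energy v : W0 v -> N v <= (C0 + 1) * pnorm (T v).
Proof.
move=> wv; have := N_le (W0W wv); have := poincare wv; rewrite mulrDl mul1r.
lra.
Qed.

(** Poincare's inequality applies to [u - h], and the norm of [h] pays for the
    difference. *)
Lemma N_coset u h : W u -> W h -> W0 (u \- h) ->
  N u <= (C0 + 1) * pnorm (T u) + (2 * C0 + 1) * N h.
Proof.
move=> wu wh wuh; have := N_le wu; have := A_tri wu wh; have := A_N wh.
have := poincare wuh; rewrite linear_sub.
have := pnormB p1 (W_Lp wu) (W_Lp wh); have := T_N wh.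
move=> h1 h2 h3 h4 h5 h6.
have h7 : C0 * pnorm (fun x => T u x - T h x) <= C0 * (pnorm (T u) + 2 * N h).
  rewrite ler_wpM2l//; apply: (le_trans h2).
  by rewrite lerD2l.
lra.
Qed.

Lemma energy_bound : exists2 l : R, 0 < l &
  forall (f : (Y -> R) -> R) F u g, W u -> W g -> W0 (u \- g) ->
  (forall v, W0 v -> pform (T u) (T v) = f v) -> 0 <= F ->
  (forall v, W0 v -> `|f v| <= F * N v) ->
  pnorm (T u) <= l * (F `^ (p / (p - 1)) + pnorm (T g) `^ p) `^ p^-1.
Proof.
have K0 : 0 <= C0 + 1 by rewrite addr_ge0.
have K1 : 0 <= 1 + (C0 + 1) by rewrite addr_ge0.
have [l l0 Hl] := powR_absorb p1 K1; exists l => //.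
move=> f F u g wu wg wug sol F0 fF.
(* in terms of [t] all terms are homogeneous of degree [p]: both [|T g| <= t]
   and [F <= t ^ (p - 1)] *)
set t := (_ + _) `^ _.
have t0 : 0 <= t by exact: powR_ge0.
have tp : t `^ p = F `^ (p / (p - 1)) + pnorm (T g) `^ p.
  by rewrite powRVK ?gt_eqF// addr_ge0// powR_ge0.
have gt : pnorm (T g) <= t.
  rewrite -[leLHS](@powRKV _ p) ?gt_eqF ?pnorm_ge0//.
  apply: ler_powRl; rewrite ?invr_ge0 ?(ltW p0) ?powR_ge0// lerDr powR_ge0//.
have Ft : F <= t `^ (p - 1).
  have -> : t `^ (p - 1) = (t `^ p) `^ (p / (p - 1))^-1.
    by rewrite -powRrM; congr (_ `^ _); field; rewrite !gt_eqF.
  have q0 : p / (p - 1) != 0 by rewrite mulf_neq0 ?invr_eq0 ?gt_eqF.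
  rewrite -[leLHS](powRKV q0 F0).
  apply: ler_powRl; rewrite ?invr_ge0 ?divr_ge0 ?(ltW p0) ?(ltW p10) ?powR_ge0//.
  by rewrite tp lerDl powR_ge0.
apply: Hl => //; first exact: pnorm_ge0.
have lu := W_Lp wu; have lg := W_Lp wg.
rewrite -pform_diag//.
have -> : pform (T u) (T u) = pform (T u) (T (u \- g)) + pform (T u) (T g).
  by rewrite linear_sub pformBr// subrK.
rewrite sol//.
have h1 : f (u \- g) <= t `^ (p - 1) * ((C0 + 1) * (pnorm (T u) + t)).
  apply: le_trans (ler_norm _) _; apply: le_trans (fF _ wug) _.
  apply: ler_pM => //; apply: le_trans (N_energy wug) _; rewrite ler_wpM2l//.
  rewrite linear_sub; apply: le_trans (pnormB p1 lu lg) _.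
  by rewrite lerD2l.
have h2 : pform (T u) (T g) <= pnorm (T u) `^ (p - 1) * t.
  apply: le_trans (ler_norm _) _; apply: le_trans (pform_le p1 lu lg) _.
  by rewrite ler_wpM2l// powR_ge0.
have E : t `^ (p - 1) * ((C0 + 1) * (pnorm (T u) + t)) =
    (C0 + 1) * (t `^ (p - 1) * pnorm (T u) + t `^ p).
  by rewrite -(mulr_powRB1 t0 p0); ring.
rewrite E in h1.
have h3 : 0 <= (C0 + 1) * (pnorm (T u) `^ (p - 1) * t).
  by rewrite !mulr_ge0 ?powR_ge0.
have h4 : 0 <= t `^ (p - 1) * pnorm (T u) by rewrite mulr_ge0 ?powR_ge0 ?pnorm_ge0.
have h5 : 0 <= t `^ p by exact: powR_ge0.
lra.
Qed.

Lemma norm_bound : exists2 l : R, 0 < l &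
  forall (f : (Y -> R) -> R) F u g, W u -> W g -> W0 (u \- g) ->
  (forall v, W0 v -> pform (T u) (T v) = f v) -> 0 <= F ->
  (forall v, W0 v -> `|f v| <= F * N v) ->
  N u <= l * (F `^ (p / (p - 1)) + N g `^ p) `^ p^-1.
Proof.
have [l l0 Hl] := energy_bound.
have K0 : 0 < C0 + 1 by rewrite ltr_wpDl.
exists ((C0 + 1) * (l * 2) + (2 * C0 + 1)).
  by rewrite addr_gt0 ?mulr_gt0// ltr_wpDl// mulr_ge0.
move=> f F u g wu wg wug sol F0 fF; apply: le_trans (N_coset wu wg wug) _.
rewrite [leRHS]mulrDl lerD//.
  rewrite -!mulrA ler_wpM2l ?(ltW K0)//.
  apply: le_trans (Hl _ _ _ _ wu wg wug sol F0 fF) _; rewrite ler_wpM2l ?(ltW l0)//.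
  rewrite -[X in _ <= X * _](@powRKV _ p) ?gt_eqF// -powRM ?addr_ge0 ?powR_ge0//.
  apply: ler_powRl; rewrite ?invr_ge0 ?(ltW p0) ?addr_ge0 ?powR_ge0//.
  rewrite mulrDr -powRM// lerD//.
    rewrite ler_peMl ?powR_ge0// (le_trans _ (le1r_powR _ (ltW p1)))//; lra.
  by apply: ler_powRl; rewrite ?pnorm_ge0 ?(ltW p0) ?T_N.
rewrite ler_wpM2l ?addr_ge0 ?mulr_ge0//.
rewrite -[leLHS](@powRKV _ p) ?gt_eqF ?N_ge0//.
by apply: ler_powRl; rewrite ?invr_ge0 ?(ltW p0) ?powR_ge0// lerDr powR_ge0.
Qed.

(** The difference of the two equations, tested with the difference of the
    solutions corrected by an extension of the difference of the data. *)
Lemma monotone_gap (f1 f2 : (Y -> R) -> R) F u1 u2 h :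
  W u1 -> W u2 -> W h -> W0 ((u1 \- u2) \- h) ->
  (forall v, W0 v -> pform (T u1) (T v) = f1 v) ->
  (forall v, W0 v -> pform (T u2) (T v) = f2 v) -> 0 <= F ->
  (forall v, W0 v -> `|f1 v - f2 v| <= F * N v) ->
  pform (T u1) (T (u1 \- u2)) - pform (T u2) (T (u1 \- u2)) <=
  (2 * (C0 + 1)) * (F * (pnorm (T (u1 \- u2)) + N h) +
    (pnorm (T u1) `^ (p - 1) + pnorm (T u2) `^ (p - 1)) * N h).
Proof.
move=> w1 w2 wh wuh s1 s2 F0 fF.
have w12 := closed_sub w1 w2.
have l1 := W_Lp w1; have l2 := W_Lp w2; have lh := W_Lp wh; have l12 := W_Lp w12.
have E u (f : (Y -> R) -> R) : W u -> (forall v, W0 v -> pform (T u) (T v) = f v) ->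
    pform (T u) (T (u1 \- u2)) = f ((u1 \- u2) \- h) + pform (T u) (T h).
  move=> wu s; rewrite -s// (linear_sub (u1 \- u2) h) pformBr ?subrK//.
  exact: W_Lp.
rewrite (E _ _ w1 s1) (E _ _ w2 s2).
have h1 := le_trans (ler_norm _) (fF _ wuh).
have h2 : F * N ((u1 \- u2) \- h) <=
    F * ((C0 + 1) * (pnorm (T (u1 \- u2)) + 2 * N h)).
  rewrite ler_wpM2l// (le_trans (N_energy wuh))// ler_wpM2l ?addr_ge0//.
  rewrite linear_sub (le_trans (pnormB p1 l12 lh))// lerD2l.
  exact: T_N.
have h3 u : W u -> `|pform (T u) (T h)| <= pnorm (T u) `^ (p - 1) * (2 * N h).
  move=> wu; rewrite (le_trans (pform_le p1 (W_Lp wu) lh))//.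
  by rewrite ler_wpM2l ?powR_ge0// T_N.
have := h3 _ w1; have := h3 _ w2; rewrite !ler_norml => /andP[h4 _] /andP[_ h5].
move: h1 h2 h4 h5 => {h3 E}.
have := pnorm_ge0 m p (T (u1 \- u2)); have := N_ge0 h.
have := powR_ge0 (pnorm (T u1)) (p - 1); have := powR_ge0 (pnorm (T u2)) (p - 1).
move: (pform (T u1) _) => a; move: (pform (T u2) _) => b.
move: (f1 _) (f2 _) (N (_ \- _)) (N h) => c e k n.
move: (pnorm (T u1) `^ _) => q1; move: (pnorm (T u2) `^ _) => q2.
move: (pnorm _) => x q20 q10 n0 x0 h1 h2 h4 h5.
have h6 : 0 <= F * (C0 + 1) * x by rewrite !mulr_ge0// addr_ge0.
have h7 : 0 <= C0 * (q1 * n) by rewrite !mulr_ge0.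
have h8 : 0 <= C0 * (q2 * n) by rewrite !mulr_ge0.
have -> : 2 * (C0 + 1) * (F * (x + n) + (q1 + q2) * n) =
  F * ((C0 + 1) * (x + 2 * n)) + F * (C0 + 1) * x +
  q1 * (2 * n) + q2 * (2 * n) + 2 * (C0 * (q1 * n)) + 2 * (C0 * (q2 * n)) by ring.
lra.
Qed.

Variable B : R.
Hypothesis B0 : 0 <= B.

Let D a1 a2 : R := a1 `^ (p / (p - 1))^-1 + a2 `^ (p / (p - 1))^-1.

Let D_ge0 a1 a2 : 0 <= D a1 a2. Proof. by rewrite addr_ge0// powR_ge0. Qed.

Let pnorm_pow_le u a : 0 <= a -> pnorm (T u) <= B * a `^ p^-1 ->
  pnorm (T u) `^ (p - 1) <= B `^ (p - 1) * a `^ (p / (p - 1))^-1.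
Proof.
move=> a0 ua; apply: le_trans (ler_powRl (ltW p10) (pnorm_ge0 _ _ _) ua) _.
rewrite powRM ?powR_ge0// ler_wpM2l ?powR_ge0// -powRrM invf_div.
by rewrite [p^-1 * _]mulrC.
Qed.

Let sum_pow_le u1 u2 a1 a2 : 0 <= a1 -> 0 <= a2 ->
  pnorm (T u1) <= B * a1 `^ p^-1 -> pnorm (T u2) <= B * a2 `^ p^-1 ->
  pnorm (T u1) `^ (p - 1) + pnorm (T u2) `^ (p - 1) <= B `^ (p - 1) * D a1 a2.
Proof. by move=> a10 a20 h1 h2; rewrite mulrDr lerD// pnorm_pow_le. Qed.

Let sum_le u1 u2 a1 a2 : 0 <= a1 -> 0 <= a2 ->
  pnorm (T u1) <= B * a1 `^ p^-1 -> pnorm (T u2) <= B * a2 `^ p^-1 ->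
  pnorm (T u1) + pnorm (T u2) <= 2 * B * D a1 a2 `^ (p - 1)^-1.
Proof.
move=> a10 a20 h1 h2.
have E a : a `^ p^-1 = (a `^ (p / (p - 1))^-1) `^ (p - 1)^-1.
  by rewrite -powRrM; congr (_ `^ _); field; rewrite !gt_eqF.
rewrite -mulrA mulr_natl mulr2n lerD//.
  apply: le_trans h1 _; rewrite ler_wpM2l// E.
  by apply: ler_powRl; rewrite ?invr_ge0 ?(ltW p10) ?powR_ge0// lerDl powR_ge0.
apply: le_trans h2 _; rewrite ler_wpM2l// E.
by apply: ler_powRl; rewrite ?invr_ge0 ?(ltW p10) ?powR_ge0// lerDr powR_ge0.
Qed.

(** Strong monotonicity, the sum of the two tangent inequalities between [T u1]
    and [T u2], bounds the gap from below by [x ^ p], where [x] is the norm of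
    [T (u1 - u2)]. The terms of the result, with sum [t], are those for which the
    upper bound of the gap becomes homogeneous in [x] and [t]. *)
Lemma stability_ge2 : 2 <= p -> exists2 C : R, 0 < C &
  forall (f1 f2 : (Y -> R) -> R) F u1 u2 h a1 a2,
  W u1 -> W u2 -> W h -> W0 ((u1 \- u2) \- h) ->
  (forall v, W0 v -> pform (T u1) (T v) = f1 v) ->
  (forall v, W0 v -> pform (T u2) (T v) = f2 v) -> 0 <= F ->
  (forall v, W0 v -> `|f1 v - f2 v| <= F * N v) ->
  0 <= a1 -> 0 <= a2 ->
  pnorm (T u1) <= B * a1 `^ p^-1 -> pnorm (T u2) <= B * a2 `^ p^-1 ->
  N (u1 \- u2) <=
    C * (F `^ (p - 1)^-1 + N h + D a1 a2 `^ p^-1 * N h `^ p^-1).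
Proof.
move=> p2; pose b := B `^ (p - 1).
have b0 : 0 <= b by exact: powR_ge0.
have c0 : 0 < 2 `^ (1 - p) * 2 / p :> R by rewrite !mulr_gt0 ?invr_gt0 ?powR_gt0.
pose K := (2 `^ (1 - p) * 2 / p)^-1 * (2 * (C0 + 1)) * (1 + b).
have K0 : 0 <= K.
  by rewrite !mulr_ge0 ?addr_ge0 ?invr_ge0 ?(ltW c0).
have K20 : 0 <= 2 * K by rewrite mulr_ge0.
have [l l0 Hl] := powR_absorb p1 K20.
exists ((C0 + 1) * l + (2 * C0 + 1)).
  by rewrite addr_gt0 ?mulr_gt0 ?ltr_wpDl ?mulr_ge0.
move=> f1 f2 F u1 u2 h a1 a2 w1 w2 wh wuh s1 s2 F0 fF a10 a20 h1 h2.
have w12 := closed_sub w1 w2.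
have l1 := W_Lp w1; have l2 := W_Lp w2.
set n := N h; have n0 : 0 <= n by exact: N_ge0.
set dd := D a1 a2; have d0 : 0 <= dd by exact: D_ge0.
set t := _ + _ + _.
have tF : 0 <= F `^ (p - 1)^-1 by exact: powR_ge0.
have tD : 0 <= dd `^ p^-1 * n `^ p^-1 by rewrite mulr_ge0 ?powR_ge0.
have t0 : 0 <= t by rewrite !addr_ge0.
have nt : n <= t by rewrite /t; lra.
have Ft : F <= t `^ (p - 1).
  rewrite -[leLHS](@powRVK _ (p - 1)) ?gt_eqF//.
  by apply: ler_powRl; rewrite ?(ltW p10)//; rewrite /t; lra.
have Dt : dd * n <= t `^ p.
  rewrite -[leLHS](@powRVK _ p) ?gt_eqF ?mulr_ge0//.
  by apply: ler_powRl; rewrite ?(ltW p0) ?powR_ge0// powRM// /t; lra.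
set x := pnorm (T (u1 \- u2)).
have x0 : 0 <= x by exact: pnorm_ge0.
have gap := monotone_gap w1 w2 wh wuh s1 s2 F0 fF.
have xt : x <= l * t.
  apply: Hl => //.
  have := pnorm_tangent_ge2 p1 p2 l1 l2; have := pnorm_tangent_ge2 p1 p2 l2 l1.
  have -> : pnorm (fun x => T u2 x - T u1 x) = x.
    rewrite /x linear_sub -pnormN.
    by congr (pnorm _); apply/funext => z; rewrite opprB.
  rewrite -linear_sub -/x.
  have -> : pform (T u1) (fun x => T u2 x - T u1 x) = - pform (T u1) (T (u1 \- u2)).
    rewrite -mulN1r -pformZr//; last exact: W_Lp.
    by congr (pform _ _); apply/funext => z; rewrite linear_sub mulN1r opprB.
  have : dd * n <= t `^ p by [].
  have : F * (x + n) <= t `^ (p - 1) * x + t `^ p.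
    rewrite mulrDr lerD ?ler_wpM2r// -(mulr_powRB1 t0 p0) mulrC.
    by apply: ler_pM.
  have : (pnorm (T u1) `^ (p - 1) + pnorm (T u2) `^ (p - 1)) * n <= b * (dd * n).
    by rewrite mulrA ler_wpM2r// sum_pow_le.
  move: gap; rewrite -/x -/n.
  have -> : 2 * K * (x `^ (p - 1) * t + t `^ (p - 1) * x + t `^ p) =
    (2 `^ (1 - p) * 2 / p)^-1 * ((2 * (C0 + 1)) * ((1 + b) * (2 *
      (x `^ (p - 1) * t + t `^ (p - 1) * x + t `^ p)))) by rewrite /K; ring.
  rewrite ler_pdivlMl//.
  move: (pform (T u1) _) => e1; move: (pform (T u2) _) => e2.
  move: ((_ + _) * n) => q g1 g2 g3 g4 g5 g6.
  have xp1t : 0 <= x `^ (p - 1) * t by rewrite mulr_ge0 ?powR_ge0.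
  have tp1x : 0 <= t `^ (p - 1) * x by rewrite mulr_ge0 ?powR_ge0.
  have tp0 : 0 <= t `^ p by exact: powR_ge0.
  have step1 : 2 `^ (1 - p) * 2 / p * x `^ p <= e1 - e2.
    have -> : 2 `^ (1 - p) * 2 / p * x `^ p = p^-1 * (2 * (2 `^ (1 - p) * x `^ p)).
      by ring.
    rewrite ler_pdivrMl//.
    lra.
  apply: (le_trans step1); apply: (le_trans g1).
  rewrite ler_wpM2l ?mulr_ge0 ?addr_ge0//.
  have bt : b * (dd * n) <= b * t `^ p by rewrite ler_wpM2l.
  have : 0 <= b * (x `^ (p - 1) * t) by rewrite mulr_ge0.
  have : 0 <= b * (t `^ (p - 1) * x) by rewrite mulr_ge0.
  have : 0 <= b * (t `^ p) by rewrite mulr_ge0.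
  lra.
have := N_coset w12 wh wuh; rewrite -/x -/n => hN.
apply: (le_trans hN); rewrite [leRHS]mulrDl lerD//.
  by rewrite -mulrA ler_wpM2l ?addr_ge0.
by rewrite ler_wpM2l ?addr_ge0 ?mulr_ge0.
Qed.

(** Here strong monotonicity bounds only [x ^ 2], with the weight
    [(|T u1| + |T u2|) ^ (2 - p)]; the a priori bounds replace it by a power of
    the data, and the absorption is that of degree 2. *)
Lemma stability_lt2 : p < 2 -> exists2 C : R, 0 < C &
  forall (f1 f2 : (Y -> R) -> R) F u1 u2 h a1 a2,
  W u1 -> W u2 -> W h -> W0 ((u1 \- u2) \- h) ->
  (forall v, W0 v -> pform (T u1) (T v) = f1 v) ->
  (forall v, W0 v -> pform (T u2) (T v) = f2 v) -> 0 <= F ->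
  (forall v, W0 v -> `|f1 v - f2 v| <= F * N v) ->
  0 <= a1 -> 0 <= a2 ->
  pnorm (T u1) <= B * a1 `^ p^-1 -> pnorm (T u2) <= B * a2 `^ p^-1 ->
  N (u1 \- u2) <=
    C * (D a1 a2 `^ ((2 - p) / (p - 1)) * F + N h
         + (D a1 a2 `^ (p - 1)^-1 + D a1 a2) `^ 2^-1 * N h `^ 2^-1).
Proof.
move=> p2; have p20 : 0 < 2 - p by rewrite subr_gt0.
pose b := B `^ (p - 1); pose b2 := (2 * B) `^ (2 - p).
have b0 : 0 <= b by exact: powR_ge0.
have b20 : 0 <= b2 by exact: powR_ge0.
have c0 : 0 < (p - 1) / 12 * 2 by rewrite mulr_gt0// divr_gt0.
pose K := ((p - 1) / 12 * 2)^-1 * (p * b2 * (2 * (C0 + 1)) * (1 + b)).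
have K0 : 0 <= K.
  by rewrite !mulr_ge0 ?addr_ge0 ?invr_ge0 ?(ltW c0) ?(ltW p0).
have K20 : 0 <= 2 * K by rewrite mulr_ge0.
have [l l0 Hl] := powR_absorb (ltr1n R 2) K20.
exists ((C0 + 1) * l + (2 * C0 + 1)).
  by rewrite addr_gt0 ?mulr_gt0 ?ltr_wpDl ?mulr_ge0.
move=> f1 f2 F u1 u2 h a1 a2 w1 w2 wh wuh s1 s2 F0 fF a10 a20 h1 h2.
have w12 := closed_sub w1 w2.
have l1 := W_Lp w1; have l2 := W_Lp w2.
set n := N h; have n0 : 0 <= n by exact: N_ge0.
set dd := D a1 a2; have d0 : 0 <= dd by exact: D_ge0.
set de := dd `^ ((2 - p) / (p - 1)); have de0 : 0 <= de by exact: powR_ge0.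
set k := (_ + dd) `^ 2^-1; have k0 : 0 <= k by exact: powR_ge0.
set t := _ + _ + _.
have tF : 0 <= de * F by rewrite mulr_ge0.
have tn : 0 <= k * n `^ 2^-1 by rewrite mulr_ge0 ?powR_ge0.
have t0 : 0 <= t by rewrite !addr_ge0.
have nt : n <= t by rewrite /t; lra.
have Ft : de * F <= t by rewrite /t; lra.
have Dt : de * (dd * n) <= t ^+ 2.
  have -> : de * (dd * n) = dd `^ (p - 1)^-1 * n.
    rewrite mulrA; congr (_ * _).
    rewrite -[X in _ * X](powRr1 d0) -powRD.
      by congr (_ `^ _); field; rewrite gt_eqF.
    apply/implyP => /eqP E; exfalso.
    have E2 : (2 - p) / (p - 1) + 1 = (p - 1)^-1 by field; rewrite gt_eqF.
    by move/eqP: E; rewrite E2 invr_eq0 gt_eqF.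
  have ke : dd `^ (p - 1)^-1 <= k ^+ 2.
    rewrite -powR_mulrn// powRVK ?pnatr_eq0// ?addr_ge0 ?powR_ge0//.
    by rewrite lerDl.
  apply: le_trans (ler_wpM2r n0 ke) _.
  have -> : k ^+ 2 * n = (k * n `^ 2^-1) ^+ 2.
    by rewrite exprMn -[(n `^ _) ^+ 2]powR_mulrn ?powR_ge0// powRVK ?pnatr_eq0.
  by rewrite ler_pXn2r ?nnegrE// /t; lra.
set x := pnorm (T (u1 \- u2)).
have x0 : 0 <= x by exact: pnorm_ge0.
have gap := monotone_gap w1 w2 wh wuh s1 s2 F0 fF.
have xt : x <= l * t.
  apply: Hl => //.
  have := pnorm_tangent_lt2 p1 p2 l1 l2; have := pnorm_tangent_lt2 p1 p2 l2 l1.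
  have -> : pnorm (fun x => T u2 x - T u1 x) = x.
    rewrite /x linear_sub -pnormN.
    by congr (pnorm _); apply/funext => z; rewrite opprB.
  rewrite -linear_sub -/x.
  have -> : pform (T u1) (fun x => T u2 x - T u1 x) = - pform (T u1) (T (u1 \- u2)).
    rewrite -mulN1r -pformZr//; last exact: W_Lp.
    by congr (pform _ _); apply/funext => z; rewrite linear_sub mulN1r opprB.
  rewrite [pnorm (T u2) + _]addrC; set Mp := (_ + pnorm (T u2)) `^ _.
  have Mb : Mp <= b2 * de.
    apply: ler_powR_scale; rewrite ?(ltW p20) ?mulr_ge0 ?addr_ge0 ?pnorm_ge0//.
    exact: sum_le.
  have M0 : 0 <= Mp by exact: powR_ge0.
  have sp : (pnorm (T u1) `^ (p - 1) + pnorm (T u2) `^ (p - 1)) * n <= b * (dd * n).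
    by rewrite mulrA ler_wpM2r// sum_pow_le.
  move: gap sp; rewrite -/x -/n.
  move: (pform (T u1) _) => e1; move: (pform (T u2) _) => e2.
  move: ((_ + _) * n) => q g1 g2 g3 g4.
  have C1 : 0 <= C0 + 1 by rewrite addr_ge0.
  have step1 : (p - 1) / 12 * 2 * x `^ 2 <= Mp * (p * (e1 - e2)).
    by move: g3 g4; rewrite !mulrBr !mulrDr !mulrN; lra.
  have E0 : 0 <= 2 * (C0 + 1) * (F * (x + n) + b * (dd * n)).
    by rewrite mulr_ge0 ?mulr_ge0// addr_ge0// !mulr_ge0// addr_ge0.
  have step2 : Mp * (p * (e1 - e2)) <=
      b2 * de * (p * (2 * (C0 + 1) * (F * (x + n) + b * (dd * n)))).
    apply: (@le_trans _ _ (Mp * (p * (2 * (C0 + 1) * (F * (x + n) + b * (dd * n)))))).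
      rewrite ler_wpM2l// ler_wpM2l ?(ltW p0)//; apply: (le_trans g1).
      by rewrite ler_wpM2l ?mulr_ge0// lerD2l.
    by rewrite ler_wpM2r// mulr_ge0// ltW.
  have E1 : 2 - 1 = 1 :> R by lra.
  rewrite E1 !powRr1// !powR_mulrn//.
  have -> : 2 * K * (x * t + t * x + t ^+ 2) = ((p - 1) / 12 * 2)^-1 *
      (p * b2 * (2 * (C0 + 1)) * ((1 + b) * (2 * (x * t + t * x + t ^+ 2)))).
    by rewrite /K; ring.
  rewrite ler_pdivlMl// -powR_mulrn//; apply: (le_trans step1); apply: (le_trans step2).
  have -> : b2 * de * (p * (2 * (C0 + 1) * (F * (x + n) + b * (dd * n)))) =
      p * b2 * (2 * (C0 + 1)) * (de * F * (x + n) + b * (de * (dd * n))) by ring.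
  rewrite ler_wpM2l ?mulr_ge0 ?(ltW p0)//.
  have i1 : de * F * (x + n) <= t * (x + t).
    by apply: ler_pM; rewrite ?addr_ge0// lerD2l.
  have i2 : b * (de * (dd * n)) <= b * t ^+ 2 by rewrite ler_wpM2l.
  have i3 : 0 <= b * (t * x) by rewrite !mulr_ge0.
  have i4 : 0 <= b * t ^+ 2 by rewrite mulr_ge0 ?exprn_ge0.
  have i5 : 0 <= t * x by rewrite mulr_ge0.
  have i6 : 0 <= t ^+ 2 by rewrite exprn_ge0.
  have -> : (1 + b) * (2 * (x * t + t * x + t ^+ 2)) =
    4 * (t * x) + 2 * t ^+ 2 + 4 * (b * (t * x)) + 2 * (b * t ^+ 2) by ring.
  have e3 : t * (x + t) = t * x + t ^+ 2 by ring.
  rewrite e3 in i1; lra.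
have := N_coset w12 wh wuh; rewrite -/x -/n => hN.
apply: (le_trans hN); rewrite [leRHS]mulrDl lerD//.
  by rewrite -mulrA ler_wpM2l ?addr_ge0.
by rewrite ler_wpM2l ?addr_ge0 ?mulr_ge0.
Qed.

End stability.

(** * Translations and homotheties of the Lebesgue measure *)

Section pushforward_scaling.
Context {R : realType}.

Definition image_measure d1 d2 (T1 : measurableType d1) (T2 : measurableType d2)
    (m : {measure set T1 -> \bar R}) (f : T1 -> T2) (mf : measurable_fun setT f)
    : {measure set T2 -> \bar R} :=
  @measure_function_pushforward__canonical__measure_function_Measure
    _ _ _ _ _ m f mf.

(** Half-open intervals determine the measure. *)
Lemma lebesgue_measure_affine (a c : R) (B : set R) : 0 < c ->
  measurable B ->
  @lebesgue_measure R B =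
    (c%:E * lebesgue_measure ((fun x => a + c * x)%R @^-1` B))%E.
Proof.
move=> c0 mB; have mphi : measurable_fun setT (fun x : R => a + c * x).
  by apply: measurable_funD => //; exact: measurable_funM.
pose mu : {measure set (measurableTypeR R) -> \bar R} :=
  @mscale _ (measurableTypeR R) R (NngNum (ltW c0))
    (@image_measure _ _ (measurableTypeR R) (measurableTypeR R)
       lebesgue_measure _ mphi).
rewrite -[RHS]/(mu B).
apply: (@lebesgue_measure_unique R mu _ _ mB) => _ [[x y]/= xy <-].
rewrite /mu/= /mscale/= /pushforward.
have -> : (fun x => a + c * x) @^-1` `]x, y]%classic =
    `](x - a) / c, (y - a) / c]%classic.
  apply/seteqP; split => z /=; rewrite !in_itv/= ltr_pdivrMr// ler_pdivlMr//.
    by rewrite [c * z]mulrC => /andP[? ?]; apply/andP; split; lra.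
  by rewrite [z * _]mulrC => /andP[? ?]; apply/andP; split; lra.
rewrite !lebesgue_measure_itv/= !lte_fin ltr_pM2r ?invr_gt0// ltrD2r.
case: ifPn => _; last by rewrite mule0.
by rewrite -!EFinB -EFinM; congr (_%:E); field; rewrite gt_eqF.
Qed.

(** Both sides are measures in [A], and they agree on rectangles. *)
Lemma product_measure_scaling d1 d2 (T1 : measurableType d1)
    (T2 : measurableType d2) (m1 : {sigma_finite_measure set T1 -> \bar R})
    (m2 : {sigma_finite_measure set T2 -> \bar R})
    (f1 : T1 -> T1) (f2 : T2 -> T2) (c1 c2 : {nonneg R}) :
  measurable_fun setT f1 -> measurable_fun setT f2 ->
  (forall A, measurable A -> m1 A = (c1%:num%:E * m1 (f1 @^-1` A))%E) ->
  (forall A, measurable A -> m2 A = (c2%:num%:E * m2 (f2 @^-1` A))%E) ->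
  forall A, measurable A ->
    (m1 \x m2)%E A = ((c1%:num * c2%:num)%:E *
      (m1 \x m2)%E ((fun z => (f1 z.1, f2 z.2)) @^-1` A))%E.
Proof.
move=> mf1 mf2 h1 h2.
have c120 : 0 <= c1%:num * c2%:num by rewrite mulr_ge0.
have mf : measurable_fun setT (fun z : T1 * T2 => (f1 z.1, f2 z.2)).
  by apply: measurable_fun_pair; [exact: (measurableT_comp mf1)|
    exact: (measurableT_comp mf2)].
pose mu : {measure set (T1 * T2) -> \bar R} :=
  mscale (NngNum c120) (image_measure (m1 \x m2)%E mf).
move=> C mC; rewrite -[RHS]/(mu C).
apply: (@product_measure_unique _ _ _ _ _ m1 m2 mu _ _ mC) => A B mA mB.
rewrite /mu/= /mscale/= /pushforward.
have -> : (fun z : T1 * T2 => (f1 z.1, f2 z.2)) @^-1` (A `*` B) =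
  (f1 @^-1` A) `*` (f2 @^-1` B) by [].
have mA' : measurable (f1 @^-1` A) by rewrite -[_ @^-1` _]setTI; exact: mf1.
have mB' : measurable (f2 @^-1` B) by rewrite -[_ @^-1` _]setTI; exact: mf2.
by rewrite product_measure1E// (h1 _ mA) (h2 _ mB) EFinM muleACA.
Qed.

End pushforward_scaling.

Section lebesgue_rV_geometry.
Context {R : realType}.
Implicit Types (n : nat) (c : R).

Lemma measurable_rV_affine n (b : 'rV[R]_n) (c : R) :
  measurable_fun setT (fun x : 'rV[R]_n => b + c *: x).
Proof.
apply/measurable_fun_rVP => i; under eq_fun do rewrite !mxE.
apply: measurable_funD => //; apply: measurable_funM => //.
exact: measurable_rV_coord.
Qed.

(** The coordinates transform independently, so dimension one suffices. *)
Lemma lebesgue_rV_affine n (b : 'rV[R]_n) c (B : set 'rV[R]_n) : 0 < c ->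
  measurable B -> lebesgue_rV n B =
    ((c ^+ n)%:E * lebesgue_rV n ((fun x => b + c *: x)%R @^-1` B))%E.
Proof.
move=> c0; elim: n b B => [|n IHn] b B mB.
  rewrite expr0 mul1e /=; congr dirac => //; apply/funext => x /=.
  by congr (B _); apply/rowP => -[].
have mcons := @measurable_rV_cons R n.
have mB' : measurable (@rV_cons R n @^-1` B).
  by rewrite -[_ @^-1` _]setTI; exact: mcons.
pose b0 := b ord0 ord0; pose b' : 'rV[R]_n := \row_j b ord0 (lift ord0 j).
have cn0 : 0 <= c ^+ n by rewrite exprn_ge0 ?ltW.
have m1 : measurable_fun setT (fun x : R => b0 + c * x).
  by apply: measurable_funD => //; exact: measurable_funM.
have := @product_measure_scaling R _ _ _ _ (@lebesgue_measure R) (lebesgue_rV n)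
  (fun x => b0 + c * x) (fun x => b' + c *: x) (NngNum (ltW c0)) (NngNum cn0)
  m1 (measurable_rV_affine _ _)
  (fun A mA => lebesgue_measure_affine b0 c0 mA) (fun A mA => IHn b' A mA) _ mB'.
rewrite /= -exprS /lebesgue_rVS /pushforward => ->.
congr (_ * (product_measure1 _ _ _))%E; apply/funext => -[x y] /=.
congr (B _); apply/rowP => i; rewrite !mxE.
by case: (unliftP ord0 i) => [j ->|->]; rewrite ?liftK ?unlift_none ?mxE.
Qed.

Lemma lebesgue_rV_translate n (b : 'rV[R]_n) (B : set 'rV[R]_n) : measurable B ->
  lebesgue_rV n ((fun x => x + b) @^-1` B) = lebesgue_rV n B.
Proof.
move=> mB; rewrite (lebesgue_rV_affine b ltr01 mB) expr1n mul1e.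
congr (lebesgue_rV n _); apply/funext => x; rewrite /preimage /=.
by rewrite scale1r addrC.
Qed.

Lemma measurable_rVD d (T : measurableType d) n (f g : T -> 'rV[R]_n) :
  measurable_fun setT f -> measurable_fun setT g ->
  measurable_fun setT (fun x => f x + g x).
Proof.
move=> /measurable_fun_rVP mf /measurable_fun_rVP mg.
apply/measurable_fun_rVP => i; under eq_fun do rewrite mxE.
exact: measurable_funD.
Qed.

Lemma measurable_rVB d (T : measurableType d) n (f g : T -> 'rV[R]_n) :
  measurable_fun setT f -> measurable_fun setT g ->
  measurable_fun setT (fun x => f x - g x).
Proof.
move=> /measurable_fun_rVP mf /measurable_fun_rVP mg.
apply/measurable_fun_rVP => i; under eq_fun do rewrite !mxE.
exact: measurable_funB.
Qed.

Lemma measurable_dotp n (e : 'rV[R]_n) :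
  measurable_fun setT (fun x => dotp x e).
Proof.
apply: measurable_sum => i; apply: measurable_funM => //.
exact: measurable_rV_coord.
Qed.

Lemma ge0_integral_translate n (b : 'rV[R]_n) (f : 'rV[R]_n -> \bar R) :
  measurable_fun setT f -> (forall x, (0 <= f x)%E) ->
  (\int[lebesgue_rV n]_x f (x + b)%R = \int[lebesgue_rV n]_x f x)%E.
Proof.
move=> mf f0.
have mphi : measurable_fun setT (fun x : 'rV[R]_n => x + b).
  by apply: measurable_rVD.
rewrite -[LHS](ge0_integral_pushforward mphi (lebesgue_rV n) measurableT mf)//.
by apply: eq_measure_integral => A mA _; exact: lebesgue_rV_translate.
Qed.

(** If the normal vector is not along the first axis, the slices with a fixed
    first coordinate are hyperplanes of the remaining space; otherwise the
    hyperplane is a point times the remaining space. *)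
Lemma null_hyperplane n (e : 'rV[R]_n) (t : R) : e != 0 ->
  lebesgue_rV n [set x | dotp x e = t] = 0%E.
Proof.
elim: n e t => [|n IHn] e t e0.
  by exfalso; move/eqP: e0; apply; apply/rowP => -[].
pose e' : 'rV[R]_n := \row_j e ord0 (lift ord0 j).
have E a v : dotp (rV_cons (a, v)) e = a * e ord0 ord0 + dotp v e'.
  rewrite /dotp big_ord_recl !mxE unlift_none; congr (_ + _).
  by apply: eq_bigr => i _; rewrite !mxE liftK.
rewrite /= /lebesgue_rVS /pushforward.
have [e'0|e'0] := eqVneq e' 0; last first.
  rewrite /product_measure1; apply: integral0_eq => a _ /=.
  rewrite -[RHS](IHn e' (t - a * e ord0 ord0) e'0); congr (lebesgue_rV n _).
  by apply/seteqP; split => v; rewrite /xsection /= inE/= E; lra.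
have e00 : e ord0 ord0 != 0.
  apply: contra_neq e0 => e00; apply/rowP => i; rewrite mxE.
  case: (unliftP ord0 i) => [j ->|->//].
  by have /rowP/(_ j) := e'0; rewrite !mxE.
rewrite (_ : _ @^-1` _ = [set t / e ord0 ord0] `*` setT).
  rewrite product_measure1E//.
  rewrite [X in (X * _)%E](_ : _ = 0%E) ?mul0e//.
  exact: lebesgue_measure_set1.
have D0 (v : 'rV[R]_n) : dotp v 0 = 0.
  by rewrite /dotp big1// => i _; rewrite mxE mulr0.
apply/seteqP; split => -[a v] /=; rewrite E e'0 D0 addr0.
  by move=> <-; split => //; rewrite mulfK.
by move=> [-> _]; rewrite mulfVK.
Qed.

(** The sigma-algebra is generated by the coordinates, so an open set is written
    as a countable union of boxes with rational vertices. *)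
Lemma measurable_rV_open n (O : set 'rV[R]_n) : open O -> measurable O.
Proof.
move=> oO.
pose box (q : 'rV[rat]_n * 'rV[rat]_n) : set 'rV[R]_n :=
  [set y | forall i, ratr (q.1 ord0 i) < y ord0 i < ratr (q.2 ord0 i)].
have mbox q : measurable (box q).
  rewrite (_ : box q = \big[setI/setT]_(i < n)
      (@rV_coord _ R n i @^-1`
         ([set` `]ratr (q.1 ord0 i), ratr (q.2 ord0 i)[ ] : set R))).
    apply: bigsetI_measurable => i _; rewrite -[_ @^-1` _]setTI.
    by apply: measurable_rV_coord => //; exact: measurable_itv.
  rewrite -bigcap_seq; apply/seteqP; split => y /= h i.
    by move=> _ /=; rewrite in_itv/=; exact: h.
  by have := h i (mem_index_enum i); rewrite /= in_itv.
have -> : O = \bigcup_q (if `[< box q `<=` O >] then box q else set0).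
  apply/seteqP; split => [x Ox|x [q _]]; last by case: asboolP => // h /h.
  have [P Px PO] := open_nbhs_nbhs (conj oO Ox).
  have /choice[ab Hab] : forall i : 'I_n, exists q : rat * rat,
      [/\ ratr q.1 < x ord0 i, x ord0 i < ratr q.2 &
          [set` `]ratr q.1, ratr q.2[ ] `<=` P ord0 i].
    move=> i; have /nbhs_ballP[r /= r0 rP] := Px ord0 i.
    have [a] := @rat_in_itvoo R (x ord0 i - r) (x ord0 i) (ltac:(lra)).
    have [b] := @rat_in_itvoo R (x ord0 i) (x ord0 i + r) (ltac:(lra)).
    rewrite !in_itv/= => /andP[b1 b2] /andP[a1 a2].
    exists (a, b); split => //= y; rewrite /= in_itv/= => /andP[y1 y2].
    by apply: rP; rewrite /ball/= ltr_norml; apply/andP; split; lra.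
  exists (\row_i (ab i).1, \row_i (ab i).2) => //.
  rewrite asboolT => [i|]; first by rewrite !mxE; have [-> ->] := Hab i.
  move=> y hy; apply: PO => i j; rewrite ord1.
  by have [_ _] := Hab j; apply; have := hy j; rewrite !mxE /= in_itv.
apply: countable_bigcupT_measurable => [|q]; first exact: countableP.
by case: ifP.
Qed.

End lebesgue_rV_geometry.

(** * Pointwise limits of p-integrable functions *)

Section Lp_limits.
Context {R : realType} d {X : measurableType d} (m : {measure set X -> \bar R}).
Variable p : R.
Hypothesis p1 : 1 < p.
Let p0 : 0 < p. Proof. by rewrite (lt_trans _ p1). Qed.
Local Notation inLp := (inLp m p).
Local Notation pnorm := (pnorm m p).

Lemma inLp_lty (U : X -> R) : measurable_fun setT U ->
  (\int[m]_x (`|U x| `^ p)%:E < +oo)%E <-> inLp U.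
Proof.
move=> mU; have mUp := measurable_normp p mU; split => [Uoo|[_ iU]].
  split => //; apply/integrableP; split; first exact/measurable_EFinP.
  apply: le_lt_trans Uoo; rewrite le_eqVlt; apply/orP; left; apply/eqP.
  by apply: eq_integral => x _ /=; rewrite ger0_norm// powR_ge0.
exact: (integrable_lty measurableT iU).
Qed.

Lemma pnorm_integral (U : X -> R) : inLp U ->
  (\int[m]_x (`|U x| `^ p)%:E = (pnorm U `^ p)%:E)%E.
Proof.
move=> [mU iU]; rewrite pnormE// fineK//.
exact: (integrable_fin_num measurableT iU).
Qed.

Lemma ae_eq_inLp (U V : X -> R) : measurable_fun setT V ->
  {ae m, forall x, U x = V x} -> inLp U -> inLp V /\ pnorm V = pnorm U.
Proof.
move=> mV UV lU; have [mU iU] := lU.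
have E : (\int[m]_x (`|V x| `^ p)%:E = \int[m]_x (`|U x| `^ p)%:E)%E.
  apply: ge0_ae_eq_integral => //.
  - by apply/measurable_EFinP; exact: measurable_normp.
  - by apply/measurable_EFinP; exact: measurable_normp.
  - by apply: filterS UV => x -> _.
split; first by apply/(inLp_lty mV); rewrite E (pnorm_integral lU) ltry.
by rewrite pnorm.unlock /Rintegral E.
Qed.

(** Fatou's lemma. That the limit is p-integrable is part of the conclusion,
    because it is first known as a pointwise limit only. *)
Lemma pnorm_fatou (U_ : nat -> X -> R) (U : X -> R) (e : R) :
  (forall k, inLp (U_ k)) -> measurable_fun setT U -> 0 <= e ->
  {ae m, forall x, U_ ^~ x @ \oo --> U x} -> (forall k, pnorm (U_ k) <= e) ->
  inLp U /\ pnorm U <= e.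
Proof.
move=> lU mU e0 Ucvg Ue.
have mp k : measurable_fun setT (fun x => (`|U_ k x| `^ p)%:E).
  by apply/measurable_EFinP; apply: measurable_normp; exact: (lU k).1.
have E : (\int[m]_x (`|U x| `^ p)%:E =
    \int[m]_x limn_einf (fun k => (`|U_ k x| `^ p)%:E))%E.
  apply: ge0_ae_eq_integral => //.
  - by apply/measurable_EFinP; exact: measurable_normp.
  - apply: measurableT_comp => //; apply: measurable_fun_limn_esup => k.
    exact: measurableT_comp.
  - move=> x _; rewrite limn_einf_lim; apply: lime_ge; first exact: is_cvg_einfs.
    apply: nearW => k; apply: le_ereal_inf_tmp => _ [i _ <-].
    by rewrite lee_fin powR_ge0.
  - apply: filterS Ucvg => x Ux _.
    have h : (fun k => (`|U_ k x| `^ p)%:E) @ \oo --> (`|U x| `^ p)%:E.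
      apply: cvg_EFin; first exact: nearW.
      by apply: (cvg_comp _ (fun t : R => `|t| `^ p) Ux); exact: continuous_normr_powR.
    by rewrite is_cvg_limn_einfE; [rewrite (cvg_lim _ h)|apply/cvg_ex; eexists; exact: h].
have le : (\int[m]_x (`|U x| `^ p)%:E <= (e `^ p)%:E)%E.
  rewrite E; apply: le_trans (fatou _ _ _ _) _ => //.
  rewrite limn_einf_lim; apply: lime_le; first exact: is_cvg_einfs.
  apply: nearW => k; apply: (@le_trans _ _ (\int[m]_x (`|U_ k x| `^ p)%:E)%E).
    by apply: ereal_inf_lbound; exists k => /=.
  rewrite pnorm_integral// lee_fin.
  by apply: ler_powRl; rewrite ?(ltW p0)// pnorm_ge0.
have lU' : inLp U by apply/inLp_lty => //; apply: le_lt_trans le _; rewrite ltry.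
split => //; move: le; rewrite pnorm_integral// lee_fin.
have pV : 0 <= p^-1 by rewrite invr_ge0 ltW.
move=> /(ler_powRl pV (powR_ge0 _ _)).
by rewrite !powRKV ?gt_eqF// pnorm_ge0.
Qed.

(** Riesz-Fischer: along a subsequence with increments summable at a geometric
    rate, the weighted series of the increments is integrable, hence the
    increments are pointwise dominated by a geometric sequence. *)
Lemma Lp_cauchy_subsequence (W_ : nat -> X -> R) :
  (forall n, inLp (W_ n)) ->
  (forall e : R, 0 < e -> exists N, forall i j, (N <= i)%N -> (N <= j)%N ->
     pnorm (fun x => W_ i x - W_ j x) <= e) ->
  exists phi : nat -> nat, exists2 w : X -> R, measurable_fun setT w &
    (forall k, (k <= phi k)%N) /\
    {ae m, forall x, (fun k => W_ (phi k) x) @ \oo --> w x}.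
Proof.
move=> lW cW.
pose a k : R := (2 ^ k)%:R `^ p.
have a0 k : 0 < a k by rewrite powR_gt0// ltr0n expn_gt0.
pose e k : R := ((a k)^-1 / (2 ^ k.+1)%:R) `^ p^-1.
have e0 k : 0 < e k.
  by rewrite powR_gt0// divr_gt0 ?invr_gt0// ltr0n expn_gt0.
have /choice[N_ HN] : forall k, exists N, forall i j, (N <= i)%N -> (N <= j)%N ->
    pnorm (fun x => W_ i x - W_ j x) <= e k by move=> k; exact: cW.
pose phi k := (k + \sum_(i < k.+1) N_ i)%N.
have phiN k : (N_ k <= phi k)%N.
  by rewrite /phi big_ord_recr/= addnA leq_addl.
have phiS k : (phi k <= phi k.+1)%N.
  by rewrite /phi [X in (_ <= _ + X)%N]big_ord_recr/= leq_add// leq_addr.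
pose D k x := W_ (phi k.+1) x - W_ (phi k) x.
have lD k : inLp (D k) by exact: inLpB.
have De k : pnorm (D k) <= e k by apply: HN => //; exact: leq_trans (phiS k).
pose w x := fine (limn_esup (fun k => (W_ (phi k) x)%:E)).
exists phi, w.
  apply: measurableT_comp => //.
  apply: measurable_fun_limn_esup => k; apply/measurable_EFinP.
  exact: (lW (phi k)).1.
split=> [k|]; first exact: leq_addr.
pose F k x := (a k * `|D k x| `^ p)%:E.
have F0 k x : (0 <= F k x)%E by rewrite lee_fin mulr_ge0 ?powR_ge0 ?(ltW (a0 k)).
have mF k : measurable_fun setT (F k).
  apply/measurable_EFinP; apply: measurable_funM => //.
  by apply: measurable_normp; exact: (lD k).1.
have Fint : (\int[m]_x \sum_(k <oo) F k x <= 1)%E.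
  rewrite integral_nneseries//.
  apply: le_trans (epsilon_trick0 xpredT ler01).
  apply: lee_nneseries => [k _ _|k _].
    by apply: integral_ge0 => x _; exact: F0.
  rewrite /F; under eq_integral do rewrite EFinM.
  rewrite ge0_integralZl_EFin//; last first.
  - by apply: ltW.
  - apply/measurable_EFinP; apply: measurable_normp; exact: (lD k).1.
  rewrite pnorm_integral// -EFinM lee_fin.
  have := ler_powRl (ltW p0) (pnorm_ge0 _ _ _) (De k).
  rewrite /e powRVK ?gt_eqF ?divr_ge0 ?invr_ge0 ?(ltW (a0 k))// => h.
  rewrite -ler_pdivlMl//; apply: (le_trans h).
  by rewrite div1r.
have Fi : m.-integrable setT (fun x => \sum_(k <oo) F k x)%E.
  apply/integrableP; split; first exact: ge0_emeasurable_sum.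
  apply: (@le_lt_trans _ _ 1%E); last by rewrite ltry.
  apply: le_trans Fint; rewrite le_eqVlt; apply/orP; left; apply/eqP.
  apply: eq_integral => x _; rewrite gee0_abs//.
  by apply: nneseries_ge0 => k _ _; exact: F0.
apply: filterS (integrable_ae measurableT Fi) => x /(_ I) Sfin.
pose S := fine (\sum_(k <oo) F k x)%E.
have S0 : 0 <= S by apply/fine_ge0/nneseries_ge0 => k _ _; exact: F0.
have FS k : a k * `|D k x| `^ p <= S.
  rewrite -lee_fin /S fineK// -/(F k x).
  apply: le_trans (nneseries_lim_ge k.+1 _) => //.
  rewrite big_mkord big_ord_recr/= leeDr// sume_ge0// => i _; exact: F0.
have DS k : `|D k x| <= S `^ p^-1 * 2^-1 ^+ k.
  have pV : 0 <= p^-1 by rewrite invr_ge0 ltW.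
  have := ler_powRl pV _ (FS k); rewrite powRM ?(ltW (a0 k)) ?powR_ge0//.
  rewrite /a !powRKV ?gt_eqF// => /(_ (mulr_ge0 (powR_ge0 _ _) (powR_ge0 _ _))) h.
  have k0 : 0 < (2 ^ k)%:R :> R by rewrite ltr0n expn_gt0.
  by rewrite exprVn -natrX ler_pdivlMr// mulrC.
have cD : cvgn (series (fun k => D k x)).
  apply: normed_cvg; apply: (@series_le_cvg _ _ (geometric (S `^ p^-1) 2^-1)).
  - by move=> k /=; exact: normr_ge0.
  - by move=> k /=; rewrite mulr_ge0 ?powR_ge0// exprn_ge0.
  - by move=> k /=; exact: DS.
  - by apply: is_cvg_geometric_series; rewrite ger0_norm// invf_lt1// ltr1n.
have cW' : cvgn (fun k => W_ (phi k) x).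
  have -> : (fun k => W_ (phi k) x) =
      (fun k => W_ (phi 0%N) x + series (fun k => D k x) k).
    by apply/funext => k; exact: (eq_sum_telescope (fun k => W_ (phi k) x) k).
  by apply: is_cvgD => //; exact: is_cvg_cst.
have -> : w x = limn (fun k => W_ (phi k) x); last exact: cW'.
have h : (fun k => (W_ (phi k) x)%:E) @ \oo --> (limn (fun k => W_ (phi k) x))%:E.
  by apply: cvg_EFin; [exact: nearW|exact: cW'].
rewrite /w is_cvg_limn_esupE; first by rewrite (cvg_lim _ h).
by apply/cvg_ex; eexists; exact: h.
Qed.

End Lp_limits.

(** * Weighted increments *)

Section increments.
Context {R : realType} {d : nat}.
Local Notation V := 'rV[R]_d.
Local Notation leb := (@lebesgue_rV R d).
Local Notation leb2 := (leb \x leb)%E.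
Variables (p : R) (nu : V -> R) (Omega : set V).

(** The kernel is given off the origin; with the value 0 there, it is even,
    nonnegative and measurable on the whole space. *)
Definition kernel0 (h : V) : R := if h == 0 then 0 else nu h.

(** A [p]-th root of the kernel, since increments are raised to the power [p]. *)
Definition interaction_weight (z : V * V) : R :=
  \1_(~` (~` Omega `*` ~` Omega)) z * kernel0 (z.1 - z.2) `^ p^-1.

Definition increment (u : V -> R) (z : V * V) : R :=
  interaction_weight z * (u z.1 - u z.2).

Definition cutoff (u : V -> R) (x : V) : R := \1_Omega x * u x.

Hypothesis d0 : (0 < d)%N.
Hypothesis p1 : 1 < p.
Hypothesis nuL : levy_kernel p nu.
Hypothesis mO : measurable Omega.
Let p0 : 0 < p. Proof. by rewrite (lt_trans _ p1). Qed.

Lemma increment_lin k u v :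
  increment (fun y => k * u y + v y) =
  (fun z => k * increment u z + increment v z).
Proof. by apply/funext => z; rewrite /increment; ring. Qed.

Lemma cutoff_lin k u v :
  cutoff (fun y => k * u y + v y) = (fun x => k * cutoff u x + cutoff v x).
Proof. by apply/funext => z; rewrite /cutoff; ring. Qed.

Let basis_vector : exists e : V, e != 0.
Proof.
case: d d0 => // n _; exists (const_mx 1).
by apply/eqP => /rowP/(_ ord0); rewrite !mxE; apply/eqP; rewrite oner_eq0.
Qed.

Lemma measurable_neq0 : measurable [set h : V | h != 0].
Proof.
have -> : [set h : V | h != 0] = ~` ((fun h : V => dotp h h) @^-1` [set 0]).
  apply/seteqP; split => h /=.
    move=> h0 hh; move/eqP: h0; apply; apply/rowP => i; rewrite mxE.
    have /eqP := hh; rewrite /dotp psumr_eq0 => [/allP/(_ i (mem_index_enum i))|j _].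
      by rewrite mulf_eq0 orbb => /eqP.
    by rewrite -expr2 sqr_ge0.
  move=> hh; apply/eqP => h0; apply: hh; rewrite h0 /dotp big1// => i _.
  by rewrite mxE mul0r.
apply: measurableC; rewrite -[_ @^-1` _]setTI.
have mf : measurable_fun setT (fun h : V => dotp h h).
  by apply: measurable_sum => i; apply: measurable_funM; exact: measurable_rV_coord.
by apply: mf.
Qed.

Lemma measurable_kernel0 : measurable_fun setT kernel0.
Proof.
have -> : kernel0 = nu \_ [set h | h != 0].
  apply/funext => h; rewrite /kernel0 patchE; have [->|h0] := eqVneq h 0.
    by rewrite memNset//= eqxx.
  by rewrite mem_set.
apply/(measurable_restrictT _ measurable_neq0).
by case: nuL.
Qed.

Lemma kernel0_ge0 h : 0 <= kernel0 h.
Proof. by rewrite /kernel0; case: eqVneq => // h0; case: nuL => _ /(_ _ h0). Qed.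

Lemma kernel0N h : kernel0 (- h) = kernel0 h.
Proof.
rewrite /kernel0 oppr_eq0; case: eqVneq => // h0.
by case: nuL => _ _ /(_ _ h0).
Qed.

Lemma measurable_kernel : measurable_fun setT nu.
Proof.
have -> : nu = (fun h => kernel0 h + nu 0 * \1_(~` [set h | h != 0]) h).
  apply/funext => h; rewrite /kernel0 indicE; have [->|h0] := eqVneq h 0.
    by rewrite mem_set/= ?eqxx// mulr1 add0r.
  by rewrite memNset/= ?h0 ?mulr0 ?addr0// => /(_ isT).
apply: measurable_funD; first exact: measurable_kernel0.
apply: measurable_funM => //; apply: measurable_indic.
by apply: measurableC; exact: measurable_neq0.
Qed.

(** A point lies on a hyperplane, which is negligible. *)
Lemma ae_neq (x : V) : {ae leb, forall y, x - y != 0}.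
Proof.
have [e e0] := basis_vector.
exists [set y | dotp y e = dotp x e]; split.
- rewrite (_ : [set y | _] = (fun y => dotp y e) @^-1` [set dotp x e])//.
  by rewrite -[_ @^-1` _]setTI; apply: measurable_dotp.
- exact: null_hyperplane.
- move=> y /= /negP; rewrite negbK subr_eq0 => /eqP ->//.
Qed.

Let measurable_fst_snd (f : V -> R) : measurable_fun setT f ->
  measurable_fun setT (fun z : V * V => f z.1) /\
  measurable_fun setT (fun z : V * V => f z.2).
Proof. by move=> mf; split; exact: measurableT_comp. Qed.

Lemma measurable_rV_sub : measurable_fun setT (fun z : V * V => z.1 - z.2).
Proof. exact: measurable_rVB. Qed.

(** The slices of [{z | <z.1 - z.2, e> = 0}] are hyperplanes. *)
Lemma ae_neq2 : {ae leb2, forall z, z.1 - z.2 != 0}.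
Proof.
have [e e0] := basis_vector.
have mD : measurable_fun setT (fun z : V * V => dotp (z.1 - z.2) e).
  exact: (measurableT_comp (measurable_dotp e) measurable_rV_sub).
exists [set z | dotp (z.1 - z.2) e = 0]; split.
- rewrite (_ : [set z | _] = (fun z : V * V => dotp (z.1 - z.2) e) @^-1` [set 0])//.
  by rewrite -[_ @^-1` _]setTI; apply: mD.
- rewrite /product_measure1; apply: integral0_eq => x _ /=.
  rewrite -[RHS](null_hyperplane (dotp x e) e0); congr (lebesgue_rV d _).
  have dB (y : V) : dotp (x - y) e = dotp x e - dotp y e.
    rewrite /dotp -sumrB; apply: eq_bigr => i _; rewrite !mxE; ring.
  by apply/seteqP; split => y; rewrite /xsection /= inE/= dB; lra.
- move=> z /= /negP; rewrite negbK => /eqP ->.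
  by rewrite /dotp big1// => i _; rewrite mxE mul0r.
Qed.

Lemma measurable_outer : measurable (~` (~` Omega `*` ~` Omega)).
Proof.
by apply: measurableC; apply: measurableX; exact: measurableC.
Qed.

Lemma interaction_weight_ge0 z : 0 <= interaction_weight z.
Proof. by rewrite mulr_ge0 ?powR_ge0// indicE. Qed.

Lemma interaction_weight_pow z : interaction_weight z `^ p =
  \1_(~` (~` Omega `*` ~` Omega)) z * kernel0 (z.1 - z.2).
Proof.
rewrite /interaction_weight powRM ?powR_ge0 ?indicE//.
rewrite powRVK ?gt_eqF ?kernel0_ge0//; congr (_ * _).
by case: (_ \in _); rewrite ?powR1// powR0 ?gt_eqF.
Qed.

Lemma measurable_increment u : measurable_fun setT u ->
  measurable_fun setT (increment u).
Proof.
move=> mu; have [mu1 mu2] := measurable_fst_snd mu.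
apply: measurable_funM; last exact: measurable_funB.
apply: measurable_funM.
  by apply: measurable_indic; exact: measurable_outer.
apply: (measurableT_comp (measurable_powR _)).
exact: (measurableT_comp measurable_kernel0 measurable_rV_sub).
Qed.

Lemma measurable_cutoff u : measurable_fun setT u -> measurable_fun setT (cutoff u).
Proof. by move=> mu; apply: measurable_funM => //; exact: measurable_indic. Qed.

Definition local_energy (u : V -> R) (z : V * V) : R :=
  `|u z.1 - u z.2| `^ p * kernel0 (z.1 - z.2).

Lemma local_energy_ge0 u z : 0 <= local_energy u z.
Proof. by rewrite mulr_ge0 ?powR_ge0 ?kernel0_ge0. Qed.

Lemma local_energyC u x y : local_energy u (x, y) = local_energy u (y, x).
Proof.
by rewrite /local_energy /= -normrN opprB -kernel0N opprB.
Qed.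

Lemma measurable_local_energy u : measurable_fun setT u ->
  measurable_fun setT (local_energy u).
Proof.
move=> mu; have [mu1 mu2] := measurable_fst_snd mu.
apply: measurable_funM; first by apply: measurable_normp; exact: measurable_funB.
exact: (measurableT_comp measurable_kernel0 measurable_rV_sub).
Qed.

Lemma increment_pow u z : `|increment u z| `^ p =
  \1_(~` (~` Omega `*` ~` Omega)) z * local_energy u z.
Proof.
rewrite /increment normrM (ger0_norm (interaction_weight_ge0 _)).
rewrite powRM ?interaction_weight_ge0// interaction_weight_pow /local_energy.
ring.
Qed.

Lemma nu_partE u : measurable_fun setT u ->
  nu_part p nu Omega u = (\int[leb2]_z (\1_Omega z.1 * local_energy u z)%:E)%E.
Proof.
move=> mu; have [mI1 _] := measurable_fst_snd (measurable_indic mO).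
have mG : measurable_fun setT (fun z : V * V => (\1_Omega z.1 * local_energy u z)%:E).
  apply/measurable_EFinP; apply: measurable_funM => //.
  exact: measurable_local_energy.
have G0 z : (0 <= (\1_Omega z.1 * local_energy u z)%:E)%E.
  by rewrite lee_fin mulr_ge0 ?local_energy_ge0// indicE.
rewrite (fubini_tonelli1 _ mG G0).
rewrite /nu_part integral_mkcond; apply: eq_integral => x _.
rewrite /fubini_F patchE /=; case: ifPn => xO; last first.
  under [RHS]eq_integral do rewrite indicE (negbTE xO) mul0r.
  by rewrite integral0.
under [RHS]eq_integral do rewrite indicE xO mul1r.
have mxy : measurable_fun setT (fun y : V => x - y) by exact: measurable_rVB.
have mpow : measurable_fun setT (fun y : V => `|u x - u y| `^ p).
  by apply: measurable_normp; exact: measurable_funB.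
apply: ae_eq_integral => //.
- apply/measurable_EFinP; apply: (measurable_funM mpow).
  exact: (measurableT_comp measurable_kernel mxy).
- apply/measurable_EFinP; apply: (measurable_funM mpow).
  exact: (measurableT_comp measurable_kernel0 mxy).
- apply: filterS (ae_neq x) => y xy _.
  by rewrite /local_energy /kernel0 /= (negbTE xy).
Qed.

Lemma nu_part_le_increment u : measurable_fun setT u ->
  (nu_part p nu Omega u <= \int[leb2]_z (`|increment u z| `^ p)%:E)%E.
Proof.
move=> mu; rewrite nu_partE//; have [mI1 _] := measurable_fst_snd (measurable_indic mO).
have mL := measurable_local_energy mu.
apply: ge0_le_integral => //.
- by move=> z _; rewrite lee_fin mulr_ge0 ?local_energy_ge0// indicE.
- by apply/measurable_EFinP; exact: measurable_funM.
- by apply/measurable_EFinP; apply: measurable_normp; exact: measurable_increment.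
- move=> z _; rewrite lee_fin increment_pow ler_wpM2r ?local_energy_ge0//.
  rewrite !indicE; case: (boolP (z.1 \in Omega)) => // /set_mem zO.
  by rewrite mem_set//= => -[].
Qed.

(** A pair that meets [Omega] has its first or its second point there, and by the
    symmetry of the kernel both cases carry the same energy. *)
Lemma increment_le_nu_part u : measurable_fun setT u ->
  (\int[leb2]_z (`|increment u z| `^ p)%:E <=
    nu_part p nu Omega u + nu_part p nu Omega u)%E.
Proof.
move=> mu; rewrite nu_partE//.
have [mI1 mI2] := measurable_fst_snd (measurable_indic mO).
have mL := measurable_local_energy mu.
have mG1 : measurable_fun setT (fun z : V * V => (\1_Omega z.1 * local_energy u z)%:E).
  by apply/measurable_EFinP; exact: measurable_funM.
have mG2 : measurable_fun setT (fun z : V * V => (\1_Omega z.2 * local_energy u z)%:E).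
  by apply/measurable_EFinP; exact: measurable_funM.
have G1 z : (0 <= (\1_Omega z.1 * local_energy u z)%:E)%E.
  by rewrite lee_fin mulr_ge0 ?local_energy_ge0// indicE.
have G2 z : (0 <= (\1_Omega z.2 * local_energy u z)%:E)%E.
  by rewrite lee_fin mulr_ge0 ?local_energy_ge0// indicE.
have swap : (\int[leb2]_z (\1_Omega z.1 * local_energy u z)%:E =
             \int[leb2]_z (\1_Omega z.2 * local_energy u z)%:E)%E.
  rewrite (fubini_tonelli1 _ mG1 G1) (fubini_tonelli2 _ mG2 G2).
  apply: eq_integral => x _; rewrite /fubini_F /fubini_G.
  by apply: eq_integral => y _ /=; rewrite local_energyC.
rewrite {2}swap -ge0_integralD//; apply: ge0_le_integral => //.
- by apply/measurable_EFinP; apply: measurable_normp; exact: measurable_increment.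
- exact: emeasurable_funD.
- move=> z _; rewrite -EFinD lee_fin increment_pow -mulrDl.
  rewrite ler_wpM2r ?local_energy_ge0// !indicE.
  case: (boolP (z.1 \in Omega)) => [_|z1].
    by rewrite ler_wpDr ?ler0n// lern1; case: (_ \in _).
  case: (boolP (z.2 \in Omega)) => [_|z2].
    by rewrite add0r lern1; case: (_ \in _).
  rewrite notin_setE in z1; rewrite notin_setE in z2.
  by rewrite memNset/=; [rewrite addr0|move=> h; apply: h].
Qed.

Lemma Lp_partE u : Lp_part p Omega u = (\int[leb]_x (`|cutoff u x| `^ p)%:E)%E.
Proof.
rewrite /Lp_part integral_mkcond; apply: eq_integral => x _.
rewrite patchE /cutoff indicE; case: ifPn => xO; first by rewrite mul1r.
by rewrite mul0r normr0 powR0// gt_eqF.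
Qed.

(** As [psi] is homogeneous of degree [p - 1], the weight enters with the power
    [p], which restores the kernel. *)
Lemma energyE u v : measurable_fun setT u -> measurable_fun setT v ->
  energy p nu Omega u v = pform leb2 p (increment u) (increment v).
Proof.
move=> mu mv; rewrite pform.unlock /energy /Rintegral; congr fine.
have [mu1 mu2] := measurable_fst_snd mu; have [mv1 mv2] := measurable_fst_snd mv.
rewrite integral_mkcond; apply: ae_eq_integral => //.
- apply/(measurable_restrictT _ measurable_outer).
  apply: measurable_funTS; apply/measurable_EFinP; apply: measurable_funM.
    apply: measurable_funM; last exact: measurable_funB.
    by apply: measurable_psi; exact: measurable_funB.
  exact: (measurableT_comp measurable_kernel measurable_rV_sub).
- apply/measurable_EFinP; apply: measurable_funM.
    by apply: measurable_psi; exact: measurable_increment.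
  exact: measurable_increment.
- apply: filterS ae_neq2 => z zz _; rewrite patchE.
  rewrite /increment psiM ?interaction_weight_ge0//.
  have -> : interaction_weight z `^ (p - 1) * psi p (u z.1 - u z.2) *
      (interaction_weight z * (v z.1 - v z.2)) =
      psi p (u z.1 - u z.2) * (v z.1 - v z.2) *
      (interaction_weight z * interaction_weight z `^ (p - 1)) by ring.
  rewrite mulr_powRB1 ?interaction_weight_ge0// interaction_weight_pow.
  rewrite indicE /kernel0 (negbTE zz); case: ifPn => _; first by rewrite mul1r.
  by rewrite mul0r mulr0.
Qed.

End increments.

(** * The Poincare inequality *)

Section poincare.
Context {R : realType} {d : nat}.
Local Notation V := 'rV[R]_d.
Local Notation leb := (@lebesgue_rV R d).
Local Notation leb2 := (leb \x leb)%E.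
Variables (p : R) (nu : V -> R) (Omega : set V).
Hypothesis d0 : (0 < d)%N.
Hypothesis p1 : 1 < p.
Hypothesis nuL : levy_kernel p nu.
Hypothesis mO : measurable Omega.
Let p0 : 0 < p. Proof. by rewrite (lt_trans _ p1). Qed.
Local Notation k0 := (kernel0 nu).

Let exists_pos_measure (F : nat -> set V) : (forall k, measurable (F k)) ->
  leb (\bigcup_k F k) != 0%E -> exists k, leb (F k) != 0%E.
Proof.
move=> mF; apply: contra_neqP => /forallNP h.
apply: measure_negligible; first exact: bigcupT_measurable.
apply: negligible_bigcup => k; exists (F k); split => //.
by apply/eqP; apply: contrapT => /negP /h.
Qed.

Let exists_pos_lower_bound (A : set V) : measurable A -> leb A != 0%E ->
  exists2 a : R, 0 < a & ((2 * a)%:E <= leb A)%E.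
Proof.
move=> mA A0; have Apos : (0 < leb A)%E by rewrite lt0e A0 measure_ge0.
have [Aoo|Aoo] := eqVneq (leb A) +oo%E; first by exists 1 => //; rewrite Aoo leey.
have Afin : leb A \is a fin_num by rewrite ge0_fin_numE// ltey.
exists (fine (leb A) / 2); first by rewrite divr_gt0// fine_gt0// Apos ltey.
by rewrite mulrCA divff// mulr1 fineK.
Qed.

Let posE : [set h | h != 0 /\ 0 < nu h] = [set h | 0 < k0 h].
Proof.
apply/seteqP; split => h /=; first by move=> [h0]; rewrite /kernel0 (negbTE h0).
by rewrite /kernel0; case: eqVneq => [_|//]; rewrite ltxx.
Qed.

Let inv_small (x : R) : 0 < x -> exists k : nat, forall j, (k <= j)%N -> j.+1%:R^-1 <= x.
Proof.
move=> x0; have /cvgrPdist_lt/(_ _ x0)[k _ Hk] := @cvg_harmonic R.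
exists k => j /Hk; rewrite /= sub0r normrN ger0_norm ?invr_ge0//.
exact: ltW.
Qed.

Let dotpDZ (x h e : V) (c : R) : dotp (x + c *: h) e = dotp x e + c * dotp h e.
Proof.
rewrite /dotp mulr_sumr -big_split/=; apply: eq_bigr => i _; rewrite !mxE; ring.
Qed.

(** A large multiple of a typical jump leaves the domain: for a domain of
    finite measure because the homothety of ratio [n] makes the set of returning
    jumps small, for a domain in a slab because the jumps orthogonal to the slab
    are negligible. *)
Lemma jumps_leave_domain :
  bounded_in_one_direction Omega \/ (leb Omega < +oo)%E ->
  exists (n : nat) (de c : R) (A : set V), [/\ 0 < de, 0 < c, measurable A,
    forall h, A h -> de <= k0 h &
    forall x, Omega x ->
      (c%:E <= leb (A `&` [set h | ~ Omega (x + n%:R *: h)%R]))%E].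
Proof.
have mk0 := measurable_kernel0 nuL.
have mlevel (f : V -> R) (t : R) : measurable_fun setT f -> measurable [set h | t <= f h].
  move=> mf; rewrite (_ : [set h | _] = f @^-1` `[t, +oo[%classic); last first.
    by apply/seteqP; split => h /=; rewrite in_itv/= andbT.
  by rewrite -[_ @^-1` _]setTI; apply: mf => //; exact: measurable_itv.
have pos : leb [set h | 0 < k0 h] != 0%E.
  by rewrite -posE gt_eqF//; case: nuL.
case=> [[R0 [e [R00 e1 Oe]]]|Ofin].
- have e0 : e != 0.
    apply: contra_eq_neq e1 => ->; rewrite /enorm /dotp big1 => [|i _].
      by rewrite sqrtr0 eq_sym oner_eq0.
    by rewrite mxE mul0r.
  have mabs : measurable_fun setT (fun h : V => `|dotp h e|).
    by apply: measurableT_comp => //; exact: measurable_dotp.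
  pose F (k : nat) := [set h | k.+1%:R^-1 <= k0 h] `&`
                      [set h | k.+1%:R^-1 <= `|dotp h e|].
  have mF k : measurable (F k) by apply: measurableI; exact: mlevel.
  have [|k Fk] := @exists_pos_measure F mF.
    apply: contra_neq pos => F0.
    apply: measure_negligible.
      rewrite (_ : [set h | _] = k0 @^-1` `]0, +oo[%classic); last first.
        by apply/seteqP; split => h /=; rewrite in_itv/= andbT.
      by rewrite -[_ @^-1` _]setTI; apply: mk0 => //; exact: measurable_itv.
    apply: (@negligibleS _ _ _ _ (\bigcup_k F k `|` [set h | dotp h e = 0])).
      move=> h /= hk; have [he|he] := eqVneq (dotp h e) 0; [by right|left].
      have [i Hi] := inv_small hk.
      have [j Hj] : exists k, forall j, (k <= j)%N -> j.+1%:R^-1 <= `|dotp h e|.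
        by apply: inv_small; rewrite normr_gt0.
      exists (maxn i j) => //; split => /=; [apply: Hi|apply: Hj].
        exact: leq_maxl.
      exact: leq_maxr.
    apply: negligibleU.
      by exists (\bigcup_k F k); split => //; exact: bigcupT_measurable.
    exists [set h | dotp h e = 0]; split => //; last exact: null_hyperplane.
    rewrite (_ : [set h | _] = (fun h => dotp h e) @^-1` [set 0])//.
    by rewrite -[_ @^-1` _]setTI; apply: measurable_dotp.
  have [a a0 aF] := exists_pos_lower_bound (mF k) Fk.
  pose n := (Num.bound (2 * R0 * k.+1%:R)).
  exists n, k.+1%:R^-1, a, (F k); split => //; first by move=> h [].
  move=> x Ox; rewrite (_ : F k `&` _ = F k).
    apply: le_trans aF; rewrite lee_fin; lra.
  apply/seteqP; split => h; first by case.
  move=> Fh; split => // /Oe; rewrite dotpDZ => h1; have h2 := Oe _ Ox.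
  have [_ /= h3] := Fh.
  have nk : 2 * R0 < n%:R * k.+1%:R^-1.
    rewrite ltr_pdivlMr//; apply: archi_boundP.
    by rewrite mulr_ge0// mulr_ge0// ltW.
  have h4 : n%:R * k.+1%:R^-1 <= n%:R * `|dotp h e| by rewrite ler_wpM2l.
  have h5 : n%:R * `|dotp h e| <= 2 * R0.
    rewrite -[n%:R]ger0_norm// -normrM.
    have -> : n%:R * dotp h e = (dotp x e + n%:R * dotp h e) - dotp x e by ring.
    by rewrite (le_trans (ler_normB _ _))//; lra.
  by have := lt_le_trans nk (le_trans h4 h5); rewrite ltxx.
- pose F (k : nat) := [set h | k.+1%:R^-1 <= k0 h].
  have mF k : measurable (F k) by exact: mlevel.
  have [|k Fk] := @exists_pos_measure F mF.
    apply: contra_neq pos => F0; rewrite -F0; congr (lebesgue_rV d _).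
    apply/seteqP; split => h /=.
      by move=> /inv_small[i Hi]; exists i => //; exact: Hi.
    by move=> [i _ /=]; apply: lt_le_trans; rewrite invr_gt0.
  have [a a0 aF] := exists_pos_lower_bound (mF k) Fk.
  have Of : leb Omega \is a fin_num by rewrite ge0_fin_numE.
  have M0 : 0 <= fine (leb Omega) by rewrite fine_ge0.
  pose n := (Num.bound (fine (leb Omega) / a)).+1.
  have n0 : 0 < n%:R :> R by rewrite ltr0n.
  exists n, k.+1%:R^-1, a, (F k); split => //.
  move=> x Ox; pose B := (fun h => x + n%:R *: h) @^-1` Omega.
  have mB : measurable B.
    by rewrite /B -[_ @^-1` _]setTI; apply: measurable_rV_affine.
  have Ba : (leb B <= a%:E)%E.
    rewrite -(@lee_pmul2l _ n%:R%:E)//; apply: (@le_trans _ _ (leb Omega)).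
      rewrite (lebesgue_rV_affine x n0 mO) lee_wpmul2r// lee_fin.
      by rewrite -natrX ler_nat -{1}(expn1 n) leq_exp2l.
    rewrite -(fineK Of) -EFinM lee_fin -ler_pdivrMr//.
    apply: ltW; apply: (lt_le_trans (archi_boundP _)); first by rewrite divr_ge0// ltW.
    by rewrite ler_nat.
  have mC : measurable (F k `&` [set h | ~ Omega (x + n%:R *: h)%R]).
    by apply: measurableI => //; exact: measurableC.
  have : (leb (F k) <= leb (F k `&` [set h | ~ Omega (x + n%:R *: h)%R]) + leb B)%E.
    apply: le_trans (measureU2 _ mC mB); apply: le_measure; rewrite ?inE//.
      exact: measurableU.
    by move=> h Fh; have [Bh|Bh] := pselect (B h); [right|left].
  move=> /(le_trans aF) h1.
  have h2 : ((2 * a)%:E <= leb (F k `&` [set h | ~ Omega (x + n%:R *: h)%R]) + a%:E)%E.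
    by apply: (le_trans h1); rewrite leeD2l.
  have -> : a%:E = ((2 * a)%:E - a%:E)%E by rewrite -EFinB; congr (_%:E); ring.
  by rewrite leeBlDr.
Qed.

(** The constant from [n] uses of [|a + b| ^ p <= 2 ^ p * (|a| ^ p + |b| ^ p)]. *)
Fixpoint shift_const (n : nat) : R :=
  if n is n'.+1 then 2 `^ p * (shift_const n' + 1) else 0.

Section translation_modulus.
Variable g : V -> R.
Hypothesis mg : measurable_fun setT g.
Hypothesis g0 : forall x, ~ Omega x -> g x = 0.

Let F (h : V) : \bar R := (\int[leb]_x (`|g (x + h) - g x| `^ p)%:E)%E.

Let mshift (h : V) : measurable_fun setT (fun x : V => `|g (x + h) - g x| `^ p).
Proof.
apply: measurable_normp; apply: measurable_funB => //.
by apply: (measurableT_comp mg); exact: measurable_rVD.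
Qed.

Let F_ge0 h : (0 <= F h)%E.
Proof. by apply: integral_ge0 => x _; rewrite lee_fin powR_ge0. Qed.

Let F_add a b : (F (a + b) <= (2 `^ p)%:E * (F a + F b))%E.
Proof.
have -> : F b = (\int[leb]_x (`|g ((x + a) + b) - g (x + a)| `^ p)%:E)%E.
  rewrite (@ge0_integral_translate R d a (fun x : V => (`|g (x + b) - g x| `^ p)%:E))//.
  by apply/measurable_EFinP.
have m2 : measurable_fun setT (fun x : V => `|g ((x + a) + b) - g (x + a)| `^ p).
  by apply: (measurableT_comp (mshift b)); exact: measurable_rVD.
rewrite addeC /F -ge0_integralD//; last 2 first.
- by apply/measurable_EFinP.
- by apply/measurable_EFinP; exact: mshift.
rewrite -ge0_integralZl_EFin ?powR_ge0//; last 2 first.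
- by move=> x _; rewrite adde_ge0.
- by apply: emeasurable_funD; apply/measurable_EFinP => //; exact: mshift.
apply: ge0_le_integral => //.
- by apply/measurable_EFinP; exact: mshift.
- apply: emeasurable_funM => //.
  by apply: emeasurable_funD; apply/measurable_EFinP => //; exact: mshift.
- move=> x _; rewrite -EFinD -EFinM lee_fin addrA.
  have -> : g (x + a + b) - g x = (g (x + a + b) - g (x + a)) + (g (x + a) - g x).
    by ring.
  exact: powR_normD_le.
Qed.

Let shift_const_ge0 n : 0 <= shift_const n.
Proof. by elim: n => //= n IH; rewrite mulr_ge0 ?powR_ge0// addr_ge0. Qed.

Let F_mul n h : (F (n%:R *: h) <= (shift_const n)%:E * F h)%E.
Proof.
elim: n => [|n IH].
  rewrite scale0r mul0e /F integral0_eq// => x _.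
  by rewrite addr0 subrr normr0 powR0// gt_eqF.
rewrite -natr1 scalerDl scale1r (le_trans (F_add _ _))// [shift_const _]/= EFinM -muleA.
rewrite lee_wpmul2l ?lee_fin ?powR_ge0//.
by rewrite EFinD ge0_muleDl ?lee_fin// mul1e leeD2r.
Qed.

Let measurable_shift2 (c : R) :
  measurable_fun setT (fun z : V * V => g (z.2 + c *: z.1) - g z.2).
Proof.
apply: measurable_funB; last exact: measurableT_comp.
apply: (measurableT_comp mg); apply: measurable_rVD => //.
apply: (@measurableT_comp _ _ _ _ _ _ (fun x : V => c *: x)) => //.
have := @measurable_rV_affine R d 0 c; under eq_fun do rewrite add0r.
by [].
Qed.

(** Where [x + n h] is outside the domain, [|g x| = |g (x + n h) - g x|]. Averaged
    over the jumps [h] in [A], the left side is thus bounded by the translations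
    by [n h], hence by those by [h], and on [A] the kernel is at least [de]. *)
Lemma poincare_shift (n : nat) (de c : R) (A : set V) : 0 < de -> 0 <= c ->
  measurable A -> (forall h, A h -> de <= k0 h) ->
  (forall x, Omega x -> (c%:E <= leb (A `&` [set h | ~ Omega (x + n%:R *: h)%R]))%E) ->
  (c%:E * \int[leb]_x (`|g x| `^ p)%:E <=
    (shift_const n * de^-1)%:E * \int[leb2]_z (local_energy p nu g z)%:E)%E.
Proof.
move=> de0 c0 mA Ak Ac.
have mk0 := measurable_kernel0 nuL.
have mIA : measurable_fun setT (\1_A : V -> R) by exact: measurable_indic.
have mG c' : measurable_fun setT (fun z : V * V => `|g (z.2 + c' *: z.1) - g z.2| `^ p).
  by apply: measurable_normp; exact: measurable_shift2.
have mpg : measurable_fun setT (fun x : V => `|g x| `^ p) by exact: measurable_normp.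
(* from each point of the domain, the dilated jumps of a part of [A] of measure
   at least [c] lead outside *)
have lower : (c%:E * \int[leb]_x (`|g x| `^ p)%:E <=
    \int[leb]_h ((\1_A h)%:E * F (n%:R *: h)%R))%E.
  pose G (z : V * V) := (\1_A z.1 * `|g (z.2 + n%:R *: z.1) - g z.2| `^ p)%:E.
  have mGG : measurable_fun setT G.
    apply/measurable_EFinP; apply: measurable_funM => //.
    exact: (measurableT_comp mIA).
  have G0 z : (0 <= G z)%E by rewrite lee_fin mulr_ge0 ?powR_ge0// indicE.
  have -> : (\int[leb]_h ((\1_A h)%:E * F (n%:R *: h)%R) =
      \int[leb]_h fubini_F leb G h)%E.
    apply: eq_integral => h _; rewrite /fubini_F /G /F -ge0_integralZl_EFin//.
    by apply/measurable_EFinP; exact: mshift.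
  rewrite -(fubini_tonelli1 _ mGG G0) (fubini_tonelli2 _ mGG G0).
  rewrite -ge0_integralZl_EFin//; last exact/measurable_EFinP.
  apply: ge0_le_integral => //.
  - by move=> x _; rewrite -EFinM lee_fin mulr_ge0 ?powR_ge0.
  - by apply/measurable_EFinP; exact: measurable_funM.
  - exact: measurable_fun_fubini_tonelli_G.
  - move=> x _; have [Ox|Ox] := pselect (Omega x); last first.
      rewrite g0// normr0 powR0 ?gt_eqF// mule0; exact: integral_ge0.
    pose B := A `&` [set h | ~ Omega (x + n%:R *: h)].
    have mB : measurable B.
      apply: measurableI => //.
      rewrite (_ : [set h | _] = ~` ((fun h => x + n%:R *: h) @^-1` Omega))//.
      apply: measurableC; rewrite -[_ @^-1` _]setTI.
      by apply: measurable_rV_affine.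
    apply: (@le_trans _ _ (\int[leb]_h ((`|g x| `^ p)%:E * (\1_B h)%:E))%E).
      rewrite ge0_integralZl_EFin ?powR_ge0//; last first.
        by apply/measurable_EFinP; exact: measurable_indic.
      rewrite integral_indic// setIT muleC lee_wpmul2l ?lee_fin ?powR_ge0//.
      exact: Ac.
    apply: ge0_le_integral => //.
    - apply/measurable_EFinP; apply: measurable_funM => //; exact: measurable_indic.
    - have := measurableT_comp mGG (measurable_pair2 x).
      by [].
    - move=> h _; rewrite -EFinM lee_fin !indicE.
      case: (boolP (h \in B)) => [/set_mem[Ah Oh]|_].
        by rewrite mulr1 mem_set// mul1r /= (g0 Oh) sub0r normrN.
      by rewrite mulr0 mulr_ge0 ?powR_ge0// ler0n.
apply: (le_trans lower).
pose L (z : V * V) := (k0 z.1 * `|g (z.2 + z.1) - g z.2| `^ p)%:E.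
have mL : measurable_fun setT L.
  apply/measurable_EFinP; apply: measurable_funM; first exact: measurableT_comp.
  by have := mG 1; under eq_fun do rewrite scale1r.
have L0 z : (0 <= L z)%E.
  by rewrite lee_fin mulr_ge0 ?powR_ge0// (kernel0_ge0 nuL).
have FL h : fubini_F leb L h = ((k0 h)%:E * F h)%E.
  rewrite /fubini_F /L /F -ge0_integralZl_EFin ?(kernel0_ge0 nuL)//.
  - by apply/measurable_EFinP; exact: mshift.
(* the energy in the variables [x] and [h = y - x] *)
have -> : (\int[leb2]_z (local_energy p nu g z)%:E = \int[leb]_h ((k0 h)%:E * F h))%E.
  have mle := measurable_local_energy nuL mg.
  have mlE : measurable_fun setT (fun z => (local_energy p nu g z)%:E).
    exact/measurable_EFinP.
  rewrite fubini_tonelli2//; last by move=> z; rewrite lee_fin (local_energy_ge0 nuL).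
  under [RHS]eq_integral do rewrite -FL.
  rewrite -(fubini_tonelli1 _ mL L0) (fubini_tonelli2 _ mL L0).
  apply: eq_integral => x _; rewrite /fubini_G.
  rewrite -(@ge0_integral_translate R d x (fun y => (local_energy p nu g (y, x))%:E)).
  - apply: eq_integral => h _; rewrite /L /local_energy /= addrK mulrC.
    by rewrite [h + x]addrC.
  - exact: (measurableT_comp mlE (measurable_pair2 x)).
  - by move=> y; rewrite lee_fin (local_energy_ge0 nuL).
have mkF : measurable_fun setT (fun h => (k0 h)%:E * F h)%E.
  rewrite (_ : (fun h => _) = fubini_F leb L); last by apply/funext => h; rewrite FL.
  exact: measurable_fun_fubini_tonelli_F.
rewrite -ge0_integralZl_EFin//; last 2 first.
- by move=> h _; rewrite mule_ge0// lee_fin (kernel0_ge0 nuL).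
- by rewrite mulr_ge0// invr_ge0 ltW.
apply: (ge0_le_integral _ measurableT).
- by move=> h _; rewrite mule_ge0// lee_fin indicE.
- pose G (z : V * V) := (\1_A z.1 * `|g (z.2 + n%:R *: z.1) - g z.2| `^ p)%:E.
  have mGG : measurable_fun setT G.
    apply/measurable_EFinP; apply: measurable_funM => //.
    exact: (measurableT_comp mIA).
  have G0 z : (0 <= G z)%E by rewrite lee_fin mulr_ge0 ?powR_ge0// indicE.
  rewrite (_ : (fun h => _) = fubini_F leb G).
    exact: measurable_fun_fubini_tonelli_F.
  apply/funext => h; rewrite /fubini_F /G /F -ge0_integralZl_EFin//.
  - by apply/measurable_EFinP; exact: mshift.
- by apply: emeasurable_funM.
- move=> h _; rewrite indicE; case: (boolP (h \in A)) => [/set_mem Ah|_].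
    rewrite mul1e (le_trans (F_mul _ _))// EFinM -muleA.
    rewrite lee_wpmul2l ?lee_fin// muleA -EFinM -[leLHS]mul1e.
    by rewrite lee_wpmul2r// lee_fin ler_pdivlMl// mulr1; exact: Ak.
  rewrite mul0e mule_ge0// ?lee_fin ?mulr_ge0 ?invr_ge0 ?(ltW de0)//.
  by rewrite mule_ge0// lee_fin (kernel0_ge0 nuL).
Qed.

End translation_modulus.

End poincare.

(** * The energy space *)

Section energy_space.
Context {R : realType} {d : nat}.
Local Notation V := 'rV[R]_d.
Local Notation leb := (@lebesgue_rV R d).
Local Notation leb2 := (leb \x leb)%E.
Variables (p : R) (nu : V -> R) (Omega : set V).
Hypothesis d0 : (0 < d)%N.
Hypothesis p1 : 1 < p.
Hypothesis nuL : levy_kernel p nu.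
Hypothesis mO : measurable Omega.
Let p0 : 0 < p. Proof. by rewrite (lt_trans _ p1). Qed.
Local Notation W := (Wspace p nu Omega).
Local Notation W0 := (W0space p nu Omega).
Local Notation N := (Wnorm p nu Omega).
Local Notation T := (increment p nu Omega).
Local Notation X u := (pnorm leb2 p (T u)).
Local Notation A u := (pnorm leb p (cutoff Omega u)).

Lemma WspaceP u : W u <->
  [/\ measurable_fun setT u, inLp leb p (cutoff Omega u) & inLp leb2 p (T u)].
Proof.
split=> [[mu Lu Nu]|[mu Lu Tu]].
  have mc := measurable_cutoff mO mu; have mt := measurable_increment nuL mO mu.
  split => //; first by apply/(inLp_lty leb p mc); rewrite -(Lp_partE Omega p1).
  apply/(inLp_lty leb2 p mt).
  apply: le_lt_trans (increment_le_nu_part d0 p1 nuL mO mu) _.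
  by rewrite lte_add_pinfty.
have mc := measurable_cutoff mO mu; have mt := measurable_increment nuL mO mu.
split => //; first by rewrite (Lp_partE Omega p1); apply/(inLp_lty leb p mc).
apply: le_lt_trans (nu_part_le_increment d0 p1 nuL mO mu) _.
exact/(inLp_lty leb2 p mt).
Qed.

Lemma W_inLp u : W u -> inLp leb2 p (T u).
Proof. by move=> /WspaceP[]. Qed.

Lemma W_lin k u v : W u -> W v -> W (fun y => k * u y + v y).
Proof.
move=> /WspaceP[mu lu tu] /WspaceP[mv lv tv]; apply/WspaceP; split.
- by apply: measurable_funD => //; exact: measurable_funM.
- by rewrite cutoff_lin; apply: inLpD => //; exact: inLpZ.
- by rewrite increment_lin; apply: inLpD => //; exact: inLpZ.
Qed.

Lemma W0_cst0 : W0 (cst 0).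
Proof.
split; last by apply: aeW => x _.
have c0 : cutoff Omega (cst 0) = cst 0.
  by apply/funext => x; rewrite /cutoff /= mulr0.
have t0 : T (cst 0) = cst 0.
  by apply/funext => x; rewrite /increment /= subrr mulr0.
by apply/WspaceP; rewrite c0 t0; split => //; exact: inLp0.
Qed.

Lemma W0_lin k u v : W0 u -> W0 v -> W0 (fun y => k * u y + v y).
Proof.
move=> [wu u0] [wv v0]; split; first exact: W_lin.
by apply: filterS2 u0 v0 => x ux vx Ox; rewrite ux// vx//= mulr0 addr0.
Qed.

Lemma cutoff_norm_sub u v : W u -> W v -> A u <= A (u \- v) + A v.
Proof.
move=> /WspaceP[_ lu _] /WspaceP[_ lv _].
have E : cutoff Omega (u \- v) = (fun x => cutoff Omega u x - cutoff Omega v x).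
  by apply/funext => x; rewrite /cutoff /=; ring.
have := pnormD p1 (inLpB p1 lu lv) lv; rewrite -E.
rewrite (_ : (fun x => _) = cutoff Omega u)//.
by apply/funext => x; ring.
Qed.

Let partsE u : W u -> [/\ Lp_part p Omega u = (A u `^ p)%:E,
  nu_part p nu Omega u = (fine (nu_part p nu Omega u))%:E,
  0 <= fine (nu_part p nu Omega u),
  fine (nu_part p nu Omega u) <= X u `^ p &
  X u `^ p <= 2 * fine (nu_part p nu Omega u)].
Proof.
move=> wu; have [mu Lu Nu] := wu; have /WspaceP[_ lu tu] := wu.
have n0 : (0 <= nu_part p nu Omega u)%E.
  rewrite (nu_partE d0 nuL mO mu); apply: integral_ge0 => z _.
  by rewrite lee_fin mulr_ge0 ?(local_energy_ge0 nuL)// indicE.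
have nE : nu_part p nu Omega u = (fine (nu_part p nu Omega u))%:E.
  by rewrite fineK// ge0_fin_numE.
split => //.
- by rewrite (Lp_partE Omega p1) (pnorm_integral p1).
- by rewrite fine_ge0.
- have := nu_part_le_increment d0 p1 nuL mO mu.
  by rewrite (pnorm_integral p1 tu) nE.
- have := increment_le_nu_part d0 p1 nuL mO mu.
  by rewrite (pnorm_integral p1 tu) nE -EFinD lee_fin mulr_natl mulr2n.
Qed.

Let NE u : W u -> N u = (A u `^ p + fine (nu_part p nu Omega u)) `^ p^-1.
Proof. by move=> /partsE[h1 h2 _ _ _]; rewrite /Wnorm h1 {1}h2 -EFinD. Qed.

Lemma Wnorm_ge0 u : 0 <= N u. Proof. exact: powR_ge0. Qed.

Let pV0 : 0 <= p^-1. Proof. by rewrite invr_ge0 ltW. Qed.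

Lemma cutoff_le_Wnorm u : W u -> A u <= N u.
Proof.
move=> wu; have [_ _ n0 _ _] := partsE wu.
rewrite NE// -[leLHS](@powRKV _ p) ?gt_eqF ?pnorm_ge0//.
by apply: ler_powRl; rewrite ?powR_ge0// lerDl.
Qed.

Lemma increment_le_Wnorm u : W u -> X u <= 2 * N u.
Proof.
move=> wu; have [_ _ n0 _ h] := partsE wu; rewrite NE//.
rewrite -[leLHS](@powRKV _ p) ?gt_eqF ?pnorm_ge0//.
rewrite -[Z in _ <= Z * _](@powRKV _ p) ?gt_eqF// -powRM ?addr_ge0 ?powR_ge0//.
apply: ler_powRl; rewrite ?powR_ge0//; apply: (le_trans h).
apply: ler_pM => //; last by rewrite lerDr powR_ge0.
by apply: le1r_powR; [lra|exact: ltW].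
Qed.

Lemma Wnorm_le u : W u -> N u <= A u + X u.
Proof.
move=> wu; have [_ _ n0 h _] := partsE wu; rewrite NE//.
rewrite -[leRHS](@powRKV _ p) ?gt_eqF ?addr_ge0 ?pnorm_ge0//.
apply: ler_powRl; rewrite ?addr_ge0 ?powR_ge0//.
apply: le_trans (powR_superadd (ltW p1) (pnorm_ge0 _ _ _) (pnorm_ge0 _ _ _)).
by rewrite lerD2l.
Qed.

Lemma WnormZ a u : W u -> N (fun y => a * u y) = `|a| * N u.
Proof.
move=> wu; have [mu Lu Nu] := wu.
have mau : measurable_fun setT (fun y => a * u y) by exact: measurable_funM.
have EL : Lp_part p Omega (fun y => a * u y) = ((`|a| `^ p)%:E * Lp_part p Omega u)%E.
  rewrite /Lp_part -ge0_integralZl_EFin ?powR_ge0//; last first.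
    by apply/measurable_EFinP; apply: measurable_funTS; exact: measurable_normp.
  by apply: eq_integral => x _; rewrite -EFinM normrM powRM.
have EN : nu_part p nu Omega (fun y => a * u y) =
    ((`|a| `^ p)%:E * nu_part p nu Omega u)%E.
  rewrite !(nu_partE d0 nuL mO)//.
  rewrite -ge0_integralZl_EFin ?powR_ge0//; last 2 first.
  - by move=> z _; rewrite lee_fin mulr_ge0 ?(local_energy_ge0 nuL)// indicE.
  - apply/measurable_EFinP; apply: measurable_funM.
      by apply: (measurableT_comp (measurable_indic mO)).
    exact: (measurable_local_energy nuL).
  apply: eq_integral => z _; rewrite -EFinM; congr (_%:E).
  by rewrite /local_energy -mulrBr normrM powRM//; ring.
have [h1 h2 n0 _ _] := partsE wu.
rewrite /Wnorm EL EN h1 h2 -!EFinM -!EFinD /= -mulrDr powRM ?addr_ge0 ?powR_ge0//.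
by rewrite powRKV ?gt_eqF.
Qed.

Lemma Wnorm0 : N (cst 0) = 0.
Proof.
have h : N (fun y => 0 * (cst 0 : V -> R) y) = 0.
  by rewrite (WnormZ 0 W0_cst0.1) normr0 mul0r.
rewrite -[RHS]h; congr (Wnorm _ _ _ _).
by apply/funext => y /=; rewrite mul0r.
Qed.

(** Homogeneity gives the bound where the norm is positive; where it is zero, the
    functional vanishes because it is bounded. *)
Lemma W0dual_bound f : W0dual p nu Omega f -> 0 <= W0dual_norm p nu Omega f /\
  forall v, W0 v -> `|f v| <= W0dual_norm p nu Omega f * N v.
Proof.
move=> [flin [M HM]].
have f0 : f (cst 0) = 0.
  have := flin (-1) _ _ W0_cst0 W0_cst0.
  rewrite (_ : (fun x => _) = cst 0); last by apply/funext => x /=; ring.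
  by lra.
have hs : has_sup [set `|f v| | v in [set v | W0 v /\ N v <= 1]].
  split; first by exists `|f (cst 0)|, (cst 0) => //; split; [exact: W0_cst0|rewrite Wnorm0].
  exists `|M| => _ [v [wv Nv] <-]; apply: le_trans (HM _ wv) _.
  apply: le_trans (ler_norm _) _; rewrite normrM [Z in _ * Z]ger0_norm ?Wnorm_ge0//.
  by rewrite ler_piMr.
have ub v : W0 v -> N v <= 1 -> `|f v| <= W0dual_norm p nu Omega f.
  by move=> wv Nv; apply: ub_le_sup; [exact: hs.2|exists v].
split.
  by have [_ [v [wv Nv] _]] := hs.1; exact: le_trans (normr_ge0 _) (ub _ wv Nv).
move=> v wv; have [Nv0|Nv0] := leP (N v) 0.
  have Nv : N v = 0 by apply/eqP; rewrite eq_le Nv0 Wnorm_ge0.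
  by have := HM _ wv; rewrite Nv !mulr0.
have wz : W0 (fun y => (N v)^-1 * v y + cst 0 y) by exact: W0_lin wv W0_cst0.
have E : (fun y => (N v)^-1 * v y + cst 0 y) = (fun y => (N v)^-1 * v y).
  by apply/funext => y /=; rewrite addr0.
have := ub _ wz; rewrite flin//; last exact: W0_cst0.
rewrite f0 addr0 E WnormZ; last by case: wv.
rewrite ger0_norm ?invr_ge0 ?Wnorm_ge0// mulVf ?gt_eqF// => /(_ (lexx _)).
by rewrite normrM ger0_norm ?invr_ge0 ?Wnorm_ge0// ler_pdivrMl// mulrC.
Qed.

Lemma ae_product (P : V -> Prop) : {ae leb, forall x, P x} ->
  {ae leb2, forall z, P z.1 /\ P z.2}.
Proof.
move=> [N0 [mN N00 PN]].
have m1 : measurable (N0 `*` (setT : set V)) by exact: measurableX.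
have m2 : measurable ((setT : set V) `*` N0) by exact: measurableX.
exists ((N0 `*` setT) `|` (setT `*` N0)); split; first exact: measurableU.
  apply: measure_negligible; first exact: measurableU.
  apply: negligibleU.
    exists (N0 `*` setT); split => //.
    by apply: eq_trans (product_measure1E _ _ mN measurableT) _;
      rewrite [Z in (Z * _)%E](_ : _ = 0%E) ?mul0e.
  exists (setT `*` N0); split => //.
  by apply: eq_trans (product_measure1E _ _ measurableT mN) _;
    rewrite [Z in (_ * Z)%E](_ : _ = 0%E) ?mule0.
by move=> z /= /not_andP[Pz|Pz]; [left|right]; split => //; exact: PN.
Qed.

Lemma cutoff_ae v : W0 v -> {ae leb, forall x, v x = cutoff Omega v x}.
Proof.
move=> [_ v0]; apply: filterS v0 => x vx; rewrite /cutoff indicE.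
have [Ox|Ox] := pselect (Omega x); first by rewrite mem_set// mul1r.
by rewrite memNset// mul0r vx.
Qed.

Lemma poincare : bounded_in_one_direction Omega \/ (leb Omega < +oo)%E ->
  exists2 C : R, 0 <= C & forall v, W0 v -> A v <= C * X v.
Proof.
move=> dom.
have [n [de [c [B [de0 c0 mB Bk Bc]]]]] := jumps_leave_domain d0 nuL mO dom.
have K0 : 0 <= shift_const p n / de.
  rewrite mulr_ge0 ?invr_ge0 ?(ltW de0)//.
  by elim: (n) => //= j IH; rewrite mulr_ge0 ?powR_ge0// addr_ge0.
exists ((c^-1 * (shift_const p n / de)) `^ p^-1); first exact: powR_ge0.
move=> v wv; have /WspaceP[mv lv tv] := wv.1.
have mg := measurable_cutoff mO mv.
have g0 x : ~ Omega x -> cutoff Omega v x = 0.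
  by move=> Ox; rewrite /cutoff indicE memNset// mul0r.
have := poincare_shift p1 nuL mO mg g0 de0 (ltW c0) mB Bk Bc.
rewrite (pnorm_integral p1 lv).
have -> : (\int[leb2]_z (local_energy p nu (cutoff Omega v) z)%:E =
    \int[leb2]_z (`|T (cutoff Omega v) z| `^ p)%:E)%E.
  apply: eq_integral => z _; rewrite (increment_pow Omega p1 nuL) indicE.
  have [Qz|Qz] := pselect ((~` (~` Omega `*` ~` Omega)) z).
    by rewrite mem_set// mul1r.
  rewrite memNset// mul0r /local_energy.
  move: Qz; rewrite /setC /= => /contrapT[z1 z2].
  by rewrite !g0// subrr normr0 powR0 ?mul0r// gt_eqF.
have [tg Xg] : inLp leb2 p (T (cutoff Omega v)) /\
    pnorm leb2 p (T (cutoff Omega v)) = X v.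
  apply: (ae_eq_inLp p1 _ _ tv); first exact: measurable_increment.
  apply: filterS (ae_product (cutoff_ae wv)) => z [z1 z2].
  by rewrite /increment z1 z2.
rewrite (pnorm_integral p1 tg) Xg -!EFinM lee_fin -ler_pdivlMl// mulrA => h.
rewrite -[leLHS](@powRKV _ p) ?gt_eqF ?pnorm_ge0//.
rewrite -[Z in _ <= _ * Z](@powRKV _ p) ?gt_eqF ?pnorm_ge0//.
have cK0 : 0 <= c^-1 * (shift_const p n / de).
  by apply: mulr_ge0 => //; rewrite invr_ge0 ltW.
by rewrite -powRM ?powR_ge0//; apply: ler_powRl; rewrite ?powR_ge0.
Qed.

(** By Poincare's inequality the restrictions to the domain are Cauchy too, so a
    subsequence converges almost everywhere, and then so do its increments.
    Fatou's lemma for [T (v_ i - v_ (phi k))] in the variable [k] gives the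
    convergence in norm. *)
Lemma W0_complete (C : R) : 0 <= C -> (forall v, W0 v -> A v <= C * X v) ->
  forall v_ : nat -> V -> R, (forall n, W0 (v_ n)) ->
  (forall e : R, 0 < e -> exists K, forall i j, (K <= i)%N -> (K <= j)%N ->
     pnorm leb2 p (fun x => T (v_ i) x - T (v_ j) x) <= e) ->
  exists2 v, W0 v & (fun n => pnorm leb2 p (fun x => T (v_ n) x - T v x)) @ \oo --> (0 : R).
Proof.
move=> C0 HC v_ wv cv.
have lc n : inLp leb p (cutoff Omega (v_ n)) by have /WspaceP[] := (wv n).1.
have lt n : inLp leb2 p (T (v_ n)) by exact: W_inLp (wv n).1.
have subE i j : W0 (fun y => -1 * v_ j y + v_ i y) by exact: W0_lin.
have cc e : 0 < e -> exists K, forall i j, (K <= i)%N -> (K <= j)%N ->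
    pnorm leb p (fun x => cutoff Omega (v_ i) x - cutoff Omega (v_ j) x) <= e.
  move=> e0; have C1 : 0 < C + 1 by rewrite ltr_wpDl.
  have [|K HK] := cv (e / (C + 1)); first by rewrite divr_gt0.
  exists K => i j Ki Kj; have := HC _ (subE i j).
  rewrite cutoff_lin increment_lin.
  rewrite (_ : (fun x => _) = (fun x => cutoff Omega (v_ i) x - cutoff Omega (v_ j) x));
    last by apply/funext => x; ring.
  rewrite (_ : (fun z => -1 * _ + _) = (fun x => T (v_ i) x - T (v_ j) x));
    last by apply/funext => x; ring.
  move=> h; apply: (le_trans h); have := HK _ _ Ki Kj.
  rewrite ler_pdivlMr// => h2; apply: le_trans h2; rewrite mulrC.
  by rewrite ler_wpM2l ?pnorm_ge0// lerDl.
have [phi [w mw [phik wcvg]]] := Lp_cauchy_subsequence p1 lc cc.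
pose v := cutoff Omega w.
have mv : measurable_fun setT v by exact: measurable_cutoff.
have vcvg : {ae leb, forall x, (fun k => v_ (phi k) x) @ \oo --> v x}.
  have h : {ae leb, forall x, forall k, v_ (phi k) x = cutoff Omega (v_ (phi k)) x}.
    by apply: ae_foralln => k; exact: cutoff_ae.
  apply: filterS2 wcvg h => x wx hx.
  under eq_fun do rewrite hx.
  have [Ox|Ox] := pselect (Omega x).
    by have -> : v x = w x by rewrite /v /cutoff indicE mem_set// mul1r.
  rewrite /v /cutoff indicE memNset// mul0r.
  by under eq_fun do rewrite mul0r; exact: cvg_cst.
have tcvg : {ae leb2, forall z, (fun k => T (v_ (phi k)) z) @ \oo --> T v z}.
  apply: filterS (ae_product vcvg) => z [z1 z2].
  by rewrite /increment; apply: cvgMr; exact: cvgB.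
have mT : measurable_fun setT (T v) by exact: measurable_increment.
have key e : 0 < e -> exists K, forall i, (K <= i)%N ->
    inLp leb2 p (fun z => T (v_ i) z - T v z) /\
    pnorm leb2 p (fun z => T (v_ i) z - T v z) <= e.
  move=> e0; have [K HK] := cv _ e0; exists K => i Ki.
  apply: (@pnorm_fatou _ _ _ leb2 p p1
    (fun k z => T (v_ i) z - T (v_ (phi (k + K)%N)) z)).
  - by move=> k; exact: inLpB.
  - by apply: measurable_funB => //; exact: (lt i).1.
  - exact: ltW.
  - apply: filterS tcvg => z zc; apply: cvgB; first exact: cvg_cst.
    by move: zc; rewrite -(cvg_shiftn K).
  - by move=> k; apply: HK => //; rewrite (leq_trans _ (phik _))// leq_addl.
have lTv : inLp leb2 p (T v).
  have [K /(_ K (leqnn K))[h _]] := key 1 ltr01.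
  have := inLpB p1 (lt K) h.
  rewrite (_ : (fun z => _) = T v)//; by apply/funext => z; ring.
have lv : inLp leb p (cutoff Omega v).
  have [K HK] := cv 1 ltr01.
  have [] // := @pnorm_fatou _ _ _ leb p p1 (fun k => cutoff Omega (v_ (phi (k + K)%N)))
    (cutoff Omega v) (C * (X (v_ K) + 1)).
  - exact: measurable_cutoff.
  - by rewrite mulr_ge0// addr_ge0// pnorm_ge0.
  - apply: filterS vcvg => x xc; rewrite /cutoff; apply: cvgMr.
    by move: xc; rewrite -(cvg_shiftn K).
  - move=> k; apply: le_trans (HC _ (wv _)) _; rewrite ler_wpM2l//.
    set i := phi _; have Ki : (K <= i)%N by rewrite (leq_trans _ (phik _))// leq_addl.
    have := pnormD p1 (inLpB p1 (lt i) (lt K)) (lt K).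
    rewrite (_ : (fun z => T (v_ i) z - T (v_ K) z + T (v_ K) z) = T (v_ i)); last first.
      by apply/funext => z; ring.
    by have := HK _ _ Ki (leqnn K); lra.
exists v.
  split; first exact/WspaceP.
  by apply: aeW => x Ox; rewrite /v /cutoff indicE memNset// mul0r.
apply/cvgrPdist_le => e e0; have [K HK] := key _ e0.
exists K => // i Ki; rewrite sub0r normrN ger0_norm ?pnorm_ge0//.
by have [] := HK _ Ki.
Qed.

End energy_space.

(** * The Dirichlet problem *)

Section dirichlet_problem.
Context {R : realType} {d : nat}.
Local Notation V := 'rV[R]_d.
Local Notation leb := (@lebesgue_rV R d).
Local Notation leb2 := (leb \x leb)%E.
Variables (p : R) (nu : V -> R) (Omega : set V).
Hypothesis d0 : (0 < d)%N.
Hypothesis p1 : 1 < p.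
Hypothesis nuL : levy_kernel p nu.
Hypothesis mO : measurable Omega.
Hypothesis domO : bounded_in_one_direction Omega \/ (leb Omega < +oo)%E.
Let p0 : 0 < p. Proof. by rewrite (lt_trans _ p1). Qed.
Let p10 : 0 < p - 1. Proof. by rewrite subr_gt0. Qed.
Let q0 : 0 < p / (p - 1). Proof. by rewrite divr_gt0. Qed.
Local Notation W := (Wspace p nu Omega).
Local Notation W0 := (W0space p nu Omega).
Local Notation N := (Wnorm p nu Omega).
Local Notation T := (increment p nu Omega).
Local Notation W' := (W0dual p nu Omega).
Local Notation N' := (W0dual_norm p nu Omega).
Local Notation Nt := (Tnorm p nu Omega).
Local Notation ext := (is_extension p nu Omega).
Local Notation V0 := (weak_solution p nu Omega).
Local Notation E := (energy p nu Omega).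

Let W0W : W0 `<=` W. Proof. by move=> u []. Qed.

Lemma Wspace_sub u v : W u -> W v -> W (u \- v).
Proof. by apply: (closed_sub (W := W)) => k a b; exact: W_lin. Qed.

Lemma energy_pform u v : W u -> W v -> E u v = pform leb2 p (T u) (T v).
Proof. by move=> [mu _ _] [mv _ _]; exact: energyE. Qed.

Lemma energy_diag u : W u -> E u u = pnorm leb2 p (T u) `^ p.
Proof. by move=> wu; rewrite energy_pform// pform_diag. Qed.

Lemma weak_solutionP f g u : V0 f g u ->
  [/\ ext g u, forall g', ext g g' -> W0 (u \- g') &
      forall v, W0 v -> pform leb2 p (T u) (T v) = f v].
Proof.
move=> [wu [g' [wg' g'g] [_ ug']] sol].
have ug : ae_eq_compl Omega u g.
  apply: filterS2 g'g ug' => x h1 h2 Ox.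
  by rewrite -(h1 Ox); apply/eqP; rewrite -subr_eq0; apply/eqP; exact: h2.
split.
- by split.
- move=> h [wh hg]; split; first exact: (Wspace_sub wu wh).
  by apply: filterS2 ug hg => x h1 h2 Ox /=; rewrite h1// h2// subrr.
- by move=> v wv; rewrite -(energy_pform wu (W0W wv)); exact: sol.
Qed.

Lemma extension_sub g1 g2 u1 u2 h : ext g1 u1 -> ext g2 u2 ->
  ext (g1 \- g2) h -> W0 ((u1 \- u2) \- h).
Proof.
move=> [w1 e1] [w2 e2] [wh eh]; split.
  exact: (Wspace_sub (Wspace_sub w1 w2) wh).
apply: filterS2 (filterI e1 e2) eh => x [h1 h2] h3 Ox /=.
by rewrite h1// h2// h3// subrr.
Qed.

Lemma W0dual_sub f1 f2 : W' f1 -> W' f2 -> W' (f1 \- f2).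
Proof.
move=> [l1 [M1 H1]] [l2 [M2 H2]]; split.
  by move=> a u v wu wv /=; rewrite l1// l2//; ring.
exists (M1 + M2) => v wv /=; rewrite mulrDl (le_trans (ler_normB _ _))// lerD//.
  exact: H1.
exact: H2.
Qed.

Lemma has_inf_extension g : Tspace p nu Omega g -> has_inf [set N u | u in ext g].
Proof.
move=> [u eu]; split; first by exists (N u), u.
by exists 0 => _ [v _ <-]; exact: Wnorm_ge0.
Qed.

Lemma Tnorm_ge0 g : Tspace p nu Omega g -> 0 <= Nt g.
Proof.
move=> Tg; apply: lb_le_inf; first exact: (has_inf_extension Tg).1.
by move=> _ [v _ <-]; exact: Wnorm_ge0.
Qed.

Lemma le_Tnorm (phi : R -> R) g c : continuous phi -> Tspace p nu Omega g ->
  (forall h, ext g h -> c <= phi (N h)) -> c <= phi (Nt g).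
Proof.
move=> cphi Tg H; apply: (le_continuous_inf (has_inf_extension Tg) cphi).
by move=> _ [h eh <-]; exact: H.
Qed.

Lemma solution_exists f g : W' f -> Tspace p nu Omega g -> exists u, V0 f g u.
Proof.
move=> Wf [g' [wg' g'g]].
have [C C0 HC] := poincare d0 p1 nuL mO domO.
have [F0 HF] := W0dual_bound d0 p1 nuL mO Wf.
have FC v : W0 v -> `|f v| <= N' f * (C + 1) * pnorm leb2 p (T v).
  move=> wv; apply: le_trans (HF v wv) _; rewrite -mulrA ler_wpM2l//.
  apply: le_trans (Wnorm_le d0 p1 nuL mO (W0W wv)) _.
  by rewrite mulrDl mul1r lerD2r; exact: HC.
have [v wv Hv] := direct_method p1 (increment_lin p nu Omega)
  (W0_cst0 d0 p1 nuL mO) (fun k u v => @W0_lin R d p nu Omega d0 p1 nuL mO k u v)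
  (fun u wu => W_inLp d0 p1 nuL mO (W0W wu))
  (W0_complete d0 p1 nuL mO C0 HC) (W_inLp d0 p1 nuL mO wg')
  (mulr_ge0 F0 (addr_ge0 C0 ler01)) Wf.1 FC.
exists (fun y => 1 * g' y + v y).
have wu := W_lin d0 p1 nuL mO 1 wg' (W0W wv).
split; first exact: wu.
  exists g'; first by split.
  suff -> : (fun y => 1 * g' y + v y) \- g' = v by [].
  by apply/funext => y /=; ring.
move=> w ww; rewrite (energy_pform wu (W0W ww)).
rewrite -(Hv _ ww) increment_lin; congr (pform _ _ _ _).
by apply/funext => z; rewrite mul1r.
Qed.

Lemma solution_bound : exists2 C : R, 0 < C & forall f g u,
  W' f -> Tspace p nu Omega g -> V0 f g u ->
  (forall g', ext g g' -> E u u <= C * (N' f `^ (p / (p - 1)) + E g' g')) /\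
  N u <= C * (N' f `^ (p / (p - 1)) + Nt g `^ p) `^ p^-1.
Proof.
have [C C0 HC] := poincare d0 p1 nuL mO domO.
pose A u := pnorm leb p (cutoff Omega u).
have [l l0 Hl] := @energy_bound R _ _ leb2 p p1 _ T W W0 (increment_lin p nu Omega)
  W0W (fun u => @W_inLp R d p nu Omega d0 p1 nuL mO u) A N
  (Wnorm_ge0 p nu Omega) (fun u => @Wnorm_le R d p nu Omega d0 p1 nuL mO u) C C0 HC.
have [l' l'0 Hl'] := @norm_bound R _ _ leb2 p p1 _ T W W0 (increment_lin p nu Omega)
  W0W (fun u => @W_inLp R d p nu Omega d0 p1 nuL mO u) A N
  (fun u v => @cutoff_norm_sub R d p nu Omega d0 p1 nuL mO u v)
  (Wnorm_ge0 p nu Omega)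
  (fun u => @cutoff_le_Wnorm R d p nu Omega d0 p1 nuL mO u)
  (fun u => @increment_le_Wnorm R d p nu Omega d0 p1 nuL mO u)
  (fun u => @Wnorm_le R d p nu Omega d0 p1 nuL mO u) C C0 HC.
exists (l `^ p + l'); first by rewrite addr_gt0// powR_gt0.
move=> f g u Wf Tg /weak_solutionP[[wu ug] uW0 sol].
have [F0 HF] := W0dual_bound d0 p1 nuL mO Wf.
split=> [g' eg'|].
  have wg' := eg'.1; rewrite (energy_diag wu) (energy_diag wg').
  have S0 : 0 <= N' f `^ (p / (p - 1)) + pnorm leb2 p (T g') `^ p.
    by rewrite addr_ge0// powR_ge0.
  have := ler_powRl (ltW p0) (pnorm_ge0 _ _ _) (Hl _ _ _ _ wu wg' (uW0 _ eg') sol F0 HF).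
  rewrite powRM ?powR_ge0 ?(ltW l0)// powRVK ?gt_eqF// => h.
  by apply: (le_trans h); rewrite ler_wpM2r// lerDl ltW.
(* the norms make [phi] continuous on the whole line *)
pose phi (t : R) : R := l' * `|N' f `^ (p / (p - 1)) + `|t| `^ p| `^ p^-1.
have cphi : continuous phi.
  move=> t; apply: cvgMr.
  apply: (@cvg_comp _ _ _ (fun t => N' f `^ (p / (p - 1)) + `|t| `^ p)
    (fun s : R => `|s| `^ p^-1)); last first.
    by apply: continuous_normr_powR; rewrite invr_gt0.
  by apply: cvgD; [exact: cvg_cst|exact: continuous_normr_powR].
have phiE t : 0 <= t -> phi t = l' * (N' f `^ (p / (p - 1)) + t `^ p) `^ p^-1.
  by move=> t0; rewrite /phi (ger0_norm t0) ger0_norm// addr_ge0// powR_ge0.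
apply: (@le_trans _ _ (phi (Nt g))).
  apply: (le_Tnorm cphi Tg) => h eh; rewrite phiE ?Wnorm_ge0//.
  exact: Hl' wu eh.1 (uW0 _ eh) sol F0 HF.
by rewrite phiE ?Tnorm_ge0// ler_wpM2r ?powR_ge0// lerDr powR_ge0.
Qed.

Let D a1 a2 : R := a1 `^ (p / (p - 1))^-1 + a2 `^ (p / (p - 1))^-1.

Lemma solution_stability : exists2 C : R, 0 < C & forall f1 f2 g1 g2 u1 u2,
  W' f1 -> W' f2 -> Tspace p nu Omega g1 -> Tspace p nu Omega g2 ->
  V0 f1 g1 u1 -> V0 f2 g2 u2 ->
  let DD := D (N' f1 `^ (p / (p - 1)) + Nt g1 `^ p)
              (N' f2 `^ (p / (p - 1)) + Nt g2 `^ p) in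
  let K := (DD `^ (p - 1)^-1 + DD) `^ 2^-1 in
  (2 <= p -> N (u1 \- u2) <=
     C * (N' (f1 \- f2) `^ (p - 1)^-1 + Nt (g1 \- g2)
          + DD `^ p^-1 * Nt (g1 \- g2) `^ p^-1)) /\
  (p < 2 -> N (u1 \- u2) <=
     C * (DD `^ ((2 - p) / (p - 1)) * N' (f1 \- f2) + Nt (g1 \- g2)
          + K * Nt (g1 \- g2) `^ 2^-1)).
Proof.
have [C C0 HC] := poincare d0 p1 nuL mO domO.
have [l l0 Hl] := solution_bound.
pose A u := pnorm leb p (cutoff Omega u).
have B0 : 0 <= 2 * l by rewrite mulr_ge0// ltW.
have bound f g u : W' f -> Tspace p nu Omega g -> V0 f g u ->
    pnorm leb2 p (T u) <= 2 * l * (N' f `^ (p / (p - 1)) + Nt g `^ p) `^ p^-1.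
  move=> Wf Tg sol; have [[wu _] _ _] := weak_solutionP sol.
  apply: le_trans (increment_le_Wnorm d0 p1 nuL mO wu) _; rewrite -mulrA ler_wpM2l//.
  exact: (Hl _ _ _ Wf Tg sol).2.
have TgB g1 g2 : Tspace p nu Omega g1 -> Tspace p nu Omega g2 ->
    Tspace p nu Omega (g1 \- g2).
  move=> [h1 [w1 e1]] [h2 [w2 e2]]; exists (h1 \- h2); split; first exact: (Wspace_sub w1 w2).
  by apply: filterS2 e1 e2 => x h3 h4 Ox /=; rewrite h3// h4.
have a0 f g : 0 <= N' f `^ (p / (p - 1)) + Nt g `^ p.
  by rewrite addr_ge0// powR_ge0.
have [p2|p2] := leP 2 p.
  have [Cs Cs0 HCs] := @stability_ge2 R _ _ leb2 p p1 _ T W W0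
    (increment_lin p nu Omega)
    (fun k u v => @W_lin R d p nu Omega d0 p1 nuL mO k u v)
    W0W (fun u => @W_inLp R d p nu Omega d0 p1 nuL mO u) A N
    (fun u v => @cutoff_norm_sub R d p nu Omega d0 p1 nuL mO u v)
    (Wnorm_ge0 p nu Omega)
    (fun u => @cutoff_le_Wnorm R d p nu Omega d0 p1 nuL mO u)
    (fun u => @increment_le_Wnorm R d p nu Omega d0 p1 nuL mO u)
    (fun u => @Wnorm_le R d p nu Omega d0 p1 nuL mO u) C C0 HC _ B0 p2.
  exists Cs => // f1 f2 g1 g2 u1 u2 Wf1 Wf2 Tg1 Tg2 sol1 sol2 DD K; split=> // _.
  have [e1 _ s1] := weak_solutionP sol1; have [e2 _ s2] := weak_solutionP sol2.
  have Wf12 := W0dual_sub Wf1 Wf2; have [F0 HF] := W0dual_bound d0 p1 nuL mO Wf12.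
  pose phi (t : R) : R := Cs * (N' (f1 \- f2) `^ (p - 1)^-1 + `|t|
          + DD `^ p^-1 * `|t| `^ p^-1).
  have cphi : continuous phi.
    move=> t; apply: cvgMr; apply: cvgD.
      by apply: cvgD; [exact: cvg_cst|exact: norm_continuous].
    by apply: cvgMr; apply: continuous_normr_powR; rewrite invr_gt0.
  have phiE t : 0 <= t -> phi t = Cs * (N' (f1 \- f2) `^ (p - 1)^-1 + t
          + DD `^ p^-1 * t `^ p^-1).
    by move=> t0; rewrite /phi (ger0_norm t0).
  rewrite -phiE ?Tnorm_ge0//; last exact: (TgB _ _ Tg1 Tg2).
  apply: (le_Tnorm cphi (TgB _ _ Tg1 Tg2)).
  move=> h eh; rewrite phiE ?Wnorm_ge0//.
  exact: (HCs _ _ _ _ _ _ _ _ e1.1 e2.1 eh.1 (extension_sub e1 e2 eh) s1 s2 F0 HF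
    (a0 _ _) (a0 _ _) (bound _ _ _ Wf1 Tg1 sol1) (bound _ _ _ Wf2 Tg2 sol2)).
have [Cs Cs0 HCs] := @stability_lt2 R _ _ leb2 p p1 _ T W W0
  (increment_lin p nu Omega)
  (fun k u v => @W_lin R d p nu Omega d0 p1 nuL mO k u v)
  W0W (fun u => @W_inLp R d p nu Omega d0 p1 nuL mO u) A N
  (fun u v => @cutoff_norm_sub R d p nu Omega d0 p1 nuL mO u v)
  (Wnorm_ge0 p nu Omega)
  (fun u => @cutoff_le_Wnorm R d p nu Omega d0 p1 nuL mO u)
  (fun u => @increment_le_Wnorm R d p nu Omega d0 p1 nuL mO u)
  (fun u => @Wnorm_le R d p nu Omega d0 p1 nuL mO u) C C0 HC _ B0 p2.
exists Cs => // f1 f2 g1 g2 u1 u2 Wf1 Wf2 Tg1 Tg2 sol1 sol2 DD K.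
split=> [|_]; first by rewrite leNgt => /negP.
have [e1 _ s1] := weak_solutionP sol1; have [e2 _ s2] := weak_solutionP sol2.
have Wf12 := W0dual_sub Wf1 Wf2; have [F0 HF] := W0dual_bound d0 p1 nuL mO Wf12.
pose phi (t : R) : R := Cs * (DD `^ ((2 - p) / (p - 1)) * N' (f1 \- f2) + `|t|
        + K * `|t| `^ 2^-1).
have cphi : continuous phi.
  move=> t; apply: cvgMr; apply: cvgD.
    by apply: cvgD; [exact: cvg_cst|exact: norm_continuous].
  by apply: cvgMr; apply: continuous_normr_powR; rewrite invr_gt0.
have phiE t : 0 <= t -> phi t = Cs * (DD `^ ((2 - p) / (p - 1)) * N' (f1 \- f2) + t
        + K * t `^ 2^-1).
  by move=> t0; rewrite /phi (ger0_norm t0).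
rewrite -phiE ?Tnorm_ge0//; last exact: (TgB _ _ Tg1 Tg2).
apply: (le_Tnorm cphi (TgB _ _ Tg1 Tg2)).
move=> h eh; rewrite phiE ?Wnorm_ge0//.
exact: (HCs _ _ _ _ _ _ _ _ e1.1 e2.1 eh.1 (extension_sub e1 e2 eh) s1 s2 F0 HF
  (a0 _ _) (a0 _ _) (bound _ _ _ Wf1 Tg1 sol1) (bound _ _ _ Wf2 Tg2 sol2)).
Qed.

Lemma Wnorm0_ae u : W0 u -> N u = 0 -> {ae leb, forall x, u x = 0}.
Proof.
move=> wu Nu; have /(WspaceP d0 p1 nuL mO)[mu lu _] := wu.1.
have A0 : pnorm leb p (cutoff Omega u) = 0.
  apply/eqP; rewrite eq_le pnorm_ge0 andbT -Nu.
  exact: (cutoff_le_Wnorm d0 p1 nuL mO wu.1).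
have mc := measurable_cutoff mO mu.
have := pnorm_integral p1 lu; rewrite A0 powR0 ?gt_eqF// => h.
have : (\int[leb]_x `|(`|cutoff Omega u x| `^ p)%:E| = 0)%E.
  by rewrite -[RHS]h; apply: eq_integral => x _; rewrite gee0_abs// lee_fin powR_ge0.
have mp : measurable_fun setT (fun x => (`|cutoff Omega u x| `^ p)%:E).
  by apply/measurable_EFinP; exact: measurable_normp.
move/(ae_eq_integral_abs leb measurableT mp) => cu.
apply: filterS2 cu (cutoff_ae wu) => x /(_ I) /= [cx ->].
by have /eqP := powR_eq0_eq0 cx; rewrite normr_eq0 => /eqP.
Qed.

(** Stability with equal data bounds the norm of the difference by zero. *)
Lemma solution_unique f g u v : W' f -> Tspace p nu Omega g ->
  V0 f g u -> V0 f g v -> {ae leb, forall x, v x = u x}.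
Proof.
move=> Wf Tg su sv; have [C C0 HC] := solution_stability.
have [eu uW0 _] := weak_solutionP su; have [ev vW0 _] := weak_solutionP sv.
have N0 : Nt (g \- g) = 0.
  have e0 : ext (g \- g) (cst 0).
    split; first exact: (W0_cst0 d0 p1 nuL mO).1.
    by apply: aeW => x _ /=; rewrite subrr.
  apply/eqP; rewrite eq_le Tnorm_ge0 ?andbT; last by exists (cst 0).
  rewrite -(Wnorm0 d0 p1 nuL mO); apply: ge_inf; last by exists (cst 0).
  by exists 0 => _ [w _ <-]; exact: Wnorm_ge0.
have F0 : N' (f \- f) = 0.
  have Wff := W0dual_sub Wf Wf; have [F0 HF] := W0dual_bound d0 p1 nuL mO Wff.
  apply/eqP; rewrite eq_le F0 andbT; apply: ge_sup.
    exists `|(f \- f) (cst 0)|, (cst 0) => //; split; first exact: W0_cst0.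
    by rewrite (Wnorm0 d0 p1 nuL mO).
  by move=> _ [w _ <-] /=; rewrite subrr normr0.
have Nvu : N (v \- u) = 0.
  apply/eqP; rewrite eq_le Wnorm_ge0 andbT.
  have [h1 h2] := HC _ _ _ _ _ _ Wf Wf Tg Tg sv su.
  have [p2|p2] := leP 2 p.
    apply: le_trans (h1 p2) _.
    by rewrite F0 N0 !powR0 ?invr_eq0 ?gt_eqF// mulr0 !addr0 mulr0.
  apply: le_trans (h2 p2) _.
  by rewrite F0 N0 !powR0 ?invr_eq0 ?pnatr_eq0// !mulr0 !addr0 mulr0.
have := Wnorm0_ae (vW0 _ eu) Nvu; apply: filterS => x /= h.
by apply/eqP; rewrite -subr_eq0; apply/eqP.
Qed.

End dirichlet_problem.

Theorem theorem8p18 (R : realType) (d : nat) (p : R) (nu : 'rV[R]_d -> R)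
    (Omega : set 'rV[R]_d) :
  (0 < d)%N -> 1 < p -> levy_kernel p nu -> open Omega ->
  bounded_in_one_direction Omega \/ (lebesgue_rV d Omega < +oo)%E ->
  let p' := p / (p - 1) in
  let W := Wspace p nu Omega in
  let W' := W0dual p nu Omega in
  let T := Tspace p nu Omega in
  let normW := Wnorm p nu Omega in
  let normW' := W0dual_norm p nu Omega in
  let normT := Tnorm p nu Omega in
  let E := energy p nu Omega in
  let V0 := weak_solution p nu Omega in
  [/\ forall f g, W' f -> T g ->
        exists u, V0 f g u /\
          forall v, V0 f g v -> {ae lebesgue_rV d, forall x, v x = u x},
      exists2 C : R, 0 < C & forall f g u, W' f -> T g -> V0 f g u ->
        (forall g', is_extension p nu Omega g g' ->
           E u u <= C * (normW' f `^ p' + E g' g')) /\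
        normW u <= C * (normW' f `^ p' + normT g `^ p) `^ p^-1 &
      exists2 C : R, 0 < C & forall f1 f2 g1 g2 u1 u2,
        W' f1 -> W' f2 -> T g1 -> T g2 -> V0 f1 g1 u1 -> V0 f2 g2 u2 ->
        let D := (normW' f1 `^ p' + normT g1 `^ p) `^ p'^-1
               + (normW' f2 `^ p' + normT g2 `^ p) `^ p'^-1 in
        let K := (D `^ (p - 1)^-1 + D) `^ 2^-1 in
        (2 <= p ->
           normW (u1 \- u2) <=
             C * (normW' (f1 \- f2) `^ (p - 1)^-1 + normT (g1 \- g2)
                  + D `^ p^-1 * normT (g1 \- g2) `^ p^-1)) /\
        (p < 2 ->
           normW (u1 \- u2) <=
             C * (D `^ ((2 - p) / (p - 1)) * normW' (f1 \- f2)
                  + normT (g1 \- g2)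
                  + K * normT (g1 \- g2) `^ 2^-1))].
Proof.
move=> d0 p1 nuL oO domO p' W W' T normW normW' normT E V0.
have mO : measurable Omega by exact: measurable_rV_open.
split; last 2 first.
- exact: solution_bound.
- exact: solution_stability.
move=> f g Wf Tg; have [u su] := solution_exists d0 p1 nuL mO domO Wf Tg.
exists u; split => // v sv.
exact: (solution_unique d0 p1 nuL mO domO Wf Tg su sv).
Qed.
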